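(* Let $I\subset\mathbb{R}$ be an interval with $0\in I$, let $l:I\to\mathbb{R}$ be a $C^\infty$ function such that $P=l^{-1}(0)$ is a discrete set, and let $H:I\setminus P\to\mathbb{R}$ be a $C^\infty$ function such that $Hl$ extends to a $C^\infty$ function on $I$. Put $$\eta(u)=\int_0^u 2l(v)H(v)\,dv,\quad F(t)=\int_0^t l(u)\sin\eta(u)\,du,\quad G(t)=\int_0^t l(u)\cos\eta(u)\,du .$$ Let $c_1,c_2\in\mathbb{R}$ be such that $(F(t)-c_1)^2+(G(t)-c_2)^2>0$ for all $t\in I$, and let $\gamma=(x,y):I\to\mathbb{R}^2$ be a curve given by $$y(t)=\big((F(t)-c_1)^2+(G(t)-c_2)^2\big)^{1/2},\qquad x'(t)=\frac{F'(t)(G(t)-c_2)-G'(t)(F(t)-c_1)}{y(t)} .$$ Let $p\in I$ with $l(p)=0$. Then $\gamma$ at $p$ is (1) a $3/2$-cusp if and only if $l'\eta'\neq0$ holds at $p$; (2) a $5/2$-cusp if and only if $l'\neq0$, $\eta'=0$ and $l''\eta''-l'\eta'''\neq0$ hold at $p$; (3) a $4/3$-cusp if and only if $l'=0$ and $\eta'l''\neq0$ hold at $p$; (4) a $5/3$-cusp if and only if $l'=\eta'=0$ and $\eta''l''\neq0$ hold at $p$.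
   Context: Here $Hl$ (and the integrand $2lH$ in $\eta$) denotes the $C^\infty$ extension to $I$, and ${}'=d/dt$. Two $C^\infty$ map-germs $f_1,f_2:(\mathbb{R}^m,0)\to(\mathbb{R}^n,0)$ are $\mathcal{A}$-equivalent if there exist diffeomorphism-germs $S:(\mathbb{R}^m,0)\to(\mathbb{R}^m,0)$ and $T:(\mathbb{R}^n,0)\to(\mathbb{R}^n,0)$ such that $f_2\circ S=T\circ f_1$; germs at other points are compared after translating source and target points to the origin. For $(i,j)\in\{(2,3),(2,5),(3,4),(3,5)\}$, a singular point $p$ of a curve $\gamma$ (a point with $\gamma'(p)=0$) is called a $j/i$-cusp if the map-germ $\gamma$ at $p$ is $\mathcal{A}$-equivalent to the germ $t\mapsto(t^i,t^j)$ at $0$. *)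

(* Defs.v *)
From Stdlib Require Import Reals.
From Coquelicot Require Import Coquelicot.
Open Scope R_scope.

(** * Intervals *)

(* Any endpoints may belong to [I] or not; one-point sets are excluded because
   derivatives along [I] have no meaning there. *)
Definition is_interval (I : R -> Prop) : Prop :=
  (forall a b t, I a -> I b -> a <= t <= b -> I t) /\
  (exists a b, I a /\ I b /\ a < b).

Definition is_discrete (P : R -> Prop) : Prop :=
  forall p, P p -> locally p (fun t => P t -> t = p).

(** * Smooth maps *)

(* [f] is C^k on [U]: [f] is differentiable and all its directional derivatives
   [x |-> df_x(v)] are C^(k-1).  This is the usual notion when [U] is open and
   [V] is finite-dimensional, the only case in which it is used. *)
Fixpoint Ck {V W : NormedModule R_AbsRing} (k : nat) (U : V -> Prop)
    (f : V -> W) : Prop :=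
  match k with
  | O => forall x, U x -> continuous f x
  | S k' => exists df : V -> V -> W,
      (forall x, U x -> filterdiff f (locally x) (df x)) /\
      (forall v : V, Ck k' U (fun x => df x v))
  end.

Definition smooth_near {V W : NormedModule R_AbsRing} (f : V -> W) (p : V)
    : Prop :=
  exists U : V -> Prop, open U /\ U p /\ forall k, Ck k U f.

(* Smoothness on an arbitrary subset [D] of the line: near each point of [D],
   [f] coincides on [D] with a function that is smooth on a neighbourhood.
   On an open set this is ordinary smoothness. *)
Definition smooth_on (D : R -> Prop) (f : R -> R) : Prop :=
  forall p, D p -> exists g : R -> R,
    smooth_near g p /\ within D (locally p) (fun t => f t = g t).

(** * Derivatives along a subset of the line

    At interior points of [D] these are the ordinary derivatives; at an
    endpoint of an interval they are one-sided.  The values of the functions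
    outside [D] play no role. *)

Definition is_derive_in {W : NormedModule R_AbsRing} (D : R -> Prop)
    (f : R -> W) (t : R) (d : W) : Prop :=
  filterdiff f (within D (locally t)) (fun h : R => scal h d).

Definition Derive_in (D : R -> Prop) (f : R -> R) (t : R) : R :=
  iota (fun d : R => is_derive_in D f t d).

Fixpoint Derive_n_in (D : R -> Prop) (f : R -> R) (n : nat) : R -> R :=
  match n with
  | O => f
  | S n' => Derive_in D (Derive_n_in D f n')
  end.

(** * A-equivalence of map-germs and cusps *)

Definition diffeo_germ {V : NormedModule R_AbsRing} (S : V -> V) : Prop :=
  S zero = zero /\ smooth_near S zero /\
  exists S' : V -> V,
    S' zero = zero /\ smooth_near S' zero /\
    locally (zero : V) (fun x => S' (S x) = x) /\
    locally (zero : V) (fun x => S (S' x) = x).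

(* [f1] and [f2] are germs at the origin, with value the origin.  [D] is the
   domain of [f1]; when it is a neighbourhood of the origin, the condition is
   the identity of germs [f2 o S = T o f1].  Other [D] occur only for the germ of
   a curve at an endpoint of its interval of definition. *)
Definition A_equivalent {V W : NormedModule R_AbsRing} (D : V -> Prop)
    (f1 f2 : V -> W) : Prop :=
  exists (S : V -> V) (T : W -> W),
    diffeo_germ S /\ diffeo_germ T /\
    within D (locally (zero : V)) (fun t => f2 (S t) = T (f1 t)).

Definition is_cusp (j i : nat) (I : R -> Prop) (gamma : R -> R * R) (p : R)
    : Prop :=
  is_derive_in I gamma p zero /\
  A_equivalent (fun h : R => I (p + h))
    (fun h : R => minus (gamma (p + h)) (gamma p))
    (fun t : R => (t ^ i, t ^ j)).

(** * The functions eta, F and G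

    [lH] stands for the smooth extension of the product of [l] and [H]. *)

Definition eta (lH : R -> R) (u : R) : R := RInt (fun v => 2 * lH v) 0 u.

Definition Fint (l lH : R -> R) (t : R) : R :=
  RInt (fun u => l u * sin (eta lH u)) 0 t.

Definition Gint (l lH : R -> R) (t : R) : R :=
  RInt (fun u => l u * cos (eta lH u)) 0 t.

(* Main.v *)
(* The velocity is [gamma' = l (sin psi, cos psi)] with [psi' = eta' - l sin psi / y].
   In the orthonormal frame of [psi p], the coordinates [X], [Y] of [gamma - gamma p]
   satisfy [X' = l z], [Y' = l w] with [z = 1] and [w = 0] at [p], and the
   quantities in the four criteria are, up to constants, the leading coefficients of
   [X], of [Y], and (for the 5/2-cusp) of [Y - k X ^ 2].

   Sufficiency: a change of parameter turns [X] into [s ^ i].  Dividing [Y] by the map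
   [s |-> s ^ i], as in the preparation theorem, writes it as a combination of powers
   of [s] with coefficients smooth in [X]; the terms other than [s ^ j] are removed by
   a diffeomorphism of the plane.  For [i = 3] one gap of the semigroup generated by
   [i] and [j] (5 for [j = 4], 7 for [j = 5]) is first removed by adding a multiple of
   [Y] to [X].

   Necessity: [gamma = T (s ^ i, s ^ j)] for a diffeomorphism [T], so that
   [gamma = a s ^ i + b s ^ j + v s ^ (2 i) + ...] with independent vectors [a], [b].
   For the 5/2-cusp, the term in [v] is eliminated by subtracting a multiple of [X ^ 2]
   from [Y]. *)
Require Import Defs.
From Stdlib Require Import Reals Lra Lia Psatz ClassicalEpsilon List.
From Coquelicot Require Import Coquelicot.
Import ListNotations.
Open Scope R_scope.

(** The point [p] may be an endpoint of [I], and [gamma] is then known on one side only. Near [p]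
    every function is therefore replaced by one that is smooth on the whole line and agrees with it
    along [I]; the calculus is done with these extensions, and the curve is compared with them only
    on [D]. Coefficients can still be read off, because [D] accumulates at the origin.

    Which terms a diffeomorphism of the plane can remove is a matter of exponents modulo [i].
    Division by the square leaves one nonzero residue, represented by [s ^ j]; division by the cube
    leaves two, represented by [s ^ j] and [s ^ (2 * j)]. A power below the representative of its
    class cannot be absorbed: this is where the gaps come from.

    For necessity a second-order expansion of the inverse of [T] is enough. At [(s ^ i, s ^ j)] the
    neglected terms have order at least the minimum of [3 * i] and [i + j], which exceeds [j] in all
    four cases, whereas the square of the first coordinate precedes [s ^ j] only for the
    5/2-cusp. *)

(** * Calculus of C^k maps *)

Section CkCalculus.
Context {V : NormedModule R_AbsRing}.
Implicit Types U : V -> Prop.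

Lemma Ck_ext {W : NormedModule R_AbsRing} k U (f g : V -> W) :
  open U -> (forall x, U x -> f x = g x) -> Ck k U f -> Ck k U g.
Proof.
  intros hU e; destruct k as [|k]; simpl.
  - intros h x hx. apply (continuous_ext_loc g f).
    + generalize (hU x hx); apply filter_imp. intros y hy; now apply e.
    + now apply h.
  - intros [df [h1 h2]]. exists df; split; [|exact h2].
    intros x hx. apply (filterdiff_ext_locally f).
    + generalize (hU x hx); apply filter_imp. intros y hy; now apply e.
    + now apply h1.
Qed.

Lemma Ck_sub {W : NormedModule R_AbsRing} k (U U' : V -> Prop) (f : V -> W) :
  (forall x, U' x -> U x) -> Ck k U f -> Ck k U' f.
Proof.
  intros hs; revert f; induction k as [|k IH]; simpl; intros f.
  - auto.
  - intros [df [h1 h2]]. exists df; split; auto.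
Qed.

Lemma Ck_pred {W : NormedModule R_AbsRing} k U (f : V -> W) :
  Ck (S k) U f -> Ck k U f.
Proof.
  revert f; induction k as [|k IH]; intros f.
  - intros [df [h1 _]] x hx. apply (filterdiff_continuous f x).
    now exists (df x); apply h1.
  - intros [df [h1 h2]]. exists df; split; auto.
Qed.

Lemma Ck_const {W : NormedModule R_AbsRing} k U (c : W) :
  Ck k U (fun _ => c).
Proof.
  revert c; induction k as [|k IH]; intros c.
  - intros x _; apply continuous_const.
  - exists (fun _ _ => zero); split; intros.
    + apply filterdiff_const; typeclasses eauto.
    + apply IH.
Qed.

Lemma Ck_linear {W : NormedModule R_AbsRing} k U (L : V -> W) :
  is_linear L -> Ck k U L.
Proof.
  intros hL; destruct k as [|k].
  - intros x _; now apply linear_cont.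
  - exists (fun _ v => L v); split; intros.
    + now apply filterdiff_linear.
    + apply Ck_const.
Qed.

Lemma Ck_plus {W : NormedModule R_AbsRing} k U (f g : V -> W) :
  Ck k U f -> Ck k U g -> Ck k U (fun x => plus (f x) (g x)).
Proof.
  revert f g; induction k as [|k IH]; intros f g.
  - intros hf hg x hx. apply (continuous_plus f g); auto.
  - intros [df [h1 h2]] [dg [h3 h4]].
    exists (fun x v => plus (df x v) (dg x v)); split; intros.
    + apply filterdiff_plus_fct; auto; typeclasses eauto.
    + now apply IH.
Qed.

Lemma Ck_mult k U (f g : V -> R) :
  Ck k U f -> Ck k U g -> Ck k U (fun x => f x * g x).
Proof.
  revert f g; induction k as [|k IH]; intros f g.
  - intros hf hg x hx. apply (continuous_mult f g); auto.
  - intros hf hg.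
    generalize (Ck_pred _ _ _ hf) (Ck_pred _ _ _ hg); intros hf' hg'.
    destruct hf as [df [h1 h2]], hg as [dg [h3 h4]].
    exists (fun x v => df x v * g x + f x * dg x v); split; intros.
    + apply (filterdiff_mult_fct f g x (df x) (dg x)); auto.
      intros; apply Rmult_comm.
    + apply (Ck_plus k U (fun x => df x v * g x) (fun x => f x * dg x v));
        apply IH; auto.
Qed.

Lemma filterdiff_pair {W1 W2 : NormedModule R_AbsRing} F {FF : Filter F}
  (f lf : V -> W1) (g lg : V -> W2) :
  filterdiff f F lf -> filterdiff g F lg ->
  filterdiff (fun x => (f x, g x)) F (fun x => (lf x, lg x)).
Proof.
  intros hf hg.
  apply (filterdiff_comp_2 f g (fun a b => (a, b)) lf lg (fun a b => (a, b)) hf hg).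
  apply filterdiff_linear, is_linear_prod; [apply is_linear_fst|apply is_linear_snd].
Qed.

Lemma Ck_pair {W1 W2 : NormedModule R_AbsRing} k U (f : V -> W1) (g : V -> W2) :
  Ck k U f -> Ck k U g -> Ck k U (fun x => (f x, g x)).
Proof.
  revert f g; induction k as [|k IH]; intros f g.
  - intros hf hg x hx.
    apply (continuous_comp_2 f g (fun a b => (a, b))); auto.
    apply (continuous_ext (fun y => y)); [now intros []|apply continuous_id].
  - intros [df [h1 h2]] [dg [h3 h4]].
    exists (fun x v => (df x v, dg x v)); split; intros.
    + apply filterdiff_pair; auto; typeclasses eauto.
    + now apply IH.
Qed.

Lemma Ck_linear_comp {W1 W2 : NormedModule R_AbsRing} k U (f : V -> W1) (L : W1 -> W2) :
  is_linear L -> Ck k U f -> Ck k U (fun x => L (f x)).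
Proof.
  intros hL; revert f; induction k as [|k IH]; intros f.
  - intros hf x hx. apply (continuous_comp f L); auto. now apply linear_cont.
  - intros [df [h1 h2]]. exists (fun x v => L (df x v)); split; intros.
    + apply filterdiff_comp'; auto. now apply filterdiff_linear.
    + now apply IH.
Qed.

(** The outer function has one variable: its differential is multiplication by [dg (f x) 1], so the
    derivative of the composite is a product and the induction closes. With several variables the
    direction [df x v] would itself move with [x]. *)
Lemma Ck_comp k U (U' : R -> Prop) (f : V -> R) (g : R -> R) :
  (forall x, U x -> U' (f x)) -> Ck k U f -> Ck k U' g ->
  Ck k U (fun x => g (f x)).
Proof.
  revert f g; induction k as [|k IH]; intros f g hs.
  - intros hf hg x hx. apply (continuous_comp f g); auto.
  - intros hf hg. generalize (Ck_pred _ _ _ hf); intros hf'.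
    destruct hf as [df [h1 h2]], hg as [dg [h3 h4]].
    exists (fun x v => df x v * dg (f x) 1); split; intros.
    + assert (hl : is_linear (dg (f x))) by (apply h3; auto).
      apply filterdiff_ext_lin with (fun v => dg (f x) (df x v)).
      * apply filterdiff_comp'; auto.
      * intros y. rewrite <- (Rmult_1_r (df x y)) at 1.
        exact (linear_scal _ hl (df x y) 1).
    + apply Ck_mult; auto. now apply (IH f (fun y => dg y 1)).
Qed.

End CkCalculus.

Lemma Ck_of_derive k (U : R -> Prop) (f f' : R -> R) :
  (forall x, U x -> is_derive f x (f' x)) -> Ck k U f' -> Ck (S k) U f.
Proof.
  intros h1 h2. exists (fun x v => v * f' x); split; intros.
  - now apply h1.
  - apply Ck_mult; auto. apply Ck_const.
Qed.

Lemma Ck_is_derive k (U : R -> Prop) (f : R -> R) x :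
  Ck (S k) U f -> U x -> is_derive f x (Derive f x).
Proof.
  intros [df [h1 _]] hx. apply Derive_correct.
  apply ex_derive_filterdiff. now exists (df x); apply h1.
Qed.

Lemma Ck_Derive k (U : R -> Prop) (f : R -> R) :
  open U -> Ck (S k) U f -> Ck k U (Derive f).
Proof.
  intros hU [df [h1 h2]].
  apply (Ck_ext k U (fun x => df x 1)); auto.
  intros x hx. symmetry. apply is_derive_unique.
  unfold is_derive. apply filterdiff_ext_lin with (df x); auto.
  intros y. rewrite <- (Rmult_1_r y) at 1.
  apply (linear_scal (df x) (proj1 (h1 x hx)) y 1).
Qed.

(** The differentials given on [U1] and on [U2] are unrelated witnesses; on the line [Derive f] is
    common to both. This serves functions cut off by a bump, which are smooth for different reasons
    on two overlapping sets. *)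
Lemma Ck_glue k (U1 U2 : R -> Prop) (f : R -> R) :
  open U1 -> open U2 -> Ck k U1 f -> Ck k U2 f ->
  Ck k (fun x => U1 x \/ U2 x) f.
Proof.
  intros o1 o2; revert f; induction k as [|k IH]; intros f h1 h2.
  - intros x [hx|hx]; [now apply h1|now apply h2].
  - apply (Ck_of_derive k _ f (Derive f)).
    + intros x [hx|hx]; [now apply (Ck_is_derive k U1)|now apply (Ck_is_derive k U2)].
    + apply IH; now apply Ck_Derive.
Qed.

(** For functions whose successive derivatives are known explicitly: parametric integrals and the
    series of Borel's theorem. *)
Lemma Ck_of_family (U : R -> Prop) (F : nat -> R -> R) :
  (forall n x, U x -> is_derive (F n) x (F (S n) x)) ->
  forall k n, Ck k U (F n).
Proof.
  intros h; induction k as [|k IH]; intros n.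
  - intros x hx. apply (ex_derive_continuous (F n)). now exists (F (S n) x); apply h.
  - apply (Ck_of_derive k U (F n) (F (S n))); auto.
Qed.

(** * Smoothness near a point *)

Section SmoothNear.
Context {V : NormedModule R_AbsRing}.

Lemma open_locally_interior (P : V -> Prop) : open (fun x => locally x P).
Proof. intros x hx; now apply locally_locally. Qed.

Lemma smooth_near_ext {W : NormedModule R_AbsRing} (f g : V -> W) p :
  locally p (fun x => f x = g x) -> smooth_near f p -> smooth_near g p.
Proof.
  intros e [U [oU [Up hU]]].
  exists (fun x => U x /\ locally x (fun y => f y = g y)); repeat split; auto.
  - apply open_and; auto. apply open_locally_interior.
  - intros k. apply (Ck_ext k _ f).
    + apply open_and; auto. apply open_locally_interior.
    + intros x [_ hx]. now apply (locally_singleton x).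
    + apply (Ck_sub k U); [intros ?; tauto|auto].
Qed.

Lemma smooth_near_const {W : NormedModule R_AbsRing} (c : W) (p : V) :
  smooth_near (fun _ : V => c) p.
Proof.
  exists (fun _ => True); repeat split; auto using open_true.
  intros k; apply Ck_const.
Qed.

Lemma smooth_near_linear {W : NormedModule R_AbsRing} (L : V -> W) p :
  is_linear L -> smooth_near L p.
Proof.
  exists (fun _ => True); repeat split; auto using open_true.
  intros k; now apply Ck_linear.
Qed.

Lemma smooth_near_2 {W1 W2 W3 : NormedModule R_AbsRing}
  (f : V -> W1) (g : V -> W2) (h : V -> W3) p :
  (forall k U, Ck k U f -> Ck k U g -> Ck k U h) ->
  smooth_near f p -> smooth_near g p -> smooth_near h p.
Proof.
  intros H [U [oU [Up hU]]] [U' [oU' [Up' hU']]].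
  exists (fun x => U x /\ U' x); repeat split; auto using open_and.
  intros k; apply H.
  - apply (Ck_sub k U); [intros ?; tauto|auto].
  - apply (Ck_sub k U'); [intros ?; tauto|auto].
Qed.

Lemma smooth_near_plus (f g : V -> R) p :
  smooth_near f p -> smooth_near g p -> smooth_near (fun x => f x + g x) p.
Proof. apply smooth_near_2; intros; now apply (Ck_plus k U f g). Qed.

Lemma smooth_near_mult (f g : V -> R) p :
  smooth_near f p -> smooth_near g p -> smooth_near (fun x => f x * g x) p.
Proof. apply smooth_near_2; intros; now apply Ck_mult. Qed.

Lemma smooth_near_pair {W1 W2 : NormedModule R_AbsRing} (f : V -> W1) (g : V -> W2) p :
  smooth_near f p -> smooth_near g p -> smooth_near (fun x => (f x, g x)) p.
Proof. apply smooth_near_2; intros; now apply Ck_pair. Qed.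

Lemma smooth_near_linear_comp {W1 W2 : NormedModule R_AbsRing} (f : V -> W1) (L : W1 -> W2) p :
  is_linear L -> smooth_near f p -> smooth_near (fun x => L (f x)) p.
Proof.
  intros hL [U [oU [Up hU]]]. exists U; repeat split; auto.
  intros k; now apply Ck_linear_comp.
Qed.

Lemma smooth_near_opp (f : V -> R) p :
  smooth_near f p -> smooth_near (fun x => - f x) p.
Proof.
  intros hf. apply (smooth_near_ext (fun x => -1 * f x)).
  - apply filter_forall; intros x; change (-1 * f x = - f x); ring.
  - apply smooth_near_mult; auto. apply smooth_near_const.
Qed.

Lemma smooth_near_minus (f g : V -> R) p :
  smooth_near f p -> smooth_near g p -> smooth_near (fun x => f x - g x) p.
Proof. intros; apply smooth_near_plus; auto using smooth_near_opp. Qed.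

Lemma smooth_near_pow (f : V -> R) n p :
  smooth_near f p -> smooth_near (fun x => f x ^ n) p.
Proof.
  intros hf; induction n as [|n IH]; simpl.
  - apply smooth_near_const.
  - now apply smooth_near_mult.
Qed.

Lemma smooth_near_continuous {W : NormedModule R_AbsRing} (f : V -> W) p :
  smooth_near f p -> continuous f p.
Proof. intros [U [oU [Up hU]]]. now apply (hU O). Qed.

Lemma smooth_near_comp (f : V -> R) (g : R -> R) p :
  smooth_near f p -> smooth_near g (f p) -> smooth_near (fun x => g (f x)) p.
Proof.
  intros [U [oU [Up hU]]] [U' [oU' [Up' hU']]].
  assert (oW : open (fun x => U x /\ U' (f x))).
  { intros x [hx hx']. apply filter_and; [now apply oU|].
    apply (hU O x hx (fun y => U' y)). now apply oU'. }
  exists (fun x => U x /\ U' (f x)); repeat split; auto.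
  intros k. apply (Ck_comp k _ U'); [intros ?; tauto| |auto].
  apply (Ck_sub k U); [intros ?; tauto|auto].
Qed.

End SmoothNear.

Lemma smooth_near_is_derive (f : R -> R) p :
  smooth_near f p -> is_derive f p (Derive f p).
Proof. intros [U [oU [Up hU]]]. now apply (Ck_is_derive 0 U). Qed.

Lemma Ck_inv k : Ck k (fun x : R => x <> 0) Rinv.
Proof.
  induction k as [|k IH].
  - intros x hx. apply continuous_Rinv; auto.
  - apply (Ck_of_derive k _ Rinv (fun x => -1 * (/ x * / x))).
    + intros x hx. auto_derive; auto. field; auto.
    + apply Ck_mult; [apply Ck_const|now apply Ck_mult].
Qed.

Lemma smooth_near_inv (a : R) : a <> 0 -> smooth_near Rinv a.
Proof.
  intros ha. exists (fun x => x <> 0); repeat split; auto using open_neq, Ck_inv.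
Qed.

Lemma smooth_near_div {V : NormedModule R_AbsRing} (f g : V -> R) p :
  g p <> 0 -> smooth_near f p -> smooth_near g p -> smooth_near (fun x => f x / g x) p.
Proof.
  intros; apply smooth_near_mult; auto.
  apply smooth_near_comp; auto. now apply smooth_near_inv.
Qed.

Lemma Ck_pow {V : NormedModule R_AbsRing} k U (f : V -> R) n :
  Ck k U f -> Ck k U (fun x => f x ^ n).
Proof.
  intros hf; induction n as [|n IH]; simpl; [apply Ck_const|now apply Ck_mult].
Qed.

(** The differential equation [c' = m / c ^ n] alone gives smoothness: its right side is as regular
    as [c], so each step gains one derivative. *)
Lemma Ck_root (U : R -> Prop) (c : R -> R) n m :
  (forall x, U x -> c x <> 0 /\ is_derive c x (m / c x ^ n)) -> forall k, Ck k U c.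
Proof.
  intros h; induction k as [|k IH].
  - intros x hx. apply (ex_derive_continuous c). exists (m / c x ^ n); now apply h.
  - apply (Ck_of_derive k _ c (fun x => m / c x ^ n)).
    + intros; now apply h.
    + apply Ck_mult; [apply Ck_const|].
      apply (Ck_comp k U (fun y => y <> 0) (fun x => c x ^ n) Rinv).
      * intros x hx. apply pow_nonzero. now apply h.
      * now apply Ck_pow.
      * apply Ck_inv.
Qed.

(** Meant for points where no differentiation rule applies: the origin for flat functions and for
    their composites with roots, and every point for an inverse function. *)
Lemma is_derive_of_quadratic_bound (f : R -> R) x d C :
  locally x (fun y => Rabs (f y - f x - d * (y - x)) <= C * (y - x) ^ 2) ->
  is_derive f x d.
Proof.
  intros [del hdel]. apply is_derive_Reals. intros eps heps.
  assert (hC : 0 < Rabs C + 1) by (generalize (Rabs_pos C); lra).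
  assert (hm : 0 < Rmin del (eps / (Rabs C + 1))).
  { apply Rmin_pos; [apply cond_pos|]. now apply Rdiv_lt_0_compat. }
  exists (mkposreal _ hm). simpl. intros h h0 hh.
  assert (hh1 := Rlt_le_trans _ _ _ hh (Rmin_l _ _)).
  assert (hh2 := Rlt_le_trans _ _ _ hh (Rmin_r _ _)).
  assert (hb : ball x del (x + h)).
  { change (Rabs (x + h - x) < del). now replace (x + h - x) with h by ring. }
  generalize (hdel _ hb). replace (x + h - x) with h by ring. intros hq.
  replace ((f (x + h) - f x) / h - d) with ((f (x + h) - f x - d * h) / h) by (field; auto).
  unfold Rdiv. rewrite Rabs_mult, Rabs_inv.
  assert (ha : 0 < Rabs h) by now apply Rabs_pos_lt.
  apply (Rmult_lt_reg_r (Rabs h)); auto.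
  rewrite Rmult_assoc, Rinv_l, Rmult_1_r by lra.
  apply Rle_lt_trans with (1 := hq).
  rewrite <- (pow2_abs h). simpl. rewrite Rmult_1_r, <- Rmult_assoc.
  apply Rmult_lt_compat_r; auto.
  apply Rle_lt_trans with ((Rabs C + 1) * Rabs h).
  - apply Rmult_le_compat_r; [lra|]. generalize (Rle_abs C); lra.
  - rewrite Rmult_comm. now apply Rlt_div_r.
Qed.

(** * Smooth functions on the line *)

Definition smooth_R (f : R -> R) : Prop := forall k, Ck k (fun _ : R => True) f.

Lemma smooth_R_near f p : smooth_R f -> smooth_near f p.
Proof. intros hf; exists (fun _ => True); repeat split; auto using open_true. Qed.

Lemma smooth_R_is_derive f x : smooth_R f -> is_derive f x (Derive f x).
Proof. intros; now apply smooth_near_is_derive, smooth_R_near. Qed.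

Lemma smooth_R_continuous f x : smooth_R f -> continuous f x.
Proof.
  intros hf. apply (@smooth_near_continuous R_NormedModule R_NormedModule f x).
  now apply smooth_R_near.
Qed.

Lemma smooth_R_Derive f : smooth_R f -> smooth_R (Derive f).
Proof. intros hf k; apply Ck_Derive; auto using open_true. Qed.

Lemma smooth_R_Derive_n f n : smooth_R f -> smooth_R (Derive_n f n).
Proof. intros hf; induction n; simpl; auto using smooth_R_Derive. Qed.

Lemma smooth_R_const c : smooth_R (fun _ => c).
Proof. intros k; apply Ck_const. Qed.

Lemma smooth_R_id : smooth_R (fun x => x).
Proof. intros k; apply Ck_linear, is_linear_id. Qed.

Lemma smooth_R_plus f g : smooth_R f -> smooth_R g -> smooth_R (fun x => f x + g x).
Proof. intros hf hg k; now apply (Ck_plus k _ f g). Qed.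

Lemma smooth_R_mult f g : smooth_R f -> smooth_R g -> smooth_R (fun x => f x * g x).
Proof. intros hf hg k; now apply Ck_mult. Qed.

Lemma smooth_R_pow f n : smooth_R f -> smooth_R (fun x => f x ^ n).
Proof. intros hf k; now apply Ck_pow. Qed.

Lemma smooth_R_ext f g : (forall x, f x = g x) -> smooth_R f -> smooth_R g.
Proof. intros e hf k; apply (Ck_ext k _ f); auto using open_true. Qed.

Lemma smooth_R_minus f g : smooth_R f -> smooth_R g -> smooth_R (fun x => f x - g x).
Proof.
  intros hf hg. apply (smooth_R_ext (fun x => f x + -1 * g x)); [intros; ring|].
  apply smooth_R_plus, smooth_R_mult; auto using smooth_R_const.
Qed.

Lemma smooth_R_comp f g : smooth_R f -> smooth_R g -> smooth_R (fun x => g (f x)).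
Proof. intros hf hg k; now apply (Ck_comp k _ (fun _ => True)). Qed.

Ltac solve_smooth :=
  lazymatch goal with
  | |- smooth_R (fun _ => ?c) => apply smooth_R_const
  | |- smooth_R (fun x => x) => apply smooth_R_id
  | |- smooth_R (fun x => @?f x + @?g x) => apply (smooth_R_plus f g); solve_smooth
  | |- smooth_R (fun x => @?f x - @?g x) => apply (smooth_R_minus f g); solve_smooth
  | |- smooth_R (fun x => @?f x * @?g x) => apply (smooth_R_mult f g); solve_smooth
  | |- smooth_R (fun x => @?f x ^ ?n) => apply (smooth_R_pow f n); solve_smooth
  | |- smooth_R (fun x => ?g (@?f x)) =>
      first [assumption | apply (smooth_R_comp f g); solve_smooth]
  | |- _ => assumption
  end.

Lemma smooth_R_of_derive f f' :
  (forall x, is_derive f x (f' x)) -> smooth_R f' -> smooth_R f.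
Proof. intros h h' k; apply Ck_pred, (Ck_of_derive k _ f f'); auto. Qed.

(** * A bump function *)

Lemma exp_pow_INR z n : exp z ^ n = exp (INR n * z).
Proof.
  induction n as [|n IH].
  - now rewrite Rmult_0_l, exp_0.
  - rewrite S_INR, Rmult_plus_distr_r, Rmult_1_l, exp_plus, <- IH. simpl; ring.
Qed.

(** The [n]-th power of the inequality [z <= exp z] at [z = y / n]. *)
Lemma pow_le_exp n y : 0 <= y -> y ^ n <= INR n ^ n * exp y.
Proof.
  intros hy; destruct n as [|n].
  - simpl. rewrite Rmult_1_l. generalize (exp_ineq1_le y); lra.
  - assert (hn : 0 < INR (S n)) by (apply lt_0_INR; lia).
    set (z := y / INR (S n)).
    assert (hz : y = INR (S n) * z) by (unfold z; field; lra).
    assert (hz0 : 0 <= z) by (apply Rdiv_le_0_compat; auto).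
    rewrite hz, <- exp_pow_INR, Rpow_mult_distr.
    apply Rmult_le_compat_l; [apply pow_le; lra|].
    apply pow_incr. generalize (exp_ineq1_le z); lra.
Qed.

(** The exponent [m] makes the span of the family closed under differentiation, so that smoothness
    of all its members is a single induction. *)
Definition flat_exp (m : nat) (x : R) : R :=
  if Rlt_dec 0 x then exp (- / x) * (/ x) ^ m else 0.

(** [pow_le_exp] is used with exponent [m + 2] so that two powers of [x] are left over: this is the
    quadratic bound that makes the derivative at the origin vanish. *)
Lemma flat_exp_bound m x : Rabs (flat_exp m x) <= INR (m + 2) ^ (m + 2) * x ^ 2.
Proof.
  assert (hc : 0 <= INR (m + 2) ^ (m + 2)) by (apply pow_le, pos_INR).
  unfold flat_exp; destruct (Rlt_dec 0 x) as [hx|hx].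
  - assert (hy : 0 < / x) by now apply Rinv_0_lt_compat.
    assert (hp : 0 < (/ x) ^ m) by now apply pow_lt.
    assert (he := exp_pos (- / x)).
    rewrite Rabs_right by (apply Rle_ge, Rmult_le_pos; lra).
    assert (hb := pow_le_exp (m + 2) (/ x) (Rlt_le _ _ hy)).
    rewrite pow_add in hb at 1.
    apply (Rmult_le_compat_r (exp (- / x) * x ^ 2)) in hb.
    2: { apply Rmult_le_pos; [lra|]. apply pow_le; lra. }
    replace ((/ x) ^ m * (/ x) ^ 2 * (exp (- / x) * x ^ 2))
      with (exp (- / x) * (/ x) ^ m) in hb by (simpl; field; lra).
    replace (INR (m + 2) ^ (m + 2) * exp (/ x) * (exp (- / x) * x ^ 2))
      with (INR (m + 2) ^ (m + 2) * x ^ 2) in hb; auto.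
    rewrite exp_Ropp. field. apply Rgt_not_eq, exp_pos.
  - rewrite Rabs_R0. apply Rmult_le_pos; auto. apply pow2_ge_0.
Qed.

Lemma flat_exp_derive m x :
  is_derive (flat_exp m) x (flat_exp (m + 2) x - INR m * flat_exp (m + 1) x).
Proof.
  destruct (Rtotal_order x 0) as [hx|[->|hx]].
  - apply (is_derive_ext_loc (fun _ => 0)).
    + generalize (open_lt 0 x hx); apply filter_imp. intros y hy.
      unfold flat_exp; destruct (Rlt_dec 0 y); auto; lra.
    + unfold flat_exp; destruct (Rlt_dec 0 x); try lra.
      auto_derive; auto; ring.
  - assert (e0 : forall k, flat_exp k 0 = 0)
      by (intros; unfold flat_exp; destruct (Rlt_dec 0 0); auto; lra).
    rewrite !e0. apply (is_derive_of_quadratic_bound _ _ _ (INR (m + 2) ^ (m + 2))).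
    apply filter_forall; intros y. rewrite e0.
    replace (flat_exp m y - 0 - (0 - INR m * 0) * (y - 0)) with (flat_exp m y) by ring.
    rewrite Rminus_0_r. apply flat_exp_bound.
  - apply (is_derive_ext_loc (fun x => exp (- / x) * (/ x) ^ m)).
    + generalize (open_gt 0 x hx); apply filter_imp. intros y hy.
      unfold flat_exp; destruct (Rlt_dec 0 y); auto; lra.
    + unfold flat_exp; destruct (Rlt_dec 0 x); try lra.
      auto_derive; [repeat split; lra|].
      rewrite !pow_add. destruct m as [|m]; simpl.
      * field; lra.
      * change (match m with O => 1 | S _ => INR m + 1 end) with (INR (S m)).
        field; lra.
Qed.

Lemma smooth_R_flat_exp m : smooth_R (flat_exp m).
Proof.
  intros k; revert m; induction k as [|k IH]; intros m.
  - intros x _. apply (ex_derive_continuous (flat_exp m)).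
    eexists; apply flat_exp_derive.
  - apply (Ck_of_derive k _ _ (fun x => flat_exp (m + 2) x + -1 * (INR m * flat_exp (m + 1) x))).
    + intros x _.
      replace (flat_exp (m + 2) x + -1 * (INR m * flat_exp (m + 1) x))
        with (flat_exp (m + 2) x - INR m * flat_exp (m + 1) x) by ring.
      apply flat_exp_derive.
    + apply (Ck_plus k _ (flat_exp (m + 2))); auto.
      apply Ck_mult; [apply Ck_const|]. apply Ck_mult; auto. apply Ck_const.
Qed.

Lemma flat_exp_0_pos x : 0 < x -> 0 < flat_exp 0 x.
Proof.
  intros hx. unfold flat_exp; destruct (Rlt_dec 0 x); try lra.
  rewrite Rmult_1_r. apply exp_pos.
Qed.

Lemma flat_exp_nonpos m x : x <= 0 -> flat_exp m x = 0.
Proof. intros hx. unfold flat_exp; destruct (Rlt_dec 0 x); lra. Qed.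

Lemma bump_exists : exists chi : R -> R, smooth_R chi /\ (forall x, Rabs x <= 1 -> chi x = 1) /\ (forall x, 2 <= Rabs x -> chi x = 0).
Proof.
  set (e := flat_exp 0).
  (* The sum of [u] and [v] is 3, so they are never both nonpositive and the denominator [e u + e v]
     stays positive. The quotient is 1 where [v <= 0] and 0 where [u <= 0]. *)
  set (u := fun x : R => 4 - x ^ 2). set (v := fun x : R => x ^ 2 - 1).
  assert (hpos : forall x, 0 < e (u x) + e (v x)).
  { intros x. assert (h0 : forall y, 0 <= e y).
    { intros y; destruct (Rlt_le_dec 0 y); [left; now apply flat_exp_0_pos|].
      unfold e; rewrite flat_exp_nonpos; lra. }
    destruct (Rlt_le_dec 0 (u x)) as [h|h].
    - generalize (flat_exp_0_pos _ h) (h0 (v x)); fold e; lra.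
    - assert (h' : 0 < v x) by (unfold u, v in *; lra).
      generalize (flat_exp_0_pos _ h') (h0 (u x)); fold e; lra. }
  assert (su : smooth_R u).
  { unfold u; solve_smooth. }
  assert (sv : smooth_R v).
  { unfold v; solve_smooth. }
  assert (seu : smooth_R (fun x => e (u x))) by (apply smooth_R_comp; auto; apply smooth_R_flat_exp).
  assert (sev : smooth_R (fun x => e (v x))) by (apply smooth_R_comp; auto; apply smooth_R_flat_exp).
  exists (fun x => e (u x) * / (e (u x) + e (v x))); repeat split.
  - intros k. apply Ck_mult; auto.
    apply (Ck_comp k _ (fun y => y <> 0) (fun x => e (u x) + e (v x)) Rinv).
    + intros x _; generalize (hpos x); lra.
    + now apply smooth_R_plus.
    + apply Ck_inv.
  - intros x hx. assert (hv : v x <= 0).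
    { unfold v. rewrite <- pow2_abs. generalize (Rabs_pos x); nra. }
    generalize (hpos x). unfold e. rewrite (flat_exp_nonpos 0 (v x)) by auto.
    intros; field; lra.
  - intros x hx. assert (hu : u x <= 0) by (unfold u; rewrite <- pow2_abs; nra).
    unfold e. rewrite (flat_exp_nonpos 0 (u x)) by auto. ring.
Qed.

(** Germs at the origin are thereby represented by functions on the whole line, for which Hadamard
    quotients, primitives and composites carry no domain conditions. *)
Lemma smooth_R_extension (f : R -> R) :
  smooth_near f 0 -> exists g, smooth_R g /\ locally 0 (fun x => g x = f x).
Proof.
  intros [U [oU [U0 hU]]]. destruct (oU 0 U0) as [del hdel].
  destruct bump_exists as [chi [schi [chi1 chi0]]].
  assert (hd := cond_pos del).
  (* With the factor [4 / del] the bump is 1 up to [del / 4] and 0 from [del / 2] on, so the open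
     sets [Rabs x < del] and [del / 2 < Rabs x] cover the line and [g] is smooth on each. *)
  set (g := fun x => chi (4 / del * x) * f x).
  assert (habs : forall x, Rabs (4 / del * x) = 4 / del * Rabs x).
  { intros x. rewrite Rabs_mult, Rabs_right; auto.
    apply Rle_ge, Rdiv_le_0_compat; lra. }
  assert (o1 : open (fun x : R => Rabs x < del)).
  { apply (open_comp Rabs (fun y => y < del)); [|apply open_lt].
    intros x _; apply (continuous_Rabs x). }
  assert (o2 : open (fun x : R => del / 2 < Rabs x)).
  { apply (open_comp Rabs (fun y => del / 2 < y)); [|apply open_gt].
    intros x _; apply (continuous_Rabs x). }
  exists g; split.
  - intros k. apply (Ck_sub k (fun x => Rabs x < del \/ del / 2 < Rabs x)).
    { intros x _. destruct (Rlt_le_dec (Rabs x) del); [now left|right; lra]. }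
    apply Ck_glue; auto.
    + apply Ck_mult.
      * apply (Ck_sub k (fun _ => True)); auto.
        apply (smooth_R_comp (fun x => 4 / del * x) chi); auto.
        solve_smooth.
      * apply (Ck_sub k U); auto. intros x hx. apply hdel.
        change (Rabs (x - 0) < del). now rewrite Rminus_0_r.
    + apply (Ck_ext k _ (fun _ => 0)); auto using Ck_const.
      intros x hx. change (0 = g x). unfold g. rewrite chi0; [ring|]. rewrite habs.
      replace 2 with (4 / del * (del / 2)) by (field; lra).
      apply Rmult_le_compat_l; [apply Rdiv_le_0_compat; lra|lra].
  - assert (hd4 : 0 < del / 4) by lra.
    exists (mkposreal _ hd4). intros x hx. change (Rabs (x - 0) < del / 4) in hx.
    rewrite Rminus_0_r in hx. unfold g. rewrite chi1; [ring|]. rewrite habs.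
    replace 1 with (4 / del * (del / 4)) by (field; lra).
    apply Rmult_le_compat_l; [apply Rdiv_le_0_compat; lra|lra].
Qed.

(** * Hadamard quotients *)

(** Differentiation under the integral sign keeps this shape: [k] goes up by one and [g] becomes its
    derivative. All derivatives of a Hadamard quotient are thus moments. *)
Definition moment (k : nat) (g : R -> R) (t : R) : R :=
  RInt (fun s => s ^ k * g (t * s)) 0 1.

Lemma moment_derive k g t :
  smooth_R g -> is_derive (moment k g) t (moment (S k) (Derive g) t).
Proof.
  intros hg.
  assert (hd : forall s u, is_derive (fun z => s ^ k * g (z * s)) u (s ^ S k * Derive g (u * s))).
  { intros s u. replace (s ^ S k * Derive g (u * s)) with (s ^ k * (s * Derive g (u * s))) by (simpl; ring).
    apply is_derive_scal. apply (is_derive_comp g (fun z => z * s)).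
    - now apply smooth_R_is_derive.
    - auto_derive; auto; ring. }
  unfold moment.
  rewrite (RInt_ext (fun s => s ^ S k * Derive g (t * s))
    (fun s => Derive (fun u => (fun u s => s ^ k * g (u * s)) u s) t)).
  2: { intros s _. symmetry. apply is_derive_unique, hd. }
  apply (is_derive_RInt_param (fun u s => s ^ k * g (u * s))).
  - apply filter_forall; intros u s _. eexists; apply hd.
  - intros s _.
    apply (continuity_2d_pt_ext (fun u v => v ^ S k * Derive g (u * v))).
    { intros u v. symmetry. apply is_derive_unique, hd. }
    apply continuity_2d_pt_mult.
    + apply (continuity_1d_2d_pt_comp (fun v => v ^ S k) (fun _ v => v)).
      * apply derivable_continuous_pt, derivable_pt_pow.
      * apply continuity_2d_pt_id2.
    + apply (continuity_1d_2d_pt_comp (Derive g) (fun u v => u * v)).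
      * apply continuity_pt_filterlim.
        now apply smooth_R_continuous, smooth_R_Derive.
      * apply continuity_2d_pt_mult; [apply continuity_2d_pt_id1|apply continuity_2d_pt_id2].
  - apply filter_forall; intros u. apply (@ex_RInt_continuous R_CompleteNormedModule).
    intros s _. apply (smooth_R_continuous (fun s => s ^ k * g (u * s))).
    apply smooth_R_mult; [apply smooth_R_pow, smooth_R_id|].
    apply (smooth_R_comp (fun s => u * s)); auto.
    solve_smooth.
Qed.

(* [hq f t = (f t - f 0) / t], continued by [f' 0] at the origin. *)
Definition hq (f : R -> R) : R -> R := moment 0 (Derive f).

Lemma smooth_R_hq f : smooth_R f -> smooth_R (hq f).
Proof.
  intros hf k.
  apply (Ck_of_family (fun _ => True) (fun n => moment n (Derive_n (Derive f) n)) ) with (n := O).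
  intros n x _. apply moment_derive.
  now apply smooth_R_Derive_n, smooth_R_Derive.
Qed.

Lemma hq_spec f t : smooth_R f -> f t = f 0 + t * hq f t.
Proof.
  intros hf. unfold hq, moment.
  assert (h : is_RInt (fun s => t * Derive f (t * s)) 0 1 (minus (f (t * 1)) (f (t * 0)))).
  { apply (is_RInt_derive (fun s => f (t * s)) (fun s => t * Derive f (t * s))).
    - intros s _. apply (is_derive_comp f (fun s => t * s)).
      + now apply smooth_R_is_derive.
      + auto_derive; auto; ring.
    - intros s _. apply (smooth_R_continuous (fun s => t * Derive f (t * s))).
      apply smooth_R_mult; [apply smooth_R_const|].
      apply (smooth_R_comp (fun s => t * s)); auto using smooth_R_Derive.
      solve_smooth. }
  apply (@is_RInt_unique R_CompleteNormedModule) in h.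
  rewrite (RInt_ext _ (fun s => Derive f (t * s))) by (intros; simpl; ring).
  assert (hs : RInt (fun s => t * Derive f (t * s)) 0 1
    = t * RInt (fun s => Derive f (t * s)) 0 1).
  { apply (RInt_scal (fun s => Derive f (t * s))).
    apply (@ex_RInt_continuous R_CompleteNormedModule). intros s _.
    apply (smooth_R_continuous (fun s => Derive f (t * s))).
    apply (smooth_R_comp (fun s => t * s)); auto using smooth_R_Derive.
    solve_smooth. }
  rewrite <- hs, h. rewrite Rmult_1_r, Rmult_0_r.
  unfold minus, plus, opp; simpl. ring.
Qed.

(** * Orders of vanishing *)

(* The origin is left out, so that orders can be cancelled by division. *)
Definition bigO (D : R -> Prop) (n : nat) (f : R -> R) : Prop :=
  exists C, within (fun t => D t /\ t <> 0) (locally 0) (fun t => Rabs (f t) <= C * Rabs t ^ n).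

Definition full : R -> Prop := fun _ => True.

Lemma bigO_ext D n f g :
  within (fun t => D t /\ t <> 0) (locally 0) (fun t => f t = g t) -> bigO D n f -> bigO D n g.
Proof.
  intros e [C h]. exists C. generalize (filter_and _ _ e h); apply filter_imp.
  intros t [e1 h1]. now rewrite <- e1.
Qed.

Lemma bigO_eq D n f g : (forall t, f t = g t) -> bigO D n f -> bigO D n g.
Proof.
  intros e. apply bigO_ext. apply filter_forall; intros t; apply e.
Qed.

Lemma bigO_nonneg D n f : bigO D n f ->
  exists C, 0 <= C /\ within (fun t => D t /\ t <> 0) (locally 0) (fun t => Rabs (f t) <= C * Rabs t ^ n).
Proof.
  intros [C h]. exists (Rabs C); split; [apply Rabs_pos|].
  revert h; apply filter_imp. intros t h. apply Rle_trans with (1 := h).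
  apply Rmult_le_compat_r; [apply pow_le, Rabs_pos|apply Rle_abs].
Qed.

Lemma bigO_sub D D' n f : (forall t, D' t -> D t) -> bigO D n f -> bigO D' n f.
Proof.
  intros hs [C h]. exists C. unfold within in *. revert h; apply filter_imp.
  intros t h [ht1 ht2]; auto.
Qed.

Lemma bigO_full D n f : bigO full n f -> bigO D n f.
Proof. apply bigO_sub; unfold full; auto. Qed.

Lemma bigO_plus D n f g : bigO D n f -> bigO D n g -> bigO D n (fun t => f t + g t).
Proof.
  intros [C h] [C' h']. exists (C + C').
  generalize (filter_and _ _ h h'); apply filter_imp. intros t [h1 h2].
  rewrite Rmult_plus_distr_r. eapply Rle_trans; [apply Rabs_triang|].
  apply Rplus_le_compat; auto.
Qed.

Lemma bigO_mult D m n f g : bigO D m f -> bigO D n g -> bigO D (m + n) (fun t => f t * g t).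
Proof.
  intros hf hg. destruct (bigO_nonneg _ _ _ hf) as [C [hC h]].
  destruct (bigO_nonneg _ _ _ hg) as [C' [hC' h']]. exists (C * C').
  generalize (filter_and _ _ h h'); apply filter_imp. intros t [h1 h2].
  rewrite Rabs_mult, pow_add.
  replace (C * C' * (Rabs t ^ m * Rabs t ^ n)) with ((C * Rabs t ^ m) * (C' * Rabs t ^ n)) by ring.
  apply Rmult_le_compat; auto using Rabs_pos.
Qed.

Lemma bigO_continuous D f : continuous f 0 -> bigO D 0 f.
Proof.
  intros hf. exists (Rabs (f 0) + 1). unfold within.
  assert (h := hf (fun y => Rabs (y - f 0) < 1)). 
  assert (hl : locally (f 0) (fun y => Rabs (y - f 0) < 1)).
  { exists (mkposreal _ Rlt_0_1). intros y hy; exact hy. }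
  specialize (h hl). unfold filtermap in h. revert h. apply filter_imp. intros t ht _.
  simpl. rewrite Rmult_1_r. replace (f t) with (f 0 + (f t - f 0)) by ring.
  eapply Rle_trans; [apply Rabs_triang|]. lra.
Qed.

Lemma bigO_const D c : bigO D 0 (fun _ => c).
Proof. apply bigO_continuous, continuous_const. Qed.

Lemma bigO_pow D n : bigO D n (fun t => t ^ n).
Proof.
  exists 1. apply filter_forall; intros t. rewrite RPow_abs. lra.
Qed.

Lemma bigO_scal D n c f : bigO D n f -> bigO D n (fun t => c * f t).
Proof. intros hf. apply (bigO_mult D 0 n (fun _ => c) f); auto using bigO_const. Qed.

Lemma bigO_minus D n f g : bigO D n f -> bigO D n g -> bigO D n (fun t => f t - g t).
Proof.
  intros hf hg. apply (bigO_eq D n (fun t => f t + -1 * g t)); [intros; ring|].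
  apply bigO_plus; auto. now apply bigO_scal.
Qed.

Lemma bigO_le D m n f : (n <= m)%nat -> bigO D m f -> bigO D n f.
Proof.
  intros hmn [C h].
  assert (h1 : bigO D (m - n) (fun t => t ^ (m - n))) by apply bigO_pow.
  assert (hb : bigO D 0 (fun t => t ^ (m - n))).
  { apply bigO_continuous. apply (smooth_R_continuous (fun t => t ^ (m - n))).
    apply smooth_R_pow, smooth_R_id. }
  destruct (bigO_nonneg _ _ _ hb) as [C' [hC' h']].
  exists (Rabs C * C'). generalize (filter_and _ _ h h'); apply filter_imp.
  intros t [h2 h3].
  replace m with ((m - n) + n)%nat in h2 at 1 by lia. rewrite pow_add in h2.
  rewrite <- RPow_abs in h3. simpl in h3; rewrite Rmult_1_r in h3.
  apply Rle_trans with (1 := h2). rewrite <- Rmult_assoc.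
  apply Rmult_le_compat_r; [apply pow_le, Rabs_pos|].
  apply Rle_trans with (Rabs C * Rabs t ^ (m - n)).
  - apply Rmult_le_compat_r; [apply pow_le, Rabs_pos|apply Rle_abs].
  - apply Rmult_le_compat_l; [apply Rabs_pos|auto].
Qed.

Lemma bigO_dominated D N C f g : bigO D N g ->
  within D (locally 0) (fun t => Rabs (f t) <= C * Rabs (g t)) -> bigO D N f.
Proof.
  intros hg hf. destruct (bigO_nonneg _ _ _ hg) as [C' [hC' hl]]. exists (Rabs C * C').
  unfold within in *. generalize (filter_and _ _ hf hl); apply filter_imp.
  intros t [h1 h2] [ht1 ht2]. specialize (h1 ht1). specialize (h2 (conj ht1 ht2)).
  apply Rle_trans with (1 := h1). rewrite Rmult_assoc.
  apply Rle_trans with (Rabs C * Rabs (g t)).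
  - apply Rmult_le_compat_r; [apply Rabs_pos|apply Rle_abs].
  - apply Rmult_le_compat_l; [apply Rabs_pos|auto].
Qed.

Lemma bigO_pow_mult D k n f : bigO D n f -> bigO D (k + n) (fun t => t ^ k * f t).
Proof. intros; apply bigO_mult; auto using bigO_pow. Qed.

Lemma bigO_pow_cancel D k n f : bigO D (k + n) (fun t => t ^ k * f t) -> bigO D n f.
Proof.
  intros [C h]. exists C. unfold within in *. revert h; apply filter_imp. intros t h [h1 h2].
  specialize (h (conj h1 h2)). rewrite Rabs_mult, pow_add, <- RPow_abs in h.
  assert (0 < Rabs t ^ k) by (apply pow_lt; now apply Rabs_pos_lt).
  apply (Rmult_le_reg_l (Rabs t ^ k)); auto. nra.
Qed.

(** Enough for coefficients to be determined by values on [D], and true of a one-sided domain as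
    well. *)
Definition accum (D : R -> Prop) : Prop :=
  forall eps : posreal, exists t, D t /\ t <> 0 /\ Rabs t < eps.

Lemma accum_full : accum full.
Proof.
  intros eps. assert (h := cond_pos eps). exists (eps / 2); unfold full; repeat split; try lra.
  rewrite Rabs_right; lra.
Qed.

Lemma bigO_constant_term D c f :
  accum D -> bigO D 0 f -> bigO D 1 (fun t => c + t * f t) -> c = 0.
Proof.
  intros hD hf hc. destruct (Req_dec c 0) as [h0|h0]; auto. exfalso.
  assert (h1 : bigO D 1 (fun t => c)).
  { apply (bigO_eq D 1 (fun t => (c + t * f t) - t ^ 1 * f t)); [intros; ring|].
    apply bigO_minus; auto. now apply (bigO_pow_mult D 1 0). }
  destruct (bigO_nonneg _ _ _ h1) as [C [hC [eps h]]].
  assert (hc0 : 0 < Rabs c) by now apply Rabs_pos_lt.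
  assert (hm : 0 < Rmin eps (Rabs c / (C + 1))).
  { apply Rmin_pos; [apply cond_pos|apply Rdiv_lt_0_compat; lra]. }
  destruct (hD (mkposreal _ hm)) as [t [Dt [t0 ht]]]. simpl in ht.
  assert (ht1 := Rlt_le_trans _ _ _ ht (Rmin_l _ _)).
  assert (ht2 := Rlt_le_trans _ _ _ ht (Rmin_r _ _)).
  assert (hb : ball 0 eps t) by (change (Rabs (t - 0) < eps); now rewrite Rminus_0_r).
  specialize (h t hb (conj Dt t0)). simpl in h. rewrite Rmult_1_r in h.
  apply Rlt_div_r in ht2; [|lra].
  generalize (Rabs_pos t); nra.
Qed.

(** In nested form, uniqueness of the coefficients is an induction that reads off a constant term
    and cancels a factor [t]. *)
Fixpoint horner (l : list R) (t : R) : R :=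
  match l with nil => 0 | a :: l' => a + t * horner l' t end.

Lemma smooth_R_horner l : smooth_R (horner l).
Proof.
  induction l as [|a l IH]; simpl; [apply smooth_R_const|].
  apply smooth_R_plus; [apply smooth_R_const|].
  apply smooth_R_mult; auto; apply smooth_R_id.
Qed.

Lemma bigO_horner D l : bigO D 0 (horner l).
Proof. apply bigO_continuous, smooth_R_continuous, smooth_R_horner. Qed.

Lemma horner_unique D l : accum D -> bigO D (length l) (horner l) -> List.Forall (fun a => a = 0) l.
Proof.
  intros hD; induction l as [|a l IH]; simpl; intros h; constructor.
  - apply (bigO_constant_term D a (horner l)); auto using bigO_horner.
    apply (bigO_le D (S (length l))); auto; lia.
  - apply IH. apply (bigO_pow_cancel D 1).
    apply (bigO_eq D _ (fun t => a + t * horner l t)); auto.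
    intros t. replace a with 0; [ring|]. symmetry.
    apply (bigO_constant_term D a (horner l)); auto using bigO_horner.
    apply (bigO_le D (S (length l))); auto; lia.
Qed.

(** Turns an estimate into divisibility with a smooth quotient, by one Hadamard quotient for each
    order. *)
Lemma bigO_smooth_factor f n : smooth_R f -> bigO full n f ->
  exists q, smooth_R q /\ (forall t, f t = t ^ n * q t).
Proof.
  revert f; induction n as [|n IH]; intros f hf h.
  - exists f; split; auto. intros; simpl; ring.
  - assert (f0 : f 0 = 0).
    { apply (bigO_constant_term full (f 0) (hq f)); auto using accum_full.
      - now apply bigO_continuous, smooth_R_continuous, smooth_R_hq.
      - apply (bigO_le full (S n)); [lia|]. revert h; apply bigO_eq.
        intros; now apply hq_spec. }
    destruct (IH (hq f)) as [q [hq1 hq2]].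
    + now apply smooth_R_hq.
    + apply (bigO_pow_cancel full 1). revert h; apply bigO_eq.
      intros t. rewrite (hq_spec f t hf), f0; ring.
    + exists q; split; auto. intros t. rewrite (hq_spec f t hf), f0, hq2. simpl; ring.
Qed.

Lemma bigO_S_value f n : smooth_R f -> bigO full (S n) f -> f 0 = 0.
Proof.
  intros hf h. destruct (bigO_smooth_factor f (S n) hf h) as [q [_ e]].
  rewrite e. simpl; ring.
Qed.

Lemma bigO_Derive f n : smooth_R f -> bigO full (S n) f -> bigO full n (Derive f).
Proof.
  intros hf h. destruct (bigO_smooth_factor f (S n) hf h) as [q [sq e]].
  apply (bigO_eq full n (fun t => t ^ n * (INR (S n) * q t + t * Derive q t))).
  - intros t. symmetry; apply is_derive_unique.
    apply (is_derive_ext (fun t => t ^ S n * q t)); [now intros; rewrite e|].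
    assert (hd := smooth_R_is_derive q t sq).
    auto_derive; [exists (Derive q t); exact hd|].
    change (match n with O => 1 | S _ => INR n + 1 end) with (INR (S n)).
    change (fun x : R => q x) with q. simpl pred. simpl pow. ring.
  - rewrite (plus_n_O n) at 1. apply bigO_pow_mult.
    apply bigO_continuous.
    apply (smooth_R_continuous (fun t => INR (S n) * q t + t * Derive q t)).
    apply smooth_R_plus; apply smooth_R_mult;
      auto using smooth_R_const, smooth_R_id, smooth_R_Derive.
Qed.

Fixpoint psum (a : nat -> R) (n : nat) (t : R) : R :=
  match n with O => 0 | S n' => psum a n' t + a n' * t ^ n' end.

(* The factorials are included: [tcoef f n] is the [n]-th derivative at [0] over [n!]. *)
Definition tcoef (f : R -> R) (n : nat) : R := Nat.iter n hq f 0.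

Lemma smooth_R_iter_hq f n : smooth_R f -> smooth_R (Nat.iter n hq f).
Proof. intros hf; induction n; simpl; auto using smooth_R_hq. Qed.

Lemma taylor f n t : smooth_R f -> f t = psum (tcoef f) n t + t ^ n * Nat.iter n hq f t.
Proof.
  intros hf; induction n as [|n IH]; simpl; [ring|].
  rewrite IH, (hq_spec (Nat.iter n hq f)) by now apply smooth_R_iter_hq.
  unfold tcoef; ring.
Qed.

Lemma taylor_bigO D f n : smooth_R f -> bigO D n (fun t => f t - psum (tcoef f) n t).
Proof.
  intros hf. apply (bigO_eq D n (fun t => t ^ n * Nat.iter n hq f t)).
  - intros t. rewrite (taylor f n t hf). ring.
  - rewrite (plus_n_O n) at 1. apply bigO_pow_mult, bigO_continuous.
    now apply smooth_R_continuous, smooth_R_iter_hq.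
Qed.

(** * Borel's theorem *)

Lemma geometric_tail (v : nat -> R) r K :
  (forall n, (K < n)%nat -> Rabs (v n) <= r * (1 / 2) ^ n) ->
  Rabs (sum_n v K - Series v) <= r * (1 / 2) ^ K.
Proof.
  intros hv.
  (* The factor [1 - (1 / 2) ^ d] is the exact partial sum of the geometric tail; without it the
     induction on [d] would not close. *)
  assert (hd : forall d, Rabs (sum_n v K - sum_n v (d + K)) <= r * (1 / 2) ^ K * (1 - (1 / 2) ^ d)).
  { induction d as [|d IH].
    - simpl. rewrite Rminus_diag, Rabs_R0. lra.
    - change (S d + K)%nat with (S (d + K)). rewrite sum_Sn.
      change (plus (sum_n v (d + K)) (v (S (d + K)))) with (sum_n v (d + K) + v (S (d + K))).
      change ((1 / 2) ^ S d) with (1 / 2 * (1 / 2) ^ d).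
      replace (sum_n v K - (sum_n v (d + K) + v (S (d + K))))
        with ((sum_n v K - sum_n v (d + K)) + - v (S (d + K))) by ring.
      eapply Rle_trans; [apply Rabs_triang|]. rewrite Rabs_Ropp.
      assert (h := hv (S (d + K)) ltac:(lia)). change ((1 / 2) ^ S (d + K)) with (1 / 2 * (1 / 2) ^ (d + K)) in h. rewrite pow_add in h. lra. }
  assert (hr : 0 <= r * (1 / 2) ^ K).
  { assert (h := hd 1%nat). generalize (Rabs_pos (sum_n v K - sum_n v (1 + K))). simpl in h.
    simpl. lra. }
  assert (hex : ex_series v).
  { apply (ex_series_incr_n v (S K)).
    apply (ex_series_le (fun k => v (S K + k)%nat) (fun k => r * (1 / 2) ^ S K * (1 / 2) ^ k)).
    - intros n. change (Rabs (v (S K + n)%nat) <= r * (1 / 2) ^ S K * (1 / 2) ^ n).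
      rewrite Rmult_assoc, <- pow_add. apply hv; lia.
    - apply (ex_series_scal (r * (1 / 2) ^ S K) (fun k => (1 / 2) ^ k)).
      apply ex_series_geom. rewrite Rabs_right; lra. }
  assert (hl : is_lim_seq (fun d => Rabs (sum_n v K - sum_n v (d + K))) (Rabs (sum_n v K - Series v))).
  { apply (is_lim_seq_abs _ (sum_n v K - Series v)).
    apply (is_lim_seq_minus' (fun _ => sum_n v K) (fun d => sum_n v (d + K))).
    - apply is_lim_seq_const.
    - apply (is_lim_seq_incr_n (sum_n v) K). apply Series_correct in hex. exact hex. }
  refine (is_lim_seq_le _ (fun _ => r * (1 / 2) ^ K) _ (Finite (r * (1 / 2) ^ K)) _ hl _).
  - intros d. apply Rle_trans with (1 := hd d). 
    assert (0 < (1 / 2) ^ d) by (apply pow_lt; lra). nra.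
  - apply is_lim_seq_const.
Qed.

Lemma CVU_geometric (u : nat -> R -> R) K :
  (forall n x, (K < n)%nat -> Rabs (u n x) <= (1 / 2) ^ n) ->
  CVU_dom (fun N x => sum_n (fun n => u n x) N) (fun _ => True).
Proof.
  intros hu eps.
  destruct (pow_lt_1_zero (1 / 2) ltac:(rewrite Rabs_right; lra) eps (cond_pos eps)) as [N hN].
  exists (N + K)%nat. intros n hn x _.
  change (Rabs (sum_n (fun n => u n x) n - Series (fun n => u n x)) < eps).
  apply Rle_lt_trans with (1 * (1 / 2) ^ n).
  - apply geometric_tail. intros m hm. rewrite Rmult_1_l. apply hu; lia.
  - rewrite Rmult_1_l. apply Rle_lt_trans with (Rabs ((1 / 2) ^ n)); [apply Rle_abs|].
    apply hN; lia.
Qed.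

(** Terms up to index [K] are exempt from the bounds because in Borel's series the estimate of a
    derivative of order [k] starts only at [n = k + 1]. *)
Lemma is_derive_Series (u : nat -> R -> R) K :
  (forall n, smooth_R (u n)) ->
  (forall n x, (K < n)%nat -> Rabs (u n x) <= (1 / 2) ^ n) ->
  (forall n x, (K < n)%nat -> Rabs (Derive (u n) x) <= (1 / 2) ^ n) ->
  forall x, is_derive (fun y => Series (fun n => u n y)) x (Series (fun n => Derive (u n) x)).
Proof.
  intros su h0 h1 x.
  assert (hd : forall N y, is_derive (fun y => sum_n (fun n => u n y) N) y
    (sum_n (fun n => Derive (u n) y) N)).
  { intros N y. apply (is_derive_sum_n (fun n => u n)).
    intros k _. now apply smooth_R_is_derive. }
  assert (he : forall N y, Derive (fun y => sum_n (fun n => u n y) N) y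
    = sum_n (fun n => Derive (u n) y) N).
  { intros; now apply is_derive_unique. }
  unfold Series at 2.
  rewrite (Lim_seq_ext (sum_n (fun n => Derive (u n) x))
    (fun N => Derive (fun y => sum_n (fun n => u n y) N) x)) by (intros; now rewrite he).
  apply (CVU_Derive (fun N y => sum_n (fun n => u n y) N) (fun _ => True)); auto.
  - apply open_true.
  - intros a b c; auto.
  - now apply (CVU_geometric u K).
  - intros N y _; eexists; apply hd.
  - intros N y _. apply continuity_pt_filterlim.
    apply (continuous_ext (fun y => sum_n (fun n => Derive (u n) y) N)); [intros; now rewrite he|].
    assert (hs : smooth_R (fun y => sum_n (fun n => Derive (u n) y) N)).
    { induction N as [|N IH].
      - apply (smooth_R_ext (Derive (u O))); [intros; now rewrite sum_O|].
        now apply smooth_R_Derive.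
      - apply (smooth_R_ext (fun y => sum_n (fun n => Derive (u n) y) N + Derive (u (S N)) y)).
        + intros; now rewrite sum_Sn.
        + apply smooth_R_plus; auto using smooth_R_Derive. }
    now apply (smooth_R_continuous _ y).
  - assert (hc := CVU_geometric (fun n => Derive (u n)) K h1).
    intros eps; destruct (hc eps) as [N hN]. exists N. intros n hn y _.
    rewrite he. rewrite (Lim_seq_ext _ (fun n0 => sum_n (fun n => Derive (u n) y) n0)); auto.
Qed.

Lemma smooth_R_compact_bounded f : smooth_R f -> (forall x, 2 <= Rabs x -> f x = 0) ->
  exists B, forall x, Rabs (f x) <= B.
Proof.
  intros sf h0.
  destruct (continuity_ab_maj (fun x => Rabs (f x)) (-2) 2) as [m [hm _]]; [lra| |].
  - intros c _. apply continuity_pt_filterlim.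
    apply (continuous_comp f Rabs); [now apply smooth_R_continuous|apply continuous_Rabs].
  - exists (Rabs (f m)). intros x. destruct (Rle_lt_dec 2 (Rabs x)) as [h|h].
    + rewrite h0, Rabs_R0 by auto. apply Rabs_pos.
    + apply hm. apply Rabs_lt_between in h. lra.
Qed.

Lemma Derive_n_support f k : (forall x, 2 < Rabs x -> f x = 0) ->
  forall x, 2 < Rabs x -> Derive_n f k x = 0.
Proof.
  intros h0; induction k as [|k IH]; intros x hx; simpl; auto.
  rewrite (Derive_ext_loc _ (fun _ => 0)); [apply Derive_const|].
  assert (o : open (fun y : R => 2 < Rabs y)).
  { apply (open_comp Rabs (fun y => 2 < y)); [|apply open_gt].
    intros y _; apply (continuous_Rabs y). }
  generalize (o x hx); apply filter_imp; auto.
Qed.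

Lemma smooth_R_Derive_n_scal f a n x : smooth_R f ->
  Derive_n (fun y => f (a * y)) n x = a ^ n * Derive_n f n (a * x).
Proof.
  intros hf. apply Derive_n_comp_scal. apply filter_forall; intros y k _.
  destruct k as [|k]; simpl; auto.
  exists (Derive (Derive_n f k) y).
  now apply smooth_R_is_derive, smooth_R_Derive_n.
Qed.

Lemma psum_sum_n a n t : psum a (S n) t = sum_n (fun k => a k * t ^ k) n.
Proof.
  induction n as [|n IH].
  - rewrite sum_O. simpl; ring.
  - rewrite sum_Sn, <- IH. reflexivity.
Qed.

Lemma uniform_bounds (P : nat -> nat -> R -> Prop) N :
  (forall j k b b', b <= b' -> P j k b -> P j k b') ->
  (forall j k, exists b, P j k b) ->
  exists b, 0 <= b /\ forall j k, (j <= N)%nat -> (k <= N)%nat -> P j k b.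
Proof.
  intros hmon hex.
  assert (h1 : forall j M, exists b, 0 <= b /\ forall k, (k <= M)%nat -> P j k b).
  { intros j; induction M as [|M [b [hb h]]].
    - destruct (hex j O) as [b hb]. exists (Rabs b); split; [apply Rabs_pos|].
      intros k hk. replace k with O by lia. apply (hmon _ _ b); auto. apply Rle_abs.
    - destruct (hex j (S M)) as [b' hb']. exists (b + Rabs b').
      assert (h' := Rabs_pos b'). assert (h'' := Rle_abs b'). split; [lra|].
      intros k hk. destruct (Nat.eq_dec k (S M)) as [->|hne].
      + apply (hmon _ _ b'); auto; lra.
      + apply (hmon _ _ b); [lra|]. apply h; lia. }
  assert (h2 : forall M, exists b, 0 <= b /\ forall j k, (j <= M)%nat -> (k <= N)%nat -> P j k b).
  { induction M as [|M [b [hb h]]].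
    - destruct (h1 O N) as [b [hb h]]. exists b; split; auto.
      intros j k hj hk. replace j with O by lia. auto.
    - destruct (h1 (S M) N) as [b' [hb' h']]. exists (b + b'); split; [lra|].
      intros j k hj hk. destruct (Nat.eq_dec j (S M)) as [->|hne].
      + apply (hmon _ _ b'); auto; lra.
      + apply (hmon _ _ b); [lra|]. apply h; lia. }
  apply h2.
Qed.

(* The sum of the [a n * x ^ n * chi (x / eps n)], where [chi] is a bump function
   and [eps n] is so small that the derivatives of order below [n] of the [n]-th
   term are at most [2 ^ - n]. *)
Lemma borel (a : nat -> R) :
  exists f, smooth_R f /\ forall N, bigO full N (fun t => f t - psum a N t).
Proof.
  destruct bump_exists as [chi [schi [chi1 chi0]]].
  set (psi := fun j x => x ^ j * chi x).
  assert (spsi : forall j, smooth_R (psi j)).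
  { intros j; unfold psi; solve_smooth. }
  assert (psi0 : forall j x, 2 < Rabs x -> psi j x = 0).
  { intros j x hx; unfold psi; rewrite chi0 by lra; ring. }
  (* All [j <= n] are needed, not only [j = n]: the remainder estimate at the end splits off [t ^ N]
     and leaves [psi (n - N)]. *)
  assert (hB : forall n, exists b, 0 <= b /\ forall j k, (j <= n)%nat -> (k <= n)%nat ->
     forall x, Rabs (Derive_n (psi j) k x) <= b).
  { intros n. apply (uniform_bounds (fun j k b => forall x, Rabs (Derive_n (psi j) k x) <= b)).
    - intros j k b b' hb h x; specialize (h x); lra.
    (* Derivatives are known to vanish only on the open set [2 < Rabs x]. The rescaling by [3 / 2]
       makes them vanish from 2 on, endpoint included. *)
    - intros j k. destruct (smooth_R_compact_bounded (fun x => Derive_n (psi j) k (3 / 2 * x))) as [b hb].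
      + apply (smooth_R_comp (fun x => 3 / 2 * x)); auto using smooth_R_Derive_n.
        solve_smooth.
      + intros x hx. apply Derive_n_support; auto.
        rewrite Rabs_mult, Rabs_right; lra.
      + exists b. intros x. specialize (hb (2 / 3 * x)).
        now replace (3 / 2 * (2 / 3 * x)) with x in hb by field. }
  destruct (ClassicalEpsilon.choice _ hB) as [B HB]. clear hB.
  (* This choice gives at once [eps n <= (1 / 2) ^ n] and [Rabs (a n) * B n * eps n <= (1 / 2) ^ n],
     so a single factor [eps n] absorbs both the coefficient and the bound on the derivatives. *)
  set (eps := fun n => (1 / 2) ^ n / (1 + Rabs (a n) * B n)).
  assert (hden : forall n, 1 <= 1 + Rabs (a n) * B n).
  { intros n. destruct (HB n) as [h _]. generalize (Rmult_le_pos _ _ (Rabs_pos (a n)) h); lra. }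
  assert (hpow : forall n, 0 < (1 / 2) ^ n) by (intros; apply pow_lt; lra).
  assert (heps : forall n, 0 < eps n <= (1 / 2) ^ n).
  { intros n. specialize (hden n); specialize (hpow n). split.
    - apply Rdiv_lt_0_compat; lra.
    - unfold eps. apply Rle_div_l; [lra|]. rewrite <- (Rmult_1_r ((1 / 2) ^ n)) at 1.
      apply Rmult_le_compat_l; lra. }
  assert (heps1 : forall n, eps n <= 1).
  { intros n. apply Rle_trans with (1 := proj2 (heps n)).
    apply Rle_trans with (1 ^ n); [apply pow_incr; lra|rewrite pow1; lra]. }
  assert (hsmall : forall n, Rabs (a n) * B n * eps n <= (1 / 2) ^ n).
  { intros n. unfold eps. specialize (hden n); specialize (hpow n).
    replace (Rabs (a n) * B n * ((1 / 2) ^ n / (1 + Rabs (a n) * B n)))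
      with ((Rabs (a n) * B n) * (1 / 2) ^ n / (1 + Rabs (a n) * B n)) by (field; lra).
    apply Rle_div_l; [lra|]. rewrite (Rmult_comm _ ((1 / 2) ^ n)).
    apply Rmult_le_compat_l; lra. }
  assert (hterm : forall n m j k x, (j <= n)%nat -> (k <= n)%nat ->
     Rabs (a n * (eps n ^ S m * Derive_n (psi j) k (/ eps n * x))) <= (1 / 2) ^ n).
  { intros n m j k x hj hk. rewrite !Rabs_mult.
    assert (h1 := proj2 (HB n) j k hj hk (/ eps n * x)).
    assert (h2 : Rabs (eps n ^ S m) <= eps n).
    { rewrite <- RPow_abs, Rabs_right by (generalize (heps n); lra).
      simpl. rewrite <- (Rmult_1_r (eps n)) at 3.
      apply Rmult_le_compat_l; [generalize (heps n); lra|].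
      rewrite <- (pow1 m). apply pow_incr. generalize (heps n) (heps1 n); lra. }
    apply Rle_trans with (2 := hsmall n).
    rewrite (Rmult_assoc (Rabs (a n))). apply Rmult_le_compat_l; [apply Rabs_pos|].
    rewrite Rmult_comm. apply Rmult_le_compat; auto using Rabs_pos. }
  set (u := fun n x => a n * (eps n ^ n * psi n (/ eps n * x))).
  assert (su : forall n, smooth_R (u n)).
  { intros n. unfold u. apply smooth_R_mult; [apply smooth_R_const|].
    apply smooth_R_mult; [apply smooth_R_const|].
    apply (smooth_R_comp (fun x => / eps n * x)); auto.
    solve_smooth. }
  (* Each derivative costs a factor [/ eps n]; for [k < n] at least one of the [n] factors [eps n]
     survives, hence the exponent written [S (n - k - 1)]. *)
  assert (hu : forall n k x, (k < n)%nat -> Rabs (Derive_n (u n) k x) <= (1 / 2) ^ n).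
  { intros n k x hk. unfold u.
    rewrite !Derive_n_scal_l, smooth_R_Derive_n_scal by auto.
    replace (eps n ^ n * ((/ eps n) ^ k * Derive_n (psi n) k (/ eps n * x)))
      with (eps n ^ S (n - k - 1) * Derive_n (psi n) k (/ eps n * x)).
    - apply hterm; lia.
    - replace (eps n ^ n) with (eps n ^ S (n - k - 1) * eps n ^ k)
        by (rewrite <- pow_add; f_equal; lia).
      rewrite pow_inv. field. apply pow_nonzero. generalize (heps n); lra. }
  set (G := fun k x => Series (fun n => Derive_n (u n) k x)).
  assert (hG : forall k x, is_derive (G k) x (G (S k) x)).
  { intros k x. apply (is_derive_Series (fun n => Derive_n (u n) k) (S k)).
    - intros n; now apply smooth_R_Derive_n.
    - intros n y hn. apply hu; lia.
    - intros n y hn. apply (hu n (S k)); lia. }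
  exists (G O); split.
  { intros k. apply (Ck_of_family (fun _ => True) G); auto. }
  intros N.
  (* [sum_n] up to [N] includes the term of index [N], which [psum a N] does not; that term is
     itself of order [N]. *)
  apply (bigO_eq full N (fun t => (G O t - psum a (S N) t) + a N * t ^ N)).
  { intros t; simpl; ring. }
  apply bigO_plus; [|apply bigO_scal, bigO_pow].
  assert (hm : exists del : posreal, forall n, (n <= N)%nat -> del <= eps n).
  { clear -heps. induction N as [|N [d hd]].
    - exists (mkposreal _ (proj1 (heps O))). intros n hn. replace n with O by lia. simpl; lra.
    - assert (h : 0 < Rmin d (eps (S N))) by (apply Rmin_pos; [apply cond_pos|apply heps]).
      exists (mkposreal _ h). intros n hn. simpl.
      destruct (Nat.eq_dec n (S N)) as [->|hne]; [apply Rmin_r|].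
      apply Rle_trans with (1 := Rmin_l _ _). apply hd; lia. }
  destruct hm as [del hdel].
  exists ((1 / 2) ^ N). exists del. intros t ht _.
  change (Rabs (t - 0) < del) in ht. rewrite Rminus_0_r in ht.
  assert (e : psum a (S N) t = sum_n (fun n => u n t) N).
  { rewrite psum_sum_n. apply sum_n_ext_loc. intros n hn. unfold u, psi.
    assert (h := heps n). assert (h' := hdel n hn).
    rewrite chi1.
    - match goal with |- ?A = ?B => change (@eq R A B) end. rewrite Rpow_mult_distr, pow_inv. field. apply pow_nonzero; lra.
    - rewrite Rabs_mult, Rabs_inv, (Rabs_right (eps n)) by lra.
      apply (Rmult_le_reg_l (eps n)); [lra|].
      rewrite <- Rmult_assoc, Rinv_r, Rmult_1_r by lra. lra. }
  rewrite e, Rabs_minus_sym, (Rmult_comm ((1 / 2) ^ N)).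
  apply (geometric_tail (fun n => u n t)).
  intros n hn.
  (* The tail gains its factor [t ^ N] from [psi n], which is a power times [chi]; what remains has
     [n - N > 0] factors [eps n] and is bounded by [hterm] with no derivative. *)
  replace (u n t) with (t ^ N * (a n * (eps n ^ S (n - N - 1) * Derive_n (psi (n - N)%nat) 0 (/ eps n * t)))).
  - rewrite Rabs_mult, <- RPow_abs. apply Rmult_le_compat_l; [apply pow_le, Rabs_pos|].
    apply hterm; lia.
  - simpl Derive_n. unfold u, psi. replace (S (n - N - 1)) with (n - N)%nat by lia.
    replace (eps n ^ n) with (eps n ^ (n - N) * eps n ^ N) by (rewrite <- pow_add; f_equal; lia).
    replace ((/ eps n * t) ^ n) with ((/ eps n * t) ^ (n - N) * (/ eps n * t) ^ N)
      by (rewrite <- pow_add; f_equal; lia).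
    rewrite (Rpow_mult_distr _ _ N), pow_inv. field.
    apply pow_nonzero. generalize (heps n); lra.
Qed.

(** * Flat functions and roots *)

Definition flat (f : R -> R) : Prop := forall n, bigO full n f.

Lemma flat_factor f n : smooth_R f -> flat f ->
  exists q, smooth_R q /\ flat q /\ forall t, f t = t ^ n * q t.
Proof.
  intros sf hf. destruct (bigO_smooth_factor f n sf (hf n)) as [q [sq e]].
  exists q; repeat split; auto. intros m. apply (bigO_pow_cancel full n).
  apply (bigO_eq full _ f); auto.
Qed.

Lemma flat_Derive f : smooth_R f -> flat f -> flat (Derive f).
Proof. intros sf hf n; now apply bigO_Derive. Qed.

Lemma flat_0 f : smooth_R f -> flat f -> f 0 = 0.
Proof. intros sf hf; now apply (bigO_S_value f 0). Qed.

(* On each side of the origin, [c] is a branch of the root of order [S i], or zero. *)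
Lemma smooth_R_flat_root (c r : R -> R) (i : nat) :
  (forall u, Rabs (c u) ^ S i <= Rabs u) ->
  (forall u, u <> 0 ->
     (c u <> 0 /\ is_derive c u (/ INR (S i) / c u ^ i)) \/ locally u (fun v => c v = 0)) ->
  smooth_R r -> flat r -> smooth_R (fun u => r (c u)).
Proof.
  intros hc1 hc2 sr fr k; revert r sr fr.
  assert (c0 : c 0 = 0).
  { specialize (hc1 0). rewrite Rabs_R0 in hc1.
    destruct (Req_dec (c 0) 0) as [h|h]; auto.
    assert (0 < Rabs (c 0) ^ S i) by (apply pow_lt, Rabs_pos_lt; auto). lra. }
  (* Composites with flat functions are closed under differentiation: [Derive r] is flat, hence
     divisible by the power [c ^ i] in the denominator of the derivative of [c], with a flat
     quotient. *)
  assert (hder : forall r, smooth_R r -> flat r -> exists q, smooth_R q /\ flat q /\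
    forall u, is_derive (fun u => r (c u)) u (q (c u))).
  { intros r sr fr.
    destruct (flat_factor (Derive r) i) as [q [sq [fq hq]]];
      auto using smooth_R_Derive, flat_Derive.
    exists (fun t => / INR (S i) * q t); split; [|split].
    - apply smooth_R_mult; auto using smooth_R_const.
    - intros n; now apply bigO_scal.
    - intros u. destruct (Req_dec u 0) as [->|hu].
      + rewrite c0, (flat_0 q), Rmult_0_r by auto.
        (* Order [2 * S i] in [c u] is order 2 in [u], which gives derivative zero at the origin. *)
        destruct (bigO_nonneg _ _ _ (fr (2 * S i)%nat)) as [C [hC [del hdel]]].
        apply (is_derive_of_quadratic_bound _ _ _ C).
        assert (hd : 0 < Rmin 1 (del ^ S i)).
        { apply Rmin_pos; [lra|]. apply pow_lt, cond_pos. }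
        exists (mkposreal _ hd). intros u hu. change (Rabs (u - 0) < Rmin 1 (del ^ S i)) in hu.
        rewrite Rminus_0_r in *. rewrite c0, (flat_0 r) by auto.
        replace (r (c u) - 0 - 0 * u) with (r (c u)) by ring.
        destruct (Req_dec (c u) 0) as [e|e].
        * rewrite e, flat_0, Rabs_R0 by auto. apply Rmult_le_pos; auto. apply pow2_ge_0.
        * assert (hb : ball 0 del (c u)).
          { change (Rabs (c u - 0) < del). rewrite Rminus_0_r.
            apply Rnot_le_lt. intros hge.
            assert (h := pow_incr del (Rabs (c u)) (S i) (conj (Rlt_le _ _ (cond_pos del)) hge)).
            specialize (hc1 u). assert (h2 := Rmin_r 1 (del ^ S i)). lra. }
          specialize (hdel (c u) hb (conj Logic.I e)).
          apply Rle_trans with (1 := hdel). apply Rmult_le_compat_l; auto.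
          rewrite (Nat.mul_comm 2), pow_mult, <- (pow2_abs u).
          apply pow_incr. split; auto. apply pow_le, Rabs_pos.
      + destruct (hc2 u hu) as [[hcu hd]|hl].
        * replace (/ INR (S i) * q (c u)) with ((/ INR (S i) / c u ^ i) * Derive r (c u)).
          2: { rewrite hq. field. split; [apply not_0_INR; lia|now apply pow_nonzero]. }
          apply (is_derive_comp r c); auto. now apply smooth_R_is_derive.
        * rewrite (locally_singleton _ _ hl), (flat_0 q), Rmult_0_r by auto.
          apply (is_derive_ext_loc (fun _ => 0)).
          { revert hl; apply filter_imp; intros v hv. now rewrite hv, flat_0. }
          auto_derive; auto. }
  induction k as [|k IH]; intros r sr fr.
  - intros u _. destruct (hder r sr fr) as [q [_ [_ hq]]].
    apply (ex_derive_continuous (fun u => r (c u))). eexists; apply hq.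
  - destruct (hder r sr fr) as [q [sq [fq hq]]].
    apply (Ck_of_derive k _ _ (fun u => q (c u))); auto.
Qed.

Definition cbrt (u : R) : R :=
  if Rlt_dec 0 u then Rpower u (/ 3) else if Rlt_dec u 0 then - Rpower (- u) (/ 3) else 0.

Lemma Rpower_root i u : 0 < u -> Rpower u (/ INR (S i)) ^ S i = u.
Proof.
  intros hu. rewrite <- Rpower_pow by apply exp_pos.
  rewrite Rpower_mult, Rinv_l by (apply not_0_INR; lia).
  now apply Rpower_1.
Qed.

Lemma is_derive_Rpower_root i u : 0 < u ->
  is_derive (fun v => Rpower v (/ INR (S i))) u (/ INR (S i) / Rpower u (/ INR (S i)) ^ i).
Proof.
  intros hu. assert (h := Rpower_root i u hu).
  assert (hp : 0 < Rpower u (/ INR (S i))) by apply exp_pos.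
  assert (hi : INR (S i) <> 0) by (apply not_0_INR; lia).
  unfold Rpower in *. set (a := / INR (S i)) in *.
  auto_derive; auto.
  replace (/ u) with (/ exp (a * ln u) ^ S i) by now rewrite h.
  simpl pow. field. split; [apply pow_nonzero|]; lra.
Qed.

Lemma Rpower_third u : 0 < u -> Rpower u (/ 3) ^ 3 = u.
Proof. replace (/ 3) with (/ INR 3) by (simpl; f_equal; ring). apply (Rpower_root 2). Qed.

Lemma cbrt_pow u : cbrt u ^ 3 = u.
Proof.
  unfold cbrt; destruct (Rlt_dec 0 u) as [h|h]; [now apply Rpower_third|].
  destruct (Rlt_dec u 0) as [h'|h'].
  - replace ((- Rpower (- u) (/ 3)) ^ 3) with (- Rpower (- u) (/ 3) ^ 3) by ring.
    rewrite Rpower_third; lra.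
  - replace u with 0 by lra. ring.
Qed.

Lemma cube_inj a b : a ^ 3 = b ^ 3 -> a = b.
Proof.
  intros h. assert (h1 : (a - b) * (a ^ 2 + a * b + b ^ 2) = 0) by (ring_simplify; lra).
  apply Rmult_integral in h1. destruct h1 as [h1|h1]; [lra|].
  assert (ha : a = 0) by (apply Rsqr_0_uniq; unfold Rsqr; nra).
  assert (hb : b = 0) by (apply Rsqr_0_uniq; unfold Rsqr; nra). lra.
Qed.

Lemma cbrt_cube t : cbrt (t ^ 3) = t.
Proof. apply cube_inj, cbrt_pow. Qed.

Lemma cbrt_neq_0 u : u <> 0 -> cbrt u <> 0.
Proof. intros hu e. apply hu. rewrite <- (cbrt_pow u), e; ring. Qed.

Lemma is_derive_Rpower_third u : 0 < u ->
  is_derive (fun v => Rpower v (/ 3)) u (/ 3 / Rpower u (/ 3) ^ 2).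
Proof. replace 3 with (INR 3) by (simpl; ring). apply (is_derive_Rpower_root 2). Qed.

Lemma is_derive_cbrt u : u <> 0 -> is_derive cbrt u (/ 3 / cbrt u ^ 2).
Proof.
  intros hu. destruct (Rlt_le_dec 0 u) as [h|h].
  - replace (cbrt u) with (Rpower u (/ 3)) by (unfold cbrt; destruct (Rlt_dec 0 u); auto; lra).
    apply (is_derive_ext_loc (fun v => Rpower v (/ 3))); [|now apply is_derive_Rpower_third].
    generalize (open_gt 0 u h); apply filter_imp. intros v hv.
    unfold cbrt; destruct (Rlt_dec 0 v); auto; lra.
  - assert (h' : u < 0) by lra.
    assert (e : forall v, v < 0 -> - Rpower (- v) (/ 3) = cbrt v).
    { intros v hv. unfold cbrt; destruct (Rlt_dec 0 v); [lra|]. destruct (Rlt_dec v 0); auto; lra. }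
    rewrite <- e by auto.
    apply (is_derive_ext_loc (fun v => - Rpower (- v) (/ 3))).
    { generalize (open_lt 0 u h'); apply filter_imp. intros v hv; now apply e. }
    assert (hd := is_derive_Rpower_third (- u) ltac:(lra)).
    replace (/ 3 / (- Rpower (- u) (/ 3)) ^ 2) with (- (- 1 * (/ 3 / Rpower (- u) (/ 3) ^ 2))).
    + apply (is_derive_opp (fun v => Rpower (- v) (/ 3))).
      apply (is_derive_comp (fun v => Rpower v (/ 3)) Ropp); auto.
      auto_derive; auto; ring.
    + field. generalize (exp_pos (/ 3 * ln (- u))); unfold Rpower; lra.
Qed.

(** * Division by a monomial map *)

Lemma bigO_comp_pow f i N : (0 < i)%nat -> bigO full N f -> bigO full (i * N) (fun t => f (t ^ i)).
Proof.
  intros hi [C [del hdel]]. exists C.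
  assert (hd : 0 < Rmin 1 del) by (apply Rmin_pos; [lra|apply cond_pos]).
  exists (mkposreal _ hd). intros t ht [_ t0]. change (Rabs (t - 0) < Rmin 1 del) in ht.
  rewrite Rminus_0_r in ht. rewrite pow_mult, RPow_abs.
  apply hdel; [|split; [exact Logic.I|now apply pow_nonzero]].
  change (Rabs (t ^ i - 0) < del). rewrite Rminus_0_r, <- RPow_abs.
  assert (h1 := Rmin_l 1 del). assert (h2 := Rmin_r 1 del).
  destruct i as [|i]; [lia|]. simpl.
  assert (Rabs t ^ i <= 1).
  { apply Rle_trans with (1 ^ i); [apply pow_incr; split; [apply Rabs_pos|lra]|rewrite pow1; lra]. }
  generalize (Rabs_pos t); nra.
Qed.

Lemma smooth_R_comp_pow f i : smooth_R f -> smooth_R (fun t => f (t ^ i)).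
Proof. intros; apply (smooth_R_comp (fun t => t ^ i)); auto using smooth_R_pow, smooth_R_id. Qed.

(* Borel's theorem prescribes the Taylor series of the quotients by residue class of
   the exponent. What is left is flat, hence smooth in the root of its argument. *)
Lemma divide_square g : smooth_R g ->
  exists g0 g1, smooth_R g0 /\ smooth_R g1 /\ forall t, g t = g0 (t ^ 2) + t * g1 (t ^ 2).
Proof.
  intros sg. set (a := tcoef g).
  destruct (borel (fun k => a (2 * k)%nat)) as [b0 [sb0 hb0]].
  destruct (borel (fun k => a (2 * k + 1)%nat)) as [b1 [sb1 hb1]].
  set (r := fun t => g t - (b0 (t ^ 2) + t * b1 (t ^ 2))).
  assert (sr : smooth_R r).
  { apply smooth_R_minus, smooth_R_plus; auto using smooth_R_comp_pow.
    apply smooth_R_mult; auto using smooth_R_id, smooth_R_comp_pow. }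
  assert (hp : forall N t, psum a (2 * N) t = psum (fun k => a (2 * k)%nat) N (t ^ 2)
     + t * psum (fun k => a (2 * k + 1)%nat) N (t ^ 2)).
  { intros N t; induction N as [|N IH]; [simpl; ring|].
    replace (2 * S N)%nat with (S (S (2 * N))) by lia. cbn [psum].
    rewrite IH, <- !pow_mult. replace (2 * N + 1)%nat with (S (2 * N)) by lia. simpl pow; ring. }
  assert (fr : flat r).
  { intros N. apply (bigO_le full (2 * N)); [lia|].
    apply (bigO_eq full _ (fun t => (g t - psum a (2 * N) t)
      - ((b0 (t ^ 2) - psum (fun k => a (2 * k)%nat) N (t ^ 2))
      + t * (b1 (t ^ 2) - psum (fun k => a (2 * k + 1)%nat) N (t ^ 2))))).
    { intros t. rewrite hp. unfold r. ring. }
    apply bigO_minus; [now apply taylor_bigO|]. apply bigO_plus.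
    - apply (bigO_comp_pow (fun u => b0 u - psum (fun k => a (2 * k)%nat) N u)); auto; lia.
    - apply (bigO_mult full 0 (2 * N) (fun t => t)).
      + apply bigO_continuous, continuous_id.
      + apply (bigO_comp_pow (fun u => b1 u - psum (fun k => a (2 * k + 1)%nat) N u)); auto; lia. }
  assert (srm : smooth_R (fun t => r (-1 * t))).
  { apply (smooth_R_comp (fun t => -1 * t)); auto.
    solve_smooth. }
  assert (frm : flat (fun t => r (-1 * t))).
  { intros n. destruct (fr n) as [C [del hdel]]. exists C, del. intros t ht [_ t0].
    replace (Rabs t) with (Rabs (-1 * t)) by (rewrite Rabs_mult, Rabs_left; lra).
    apply hdel.
    - change (Rabs (t - 0) < del) in ht. change (Rabs (-1 * t - 0) < del).
      replace (-1 * t - 0) with (- (t - 0)) by ring. now rewrite Rabs_Ropp.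
    - split; [exact Logic.I|lra]. }
  (* [sqrt (t ^ 2)] recovers only [Rabs t]. The flat remainder is split by parity: the even part
     does not see the sign, and the odd part is [t] times an even flat function. *)
  set (re := fun t => / 2 * (r t + r (-1 * t))).
  set (ro := fun t => / 2 * (r t - r (-1 * t))).
  assert (sre : smooth_R re) by (apply smooth_R_mult; auto using smooth_R_const, smooth_R_plus).
  assert (sro : smooth_R ro) by (apply smooth_R_mult; auto using smooth_R_const, smooth_R_minus).
  assert (fre : flat re) by (intros n; apply bigO_scal, bigO_plus; auto).
  assert (fro : flat ro) by (intros n; apply bigO_scal, bigO_minus; auto).
  destruct (flat_factor ro 1 sro fro) as [q [sq [fq hq]]].
  assert (hroot : forall f, smooth_R f -> flat f -> smooth_R (fun u => f (sqrt u))).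
  { intros f sf ff. apply (smooth_R_flat_root sqrt f 1); auto.
    - intros u. destruct (Rle_lt_dec 0 u) as [h|h].
      + rewrite (Rabs_right (sqrt u)), (Rabs_right u) by (try apply Rle_ge; auto using sqrt_pos).
        rewrite pow2_sqrt; lra.
      + rewrite sqrt_neg_0, Rabs_R0 by lra. rewrite pow_ne_zero by lia. apply Rabs_pos.
    - intros u hu. destruct (Rlt_le_dec 0 u) as [h|h].
      + left. assert (h' := sqrt_lt_R0 u h). split; [lra|].
        auto_derive; auto. simpl. field; lra.
      + right. assert (h' : u < 0) by lra. generalize (open_lt 0 u h'); apply filter_imp.
        intros v hv. apply sqrt_neg_0; lra. }
  exists (fun u => b0 u + re (sqrt u)), (fun u => b1 u + q (sqrt u)); repeat split.
  - apply smooth_R_plus; auto.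
  - apply smooth_R_plus; auto.
  - intros t.
    assert (hs : sqrt (t ^ 2) = Rabs t).
    { replace (t ^ 2) with (Rsqr t) by (unfold Rsqr; ring). apply sqrt_Rsqr_abs. }
    rewrite hs.
    assert (e1 : re (Rabs t) = re t).
    { unfold Rabs; destruct (Rcase_abs t); auto. unfold re.
      replace (-1 * - t) with t by ring. replace (- t) with (-1 * t) by ring. ring. }
    assert (e2 : t * q (Rabs t) = ro t).
    { unfold Rabs; destruct (Rcase_abs t); [|rewrite (hq t); ring].
      apply Rmult_eq_reg_l with (-1); [|lra].
      replace (-1 * (t * q (- t))) with ((- t) ^ 1 * q (- t)) by ring. rewrite <- hq.
      unfold ro. replace (-1 * - t) with t by ring. replace (- t) with (-1 * t) by ring. ring. }
    rewrite e1, Rmult_plus_distr_l, e2. unfold re, ro, r. field.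
Qed.

Lemma divide_cube g : smooth_R g ->
  exists g0 g1 g2, smooth_R g0 /\ smooth_R g1 /\ smooth_R g2 /\
    forall t, g t = g0 (t ^ 3) + t * g1 (t ^ 3) + t ^ 2 * g2 (t ^ 3).
Proof.
  intros sg. set (a := tcoef g).
  destruct (borel (fun k => a (3 * k)%nat)) as [b0 [sb0 hb0]].
  destruct (borel (fun k => a (3 * k + 1)%nat)) as [b1 [sb1 hb1]].
  destruct (borel (fun k => a (3 * k + 2)%nat)) as [b2 [sb2 hb2]].
  set (r := fun t => g t - (b0 (t ^ 3) + t * b1 (t ^ 3) + t ^ 2 * b2 (t ^ 3))).
  assert (sr : smooth_R r).
  { apply smooth_R_minus, smooth_R_plus; [auto|apply smooth_R_plus|]; auto using smooth_R_comp_pow;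
    apply smooth_R_mult; auto using smooth_R_id, smooth_R_comp_pow, smooth_R_pow. }
  assert (hp : forall N t, psum a (3 * N) t = psum (fun k => a (3 * k)%nat) N (t ^ 3)
     + t * psum (fun k => a (3 * k + 1)%nat) N (t ^ 3)
     + t ^ 2 * psum (fun k => a (3 * k + 2)%nat) N (t ^ 3)).
  { intros N t; induction N as [|N IH]; [simpl; ring|].
    replace (3 * S N)%nat with (S (S (S (3 * N)))) by lia. cbn [psum].
    rewrite IH, <- !pow_mult. replace (3 * N + 1)%nat with (S (3 * N)) by lia.
    replace (3 * N + 2)%nat with (S (S (3 * N))) by lia. simpl pow; ring. }
  assert (fr : flat r).
  { intros N. apply (bigO_le full (3 * N)); [lia|].
    apply (bigO_eq full _ (fun t => (g t - psum a (3 * N) t)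
      - ((b0 (t ^ 3) - psum (fun k => a (3 * k)%nat) N (t ^ 3))
      + t * (b1 (t ^ 3) - psum (fun k => a (3 * k + 1)%nat) N (t ^ 3))
      + t ^ 2 * (b2 (t ^ 3) - psum (fun k => a (3 * k + 2)%nat) N (t ^ 3))))).
    { intros t. rewrite hp. unfold r. ring. }
    apply bigO_minus; [now apply taylor_bigO|]. apply bigO_plus; [apply bigO_plus|].
    - apply (bigO_comp_pow (fun u => b0 u - psum (fun k => a (3 * k)%nat) N u)); auto; lia.
    - apply (bigO_mult full 0 (3 * N) (fun t => t)).
      + apply bigO_continuous, continuous_id.
      + apply (bigO_comp_pow (fun u => b1 u - psum (fun k => a (3 * k + 1)%nat) N u)); auto; lia.
    - apply (bigO_mult full 0 (3 * N) (fun t => t ^ 2)).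
      + apply bigO_continuous, smooth_R_continuous, smooth_R_pow, smooth_R_id.
      + apply (bigO_comp_pow (fun u => b2 u - psum (fun k => a (3 * k + 2)%nat) N u)); auto; lia. }
  (* [cbrt] inverts the cube on the whole line, so the flat remainder goes undivided into the first
     quotient. *)
  exists (fun u => b0 u + r (cbrt u)), b1, b2; repeat split; auto.
  - apply smooth_R_plus; auto. apply (smooth_R_flat_root cbrt r 2); auto.
    + intros u. rewrite RPow_abs, cbrt_pow. lra.
    + intros u hu. left; split; [now apply cbrt_neq_0|].
      replace (INR 3) with 3 by (simpl; ring). now apply is_derive_cbrt.
  - intros t. rewrite cbrt_cube. unfold r. ring.
Qed.

(** * Inverse functions *)

Lemma hq_0 f : smooth_R f -> hq f 0 = Derive f 0.
Proof.
  intros hf. unfold hq, moment.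
  rewrite (RInt_ext _ (fun _ => Derive f 0)).
  - rewrite RInt_const. unfold scal; simpl; unfold mult; simpl; ring.
  - intros s _. rewrite Rmult_0_l. simpl; ring.
Qed.

Lemma smooth_R_shift f x : smooth_R f -> smooth_R (fun h => f (x + h)).
Proof.
  intros hf. apply (smooth_R_comp (fun h => x + h)); auto.
  apply smooth_R_plus; auto using smooth_R_const, smooth_R_id.
Qed.

Lemma Derive_shift f x h : Derive (fun h => f (x + h)) h = Derive f (x + h).
Proof.
  unfold Derive, Lim. f_equal. apply Lim_seq_ext; intros n.
  now rewrite Rplus_assoc.
Qed.

Lemma first_order_taylor f x : smooth_R f ->
  exists C, 0 <= C /\ locally x (fun y => Rabs (f y - f x - Derive f x * (y - x)) <= C * (y - x) ^ 2).
Proof.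
  intros sf. set (g := fun h => f (x + h)).
  assert (sg : smooth_R g) by now apply smooth_R_shift.
  destruct (bigO_nonneg _ _ _ (taylor_bigO full g 2 sg)) as [C [hC [del h]]].
  exists C; split; auto. exists del. refine (_ : forall y : R, Rabs (y - x) < del -> _). intros y hy.
  destruct (Req_dec (y - x) 0) as [e|e].
  { replace y with x by lra. rewrite !Rminus_diag, Rmult_0_r, Rminus_diag, Rabs_R0. lra. }
  assert (hb : ball 0 del (y - x)) by (change (Rabs (y - x - 0) < del); now rewrite Rminus_0_r).
  specialize (h _ hb (conj Logic.I e)). rewrite pow2_abs in h.
  replace (f y - f x - Derive f x * (y - x)) with (g (y - x) - psum (tcoef g) 2 (y - x)); auto.
  unfold tcoef; simpl. rewrite hq_0 by auto. unfold g. rewrite Derive_shift.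
  rewrite Rplus_0_r. replace (x + (y - x)) with y by ring. ring.
Qed.

(** Inverse function theorem on the line. A lower bound [m] for the slope gives preimages by the
    intermediate value theorem and a Lipschitz inverse; the equation for the derivative of the
    inverse then raises its regularity step by step. *)
Lemma diffeo_germ_of_derive (S : R -> R) :
  smooth_R S -> S 0 = 0 -> 0 < Derive S 0 -> diffeo_germ (V := R_NormedModule) S.
Proof.
  intros sS S0 hS. set (m := Derive S 0 / 2). assert (hm : 0 < m) by (unfold m; lra).
  assert (hcont : continuous (Derive S) 0) by now apply smooth_R_continuous, smooth_R_Derive.
  destruct (hcont (fun y => m < y)) as [del hdel].
  { apply (open_gt m). unfold m; lra. }
  assert (hdel' : forall x, Rabs x < del -> m < Derive S x).
  { intros x hx. apply hdel. change (Rabs (x - 0) < del). now rewrite Rminus_0_r. }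
  clear hdel. set (d := del / 2). assert (hd : 0 < d < del).
  { unfold d. generalize (cond_pos del); lra. }
  assert (hexp : forall x y, Rabs x <= d -> Rabs y <= d -> m * Rabs (y - x) <= Rabs (S y - S x)).
  { assert (h : forall x y, Rabs x <= d -> Rabs y <= d -> x < y -> m * Rabs (y - x) <= Rabs (S y - S x)).
    { intros x y hx hy hxy. apply Rabs_le_between in hx, hy.
      destruct (MVT_gen S x y (Derive S)) as [c [hc e]].
      - intros z _; now apply smooth_R_is_derive.
      - intros z _; now apply continuity_pt_filterlim, smooth_R_continuous.
      - rewrite Rmin_left, Rmax_right in hc by lra.
        assert (h := hdel' c ltac:(apply Rabs_def1; lra)).
        rewrite e, Rabs_mult. apply Rmult_le_compat_r; [apply Rabs_pos|].
        rewrite Rabs_right; lra. }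
    intros x y hx hy. destruct (Rtotal_order x y) as [h1|[->|h1]]; auto.
    - rewrite !Rminus_diag, Rabs_R0; lra.
    - rewrite (Rabs_minus_sym y), (Rabs_minus_sym (S y)). auto. }
  (* The condition on [u] stands inside the existential so that choice yields a total [sigma]. *)
  assert (hex : forall u, exists x, Rabs u <= m * d -> Rabs x <= d /\ S x = u).
  { intros u. destruct (Rle_lt_dec (Rabs u) (m * d)) as [hu|hu].
    - assert (hmono : forall x y, -d <= x -> x < y -> y <= d -> S x < S y).
      { intros x y h1 h2 h3. apply (incr_function_le S (-d) d (Derive S)); simpl; auto.
        - intros; now apply smooth_R_is_derive.
        - intros z hz1 hz2. assert (h := hdel' z ltac:(apply Rabs_def1; lra)). lra. }
      assert (hp : m * d <= S d).
      { assert (h := hexp 0 d ltac:(rewrite Rabs_R0; lra) ltac:(rewrite Rabs_right; lra)).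
        assert (h' := hmono 0 d ltac:(lra) ltac:(lra) ltac:(lra)).
        rewrite S0, !Rminus_0_r, !Rabs_right in h; lra. }
      assert (hn : S (- d) <= - (m * d)).
      { assert (h := hexp 0 (- d) ltac:(rewrite Rabs_R0; lra) ltac:(rewrite Rabs_left; lra)).
        assert (h' := hmono (- d) 0 ltac:(lra) ltac:(lra) ltac:(lra)).
        rewrite S0, !Rminus_0_r, !Rabs_left in h; lra. }
      apply Rabs_le_between in hu.
      destruct (IVT_gen S (- d) d u) as [x [hx e]].
      + intros z; now apply continuity_pt_filterlim, smooth_R_continuous.
      + rewrite Rmin_left, Rmax_right; lra.
      + rewrite Rmin_left, Rmax_right in hx by lra.
        exists x; intros _; split; auto. apply Rabs_le; lra.
    - exists 0; lra. }
  destruct (ClassicalEpsilon.choice _ hex) as [sigma hsig]. clear hex.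
  assert (hmd : 0 < m * d) by nra.
  set (U := fun u : R => Rabs u < m * d).
  assert (oU : open U).
  { apply (open_comp Rabs (fun y => y < m * d)); [|apply open_lt].
    intros x _; apply (continuous_Rabs x). }
  assert (hsd : forall u, U u -> Rabs (sigma u) <= d /\ S (sigma u) = u /\ m < Derive S (sigma u)).
  { intros u hu. unfold U in hu. destruct (hsig u) as [h1 h2]; [lra|].
    repeat split; auto. apply hdel'. lra. }
  assert (hder : forall u, U u -> is_derive sigma u (/ Derive S (sigma u))).
  { intros u hu. destruct (hsd u hu) as [h1 [h2 h3]].
    destruct (first_order_taylor S (sigma u) sS) as [C [hC [e he]]].
    (* The Taylor remainder of [S] is at most [C * w ^ 2] with [w = sigma v - sigma u]. Expansion
       gives [m * Rabs w <= Rabs (v - u)], whence [m ^ 2], and solving for [w] divides by the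
       slope. *)
    apply (is_derive_of_quadratic_bound _ _ _ (C / m ^ 2 / Derive S (sigma u))).
    assert (he' : 0 < m * e) by (apply Rmult_lt_0_compat; auto; apply cond_pos).
    assert (hl : locally u (fun v => Rabs (v - u) < m * e)).
    { exists (mkposreal _ he'). intros v hv; exact hv. }
    generalize (filter_and _ _ (oU u hu) hl); apply filter_imp.
    intros v [hv hv']. destruct (hsd v hv) as [h4 [h5 h6]].
    assert (hlip := hexp (sigma u) (sigma v) h1 h4). rewrite h2, h5 in hlip.
    assert (hb : ball (sigma u) e (sigma v)).
    { change (Rabs (sigma v - sigma u) < e). nra. }
    specialize (he _ hb). rewrite h2, h5 in he.
    set (D := Derive S (sigma u)) in *. set (w := sigma v - sigma u) in *.
    replace (w - / D * (v - u)) with (- (v - u - D * w) / D) by (field; lra).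
    unfold Rdiv at 1. rewrite Rabs_mult, Rabs_Ropp, Rabs_inv, (Rabs_right D) by lra.
    replace (C / m ^ 2 / D * (v - u) ^ 2) with ((C * ((v - u) ^ 2 / m ^ 2)) * / D) by (field; lra).
    apply Rmult_le_compat_r; [left; apply Rinv_0_lt_compat; lra|].
    apply Rle_trans with (1 := he). apply Rmult_le_compat_l; auto.
    assert (hm2 : 0 < m ^ 2) by (apply pow_lt; lra).
    apply (Rmult_le_reg_r (m ^ 2)); auto.
    replace ((v - u) ^ 2 / m ^ 2 * m ^ 2) with ((v - u) ^ 2) by (field; lra).
    rewrite <- (pow2_abs w), <- (pow2_abs (v - u)). 
    replace (Rabs w ^ 2 * m ^ 2) with ((m * Rabs w) ^ 2) by ring.
    apply pow_incr. split; auto. apply Rmult_le_pos; [lra|apply Rabs_pos]. }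
  assert (sig0 : sigma 0 = 0).
  { assert (hU0 : U 0) by (unfold U; rewrite Rabs_R0; lra).
    destruct (hsd 0 hU0) as [h1 [h2 _]].
    assert (h := hexp 0 (sigma 0) ltac:(rewrite Rabs_R0; lra) h1).
    rewrite h2, S0, Rminus_diag, Rabs_R0, Rminus_0_r in h.
    assert (h' := Rabs_pos (sigma 0)). assert (Rabs (sigma 0) = 0) by nra.
    now apply Rabs_eq_0. }
  split; [exact S0|]. split; [now apply smooth_R_near|].
  exists sigma. split; [exact sig0|]. split; [|split].
  - exists U. split; [auto|]. split; [unfold U; change (Rabs 0 < m * d); rewrite Rabs_R0; lra|].
    induction k as [|k IH].
    + intros u hu. apply (ex_derive_continuous sigma). eexists; now apply hder.
    + apply (Ck_of_derive k U sigma (fun u => / Derive S (sigma u))); auto.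
      apply (Ck_comp k U (fun y => y <> 0) (fun u => Derive S (sigma u)) Rinv).
      * intros u hu. destruct (hsd u hu) as [_ [_ h]]. lra.
      * apply (Ck_comp k U (fun _ => True)); auto. now apply smooth_R_Derive.
      * apply Ck_inv.
  - assert (hc : continuous S 0) by now apply smooth_R_continuous.
    assert (hl : locally (0 : R) (fun x => Rabs x < d)).
    { exists (mkposreal _ (proj1 hd)). intros x hx. change (Rabs (x - 0) < d) in hx.
      now rewrite Rminus_0_r in hx. }
    assert (hl2 : locally (0 : R) (fun x => U (S x))).
    { apply hc. rewrite S0. apply oU. unfold U; rewrite Rabs_R0; lra. }
    generalize (filter_and _ _ hl hl2); apply filter_imp. intros x [h1 h2].
    destruct (hsd _ h2) as [h3 [h4 _]].
    assert (h := hexp x (sigma (S x)) ltac:(lra) h3).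
    rewrite h4, Rminus_diag, Rabs_R0 in h.
    assert (h' := Rabs_pos (sigma (S x) - x)). assert (e : Rabs (sigma (S x) - x) = 0) by nra.
    apply Rabs_eq_0 in e. change (sigma (S x) = x). lra.
  - generalize (oU 0 ltac:(unfold U; rewrite Rabs_R0; lra)); apply filter_imp.
    intros u hu. now destruct (hsd u hu) as [_ [h _]].
Qed.

(** * Normal forms of cusps *)

Local Notation cuspidal D f j i :=
  (A_equivalent (V := R_NormedModule) D f (fun t : R => (t ^ i, t ^ j))).

Local Notation RR := (prod_NormedModule R_AbsRing R_NormedModule R_NormedModule).

Lemma smooth_near_sqrt a : 0 < a -> smooth_near sqrt a.
Proof.
  intros ha. exists (fun x => 0 < x); split; [apply open_gt|split; auto].
  apply (Ck_root (fun x => 0 < x) sqrt 1 (/ 2)).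
  intros x hx. assert (h := sqrt_lt_R0 x hx). split; [lra|].
  auto_derive; auto. field; lra.
Qed.

Lemma smooth_near_Rpower_root i a : 0 < a -> smooth_near (fun v => Rpower v (/ INR (S i))) a.
Proof.
  intros ha. exists (fun x => 0 < x); split; [apply open_gt|split; auto].
  apply (Ck_root (fun x => 0 < x) _ i (/ INR (S i))).
  intros x hx. split; [apply Rgt_not_eq, exp_pos|now apply is_derive_Rpower_root].
Qed.

(* Completing the square in [z = w + e w ^ 2]. *)
Lemma quadratic_inverse e z : 0 <= 1 + 4 * e * z ->
  let w := 2 * z / (1 + sqrt (1 + 4 * e * z)) in w + e * w ^ 2 = z.
Proof.
  intros h w. unfold w. assert (hs := sqrt_pos (1 + 4 * e * z)).
  assert (hq := pow2_sqrt _ h). set (s := sqrt (1 + 4 * e * z)) in *.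
  assert (he : 4 * e * z = s ^ 2 - 1) by lra.
  replace (e * (2 * z / (1 + s)) ^ 2) with (z * (4 * e * z) / (1 + s) ^ 2) by (field; lra).
  rewrite he. field. lra.
Qed.

Lemma quadratic_inverse_l e w : 0 < 1 + e * w -> 0 <= 1 + 2 * (e * w) ->
  2 * (w + e * w ^ 2) / (1 + sqrt (1 + 4 * e * (w + e * w ^ 2))) = w.
Proof.
  intros h h'.
  replace (1 + 4 * e * (w + e * w ^ 2)) with ((1 + 2 * (e * w)) ^ 2) by ring.
  rewrite sqrt_pow2 by auto. field. lra.
Qed.

Lemma continuous_pos {V : UniformSpace} (f : V -> R) p c : c < f p -> continuous f p -> locally p (fun v => c < f v).
Proof. intros h hf. apply (hf (fun y => c < y)). now apply (open_gt c). Qed.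

Lemma continuous_neq {V : UniformSpace} (f : V -> R) p : f p <> 0 -> continuous f p -> locally p (fun v => f v <> 0).
Proof. intros h hf. apply (hf (fun y => y <> 0)). now apply open_neq. Qed.

Section NormalForm.
Variables (a1 a2 b1 b2 : R) (hdet : a1 * b2 - a2 * b1 <> 0).
Variables (g c e : R -> R).
Hypotheses (sg : smooth_near g 0) (sc : smooth_near c 0) (se : smooth_near e 0).
Hypotheses (g0 : g 0 = 0) (c0 : c 0 <> 0).

Let X (v : R * R) := a1 * fst v + a2 * snd v.
Let Z (v : R * R) := (b1 * fst v + b2 * snd v - g (X v)) / c (X v).
Let Del (v : R * R) := 1 + 4 * e (X v) * Z v.
(** The root of the quadratic equation that vanishes with [Z], with the radical in the denominator
    so that the formula remains valid where [e] is zero. *)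
Let W (v : R * R) := 2 * Z v / (1 + sqrt (Del v)).
Let Y (v : R * R) := g (fst v) + c (fst v) * (snd v + e (fst v) * snd v ^ 2).

(* [W v] is the solution [w] of [Y = g X + c X * (w + e X * w ^ 2)], that is,
   [w = s ^ j] on the curve of [A_equivalent_of_coordinates]. *)
Definition straighten (v : R * R) : R * R := (X v, W v).
Definition unstraighten (v : R * R) : R * R :=
  ((b2 * fst v - a2 * Y v) / (a1 * b2 - a2 * b1), (a1 * Y v - b1 * fst v) / (a1 * b2 - a2 * b1)).

Let O2 : RR := (0, 0).

Let s_fst (p : RR) :
  smooth_near (V := RR) (W := R_NormedModule) (fun v => fst v) p.
Proof. apply smooth_near_linear, is_linear_fst. Qed.

Let s_snd (p : RR) :
  smooth_near (V := RR) (W := R_NormedModule) (fun v => snd v) p.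
Proof. apply smooth_near_linear, is_linear_snd. Qed.

Let X0 : X O2 = 0.
Proof. unfold X, O2; simpl; ring. Qed.

Let s_X : smooth_near (V := RR) (W := R_NormedModule) X O2.
Proof.
  unfold X. apply smooth_near_plus; apply smooth_near_mult; auto using @smooth_near_const.
Qed.

Let s_gX f : smooth_near f 0 ->
  smooth_near (V := RR) (W := R_NormedModule) (fun v => f (X v)) O2.
Proof. intros hf. apply smooth_near_comp; auto. now rewrite X0. Qed.

Let Z0 : Z O2 = 0.
Proof. unfold Z. rewrite X0, g0. unfold O2; simpl. field; auto. Qed.

Let s_Z : smooth_near (V := RR) (W := R_NormedModule) Z O2.
Proof.
  unfold Z. apply smooth_near_div; auto.
  - now rewrite X0.
  - apply smooth_near_minus; auto.
    apply smooth_near_plus; apply smooth_near_mult; auto using @smooth_near_const.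
Qed.

Let Del0 : Del O2 = 1.
Proof. unfold Del. rewrite Z0. ring. Qed.

Let s_Del : smooth_near (V := RR) (W := R_NormedModule) Del O2.
Proof.
  unfold Del. apply smooth_near_plus; [apply smooth_near_const|].
  apply smooth_near_mult; auto. apply smooth_near_mult; auto using @smooth_near_const.
Qed.

Let s_W : smooth_near (V := RR) (W := R_NormedModule) W O2.
Proof.
  unfold W. apply smooth_near_div.
  - generalize (sqrt_pos (Del O2)); lra.
  - apply smooth_near_mult; auto using @smooth_near_const.
  - apply smooth_near_plus; [apply smooth_near_const|].
    apply smooth_near_comp; auto. apply smooth_near_sqrt. rewrite Del0; lra.
Qed.

Let s_Y : smooth_near (V := RR) (W := R_NormedModule) Y O2.
Proof.
  assert (h : forall f, smooth_near f 0 ->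
    smooth_near (V := RR) (W := R_NormedModule) (fun v => f (fst v)) O2).
  { intros f hf. apply smooth_near_comp; auto. }
  unfold Y. apply smooth_near_plus; auto. apply smooth_near_mult; auto.
  apply smooth_near_plus; auto. apply smooth_near_mult; auto. now apply smooth_near_pow.
Qed.

(** Both directions are explicit: [W] solves the quadratic equation, while [unstraighten]
    substitutes into it and inverts a linear map. *)
Lemma diffeo_germ_straighten :
  diffeo_germ (V := RR) straighten.
Proof.
  assert (cf : continuous (fun v : R * R => fst v) O2)
    by apply (smooth_near_continuous (V := RR) (W := R_NormedModule) _ O2 (s_fst O2)).
  split; [|split; [|exists unstraighten; split; [|split; [|split]]]].
  - unfold straighten, W. change zero with O2. rewrite X0, Z0.
    unfold O2; f_equal. unfold Rdiv; rewrite Rmult_0_r; ring.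
  - apply smooth_near_pair; auto.
  - change (unstraighten (0, 0) = (0, 0)). unfold unstraighten, Y; simpl. rewrite g0.
    apply injective_projections; simpl; field; auto.
  - apply smooth_near_pair; apply smooth_near_div; auto using @smooth_near_const;
      apply smooth_near_minus; apply smooth_near_mult; auto using @smooth_near_const.
  - assert (h1 : locally O2 (fun v => c (X v) <> 0)).
    { apply (continuous_neq (fun v => c (X v))); [now rewrite X0|].
      apply (smooth_near_continuous (V := RR) (W := R_NormedModule) _ O2 (s_gX c sc)). }
    assert (h2 : locally O2 (fun v => 0 < Del v)).
    { apply continuous_pos; [rewrite Del0; lra|].
      apply (smooth_near_continuous (V := RR) (W := R_NormedModule) _ O2 s_Del). }
    generalize (filter_and _ _ h1 h2); apply filter_imp. intros v [hc hD].
    assert (e1 : Y (straighten v) = b1 * fst v + b2 * snd v).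
    { unfold Y, straighten; simpl fst; simpl snd.
      assert (hq := quadratic_inverse (e (X v)) (Z v) (Rlt_le _ _ hD)). cbv zeta in hq.
      unfold W, Del. rewrite hq. unfold Z. field; auto. }
    unfold unstraighten. rewrite e1. simpl fst. unfold X.
    destruct v as [v1 v2]; simpl. f_equal; field; auto.
  - assert (h1 : locally (O2 : RR) (fun v : RR => c (fst v) <> 0)).
    { apply (continuous_neq (fun v : R * R => c (fst v))); auto.
      apply (continuous_comp (fun v : R * R => fst v) c); auto.
      apply (@smooth_near_continuous R_NormedModule R_NormedModule c 0 sc). }
    assert (h2 : locally (O2 : RR) (fun v : RR => - / 2 < e (fst v) * snd v)).
    { apply (continuous_pos (fun v : R * R => e (fst v) * snd v)); [unfold O2; simpl; lra|].
      apply (smooth_near_continuous (V := RR) (W := R_NormedModule)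
        (fun v : RR => e (fst v) * snd v) O2).
      apply smooth_near_mult; auto. apply smooth_near_comp; auto. }
    generalize (filter_and (F := locally (O2 : RR)) _ _ h1 h2); apply filter_imp. intros v [hc hD].
    assert (e1 : X (unstraighten v) = fst v).
    { unfold X, unstraighten; simpl. field; auto. }
    assert (e2 : Z (unstraighten v) = snd v + e (fst v) * snd v ^ 2).
    { unfold Z. rewrite e1. unfold unstraighten; simpl fst; simpl snd.
      unfold Y. field; auto. }
    unfold straighten, W, Del. rewrite e2, e1, quadratic_inverse_l by lra.
    now destruct v.
Qed.

(** The second coordinate has the shape left by division: for [i = 3] the exponents [0], [j] and
    [2 * j] represent all residues, and for [i = 2] the first two suffice, with [e = 0]. *)
Lemma A_equivalent_of_coordinates (D : R -> Prop) (f : R -> R * R) (S : R -> R) i j :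
  (0 < j)%nat -> (0 < i)%nat ->
  diffeo_germ (V := R_NormedModule) S ->
  within D (locally 0) (fun h =>
    X (f h) = S h ^ i /\
    b1 * fst (f h) + b2 * snd (f h) = g (S h ^ i) + c (S h ^ i) * (S h ^ j + e (S h ^ i) * (S h ^ j) ^ 2)) ->
  cuspidal D f j i.
Proof.
  intros hj hi hS hD. exists S, straighten. split; [auto|split; [apply diffeo_germ_straighten|]].
  destruct hS as [S0 [sS _]].
  assert (s1 : smooth_near (fun h : R_NormedModule => S h ^ i) 0) by now apply smooth_near_pow.
  assert (s2 : smooth_near (fun h : R_NormedModule => S h ^ j) 0) by now apply smooth_near_pow.
  change (S 0 = 0) in S0.
  assert (e1 : S 0 ^ i = 0) by (rewrite S0; apply pow_ne_zero; lia).
  assert (e2 : S 0 ^ j = 0) by (rewrite S0; apply pow_ne_zero; lia).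
  assert (h1 : locally (0 : R) (fun h => c (S h ^ i) <> 0)).
  { apply (continuous_neq (fun h => c (S h ^ i))); [now rewrite e1|].
    apply (@smooth_near_continuous R_NormedModule R_NormedModule (fun h => c (S h ^ i)) 0).
    apply (smooth_near_comp (fun h : R_NormedModule => S h ^ i) c); auto. now rewrite e1. }
  assert (h2 : locally (0 : R) (fun h => - / 2 < e (S h ^ i) * S h ^ j)).
  { apply (continuous_pos (fun h => e (S h ^ i) * S h ^ j)); [rewrite e2; lra|].
    apply (@smooth_near_continuous R_NormedModule R_NormedModule (fun h => e (S h ^ i) * S h ^ j) 0).
    apply smooth_near_mult; auto.
    apply (smooth_near_comp (fun h : R_NormedModule => S h ^ i) e); auto. now rewrite e1. }
  unfold within in *.
  generalize (filter_and _ _ (filter_and _ _ h1 h2) hD); apply filter_imp.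
  intros h [[h3 h4] h5] Dh. specialize (h5 Dh). destruct h5 as [h5 h6].
  unfold straighten, W, Del, Z. rewrite h6, h5.
  replace ((g (S h ^ i) + c (S h ^ i) * (S h ^ j + e (S h ^ i) * (S h ^ j) ^ 2) - g (S h ^ i)) / c (S h ^ i))
    with (S h ^ j + e (S h ^ i) * (S h ^ j) ^ 2) by (field; auto).
  rewrite quadratic_inverse_l by lra. reflexivity.
Qed.

End NormalForm.

(** * Changes of parameter *)

Lemma bigO_sub_mult D n f f' g g' : bigO D 0 f -> bigO D 0 g' ->
  bigO D n (fun t => f t - f' t) -> bigO D n (fun t => g t - g' t) ->
  bigO D n (fun t => f t * g t - f' t * g' t).
Proof.
  intros hf hg h1 h2.
  apply (bigO_eq D n (fun t => f t * (g t - g' t) + g' t * (f t - f' t))); [intros; ring|].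
  apply bigO_plus.
  - now apply (bigO_mult D 0 n).
  - now apply (bigO_mult D 0 n).
Qed.

Lemma bigO_0_pow D f k : bigO D 0 f -> bigO D 0 (fun t => f t ^ k).
Proof.
  intros hf; induction k as [|k IH]; simpl; [apply bigO_const|now apply (bigO_mult D 0 0)].
Qed.

Lemma bigO_sub_pow D n f g k : bigO D 0 f -> bigO D 0 g ->
  bigO D n (fun t => f t - g t) -> bigO D n (fun t => f t ^ k - g t ^ k).
Proof.
  intros hf hg h; induction k as [|k IH]; simpl.
  - apply (bigO_eq D n (fun t => 0 * (f t - g t))); [intros; ring|now apply bigO_scal].
  - apply bigO_sub_mult; auto. now apply bigO_0_pow.
Qed.

Lemma bigO_smooth D f : smooth_R f -> bigO D 0 f.
Proof. intros; now apply bigO_continuous, smooth_R_continuous. Qed.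

Lemma bigO_pow_smooth D n f : smooth_R f -> bigO D n (fun t => t ^ n * f t).
Proof. intros hf. rewrite (plus_n_O n) at 1. now apply bigO_pow_mult, bigO_smooth. Qed.

Lemma bigO_of_locally D n f g : locally 0 (fun t => f t = g t) -> bigO D n f -> bigO D n g.
Proof.
  intros h. apply bigO_ext. unfold within. revert h; apply filter_imp; auto.
Qed.

(** With [alpha] kept outside the power, the radicand is 1 at the origin; its root is smooth
    whatever the sign of [alpha] and the parity of the exponent. *)
Lemma root_param X alpha i : smooth_R X -> alpha <> 0 ->
  bigO full (S (S i)) (fun t => X t - alpha * t ^ S i) ->
  exists rho, smooth_R rho /\ rho 0 = 1 /\ locally 0 (fun t => X t = alpha * (t * rho t) ^ S i).
Proof.
  intros sX ha hX.
  assert (hX' : bigO full (S i) X).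
  { apply (bigO_eq full _ (fun t => (X t - alpha * t ^ S i) + alpha * t ^ S i)); [intros; ring|].
    apply bigO_plus; [now apply (bigO_le full (S (S i))); [lia|]|apply bigO_scal, bigO_pow]. }
  destruct (bigO_smooth_factor X (S i) sX hX') as [q [sq hq]].
  assert (q0 : q 0 = alpha).
  { apply Rminus_diag_uniq. apply (bigO_S_value (fun t => q t - alpha) 0).
    - apply smooth_R_minus; auto using smooth_R_const.
    - apply (bigO_pow_cancel full (S i)). rewrite Nat.add_1_r. revert hX; apply bigO_eq.
      intros t; rewrite hq; ring. }
  set (u := fun t => q t * / alpha).
  assert (su : smooth_R u) by (apply smooth_R_mult; auto using smooth_R_const).
  assert (u0 : u 0 = 1) by (unfold u; rewrite q0; field; auto).
  destruct (smooth_R_extension (fun t => Rpower (u t) (/ INR (S i)))) as [rho [srho hrho]].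
  { apply (smooth_near_comp u (fun v => Rpower v (/ INR (S i)))); [now apply smooth_R_near|].
    apply smooth_near_Rpower_root. rewrite u0; lra. }
  exists rho; split; auto. split.
  - rewrite (locally_singleton _ _ hrho), u0. unfold Rpower. rewrite ln_1, Rmult_0_r. apply exp_0.
  - assert (hu : locally 0 (fun t => 0 < u t)).
    { apply (continuous_pos u); [rewrite u0; lra|now apply smooth_R_continuous]. }
    generalize (filter_and _ _ hrho hu); apply filter_imp. intros t [e ht].
    rewrite e, Rpow_mult_distr, Rpower_root, hq by auto. unfold u. field; auto.
Qed.

Lemma smooth_R_param rho : smooth_R rho -> smooth_R (fun t => t * rho t).
Proof. intros; apply smooth_R_mult; auto using smooth_R_id. Qed.

Lemma Derive_param rho : smooth_R rho -> Derive (fun t => t * rho t) 0 = rho 0.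
Proof.
  intros h. apply is_derive_unique. assert (hd := smooth_R_is_derive rho 0 h).
  auto_derive; [eexists; exact hd|]. ring.
Qed.

Lemma diffeo_germ_inverse_smooth S : diffeo_germ (V := R_NormedModule) S ->
  exists sigma, smooth_R sigma /\ sigma 0 = 0 /\
    locally 0 (fun x => sigma (S x) = x) /\ locally 0 (fun x => S (sigma x) = x).
Proof.
  intros [S0 [sS [T [T0 [sT [h1 h2]]]]]]. change (S 0 = 0) in S0. change (T 0 = 0) in T0.
  destruct (smooth_R_extension T sT) as [sigma [ss hs]].
  exists sigma; split; auto. split; [now rewrite (locally_singleton _ _ hs)|split].
  - assert (hc : continuous S 0) by apply (@smooth_near_continuous R_NormedModule R_NormedModule S 0 sS).
    assert (h3 : locally 0 (fun x => sigma (S x) = T (S x))).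
    { apply (hc (fun y => sigma y = T y)). now rewrite S0. }
    generalize (filter_and _ _ h1 h3); apply filter_imp. now intros x [e1 ->].
  - generalize (filter_and _ _ h2 hs); apply filter_imp. now intros x [e1 ->].
Qed.

(** [g] is [Y] in the parameter [s = t * rho t]. The last clause rereads expansions in [t * rho t]
    as expansions in [s]; it holds because the inverse parameter is of order one. *)
Lemma reparametrize rho Y : smooth_R rho -> rho 0 = 1 -> smooth_R Y ->
  exists g, smooth_R g /\ locally 0 (fun t => Y t = g (t * rho t)) /\
    forall n P, bigO full n (fun t => Y t - P (t * rho t)) -> bigO full n (fun s => g s - P s).
Proof.
  intros srho rho0 sY.
  assert (sS := smooth_R_param rho srho).
  assert (hdg : diffeo_germ (V := R_NormedModule) (fun t => t * rho t)).
  { apply diffeo_germ_of_derive; auto; [ring|]. rewrite Derive_param, rho0 by auto; lra. }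
  destruct (diffeo_germ_inverse_smooth _ hdg) as [sigma [ss [s0 [h1 h2]]]].
  exists (fun s => Y (sigma s)). split; [now apply smooth_R_comp|]. split.
  - revert h1; apply filter_imp. now intros t ->.
  - intros n P hP. destruct (bigO_nonneg _ _ _ hP) as [C [hC hl]]. clear hP.
    assert (hs : bigO full 1 sigma).
    { apply (bigO_eq full 1 (fun t => t ^ 1 * hq sigma t)).
      - intros t. rewrite (hq_spec sigma t ss), s0. ring.
      - now apply bigO_pow_smooth, smooth_R_hq. }
    destruct (bigO_nonneg _ _ _ hs) as [C' [hC' hl']].
    exists (C * C' ^ n).
    assert (hl2 : locally 0 (fun s => sigma s <> 0 -> Rabs (Y (sigma s) - P (sigma s * rho (sigma s))) <= C * Rabs (sigma s) ^ n)).
    { assert (hc := smooth_R_continuous sigma 0 ss). unfold within in hl.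
      specialize (hc (fun t => full t /\ t <> 0 -> Rabs (Y t - P (t * rho t)) <= C * Rabs t ^ n)
        ltac:(rewrite s0; exact hl)). unfold filtermap in hc. revert hc. apply filter_imp.
      intros s h hne. apply h; split; auto. exact Logic.I. }
    unfold within in *.
    generalize (filter_and _ _ (filter_and _ _ h2 hl') hl2); apply filter_imp.
    intros s [[e h3] h4] [_ hs0]. rewrite e in h4.
    assert (hne : sigma s <> 0) by (intros h; rewrite h in e; apply hs0; lra).
    apply Rle_trans with (1 := h4 hne). rewrite Rmult_assoc, <- Rpow_mult_distr.
    apply Rmult_le_compat_l; auto. apply pow_incr; split; [apply Rabs_pos|].
    specialize (h3 (conj Logic.I hs0)). now rewrite pow_1 in h3.
Qed.

(** The order of [h (t ^ i)] is a multiple of [i], so exceeding [i * m] means reaching [i * S m]. *)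
Lemma bigO_of_comp_pow h i m : (0 < i)%nat -> smooth_R h ->
  bigO full (S (i * m)) (fun t => h (t ^ i)) -> bigO full (S m) h.
Proof.
  intros hi; revert h; induction m as [|m IH]; intros h sh hh.
  - rewrite Nat.mul_0_r in hh.
    assert (h0 : h 0 = 0).
    { replace (h 0) with (h (0 ^ i)) by (f_equal; apply pow_ne_zero; lia).
      apply (bigO_S_value (fun t => h (t ^ i)) 0); auto. now apply smooth_R_comp_pow. }
    apply (bigO_eq full 1 (fun t => t ^ 1 * hq h t)).
    + intros t; rewrite (hq_spec h t sh), h0; ring.
    + now apply bigO_pow_smooth, smooth_R_hq.
  - assert (h0 : h 0 = 0).
    { replace (h 0) with (h (0 ^ i)) by (f_equal; apply pow_ne_zero; lia).
      apply (bigO_S_value (fun t => h (t ^ i)) (i * S m)); auto. now apply smooth_R_comp_pow. }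
    apply (bigO_eq full _ (fun t => t ^ 1 * hq h t)).
    + intros t; rewrite (hq_spec h t sh), h0; ring.
    + apply (bigO_pow_mult full 1), IH; [now apply smooth_R_hq|].
      apply (bigO_pow_cancel full i). replace (i + S (i * m))%nat with (S (i * S m)) by lia.
      revert hh; apply bigO_eq. intros t; rewrite (hq_spec h _ sh), h0; ring.
Qed.

Lemma param_pow_bigO D rho k : smooth_R rho -> rho 0 = 1 ->
  bigO D (S k) (fun t => t ^ k - (t * rho t) ^ k).
Proof.
  intros sr r0.
  apply (bigO_eq D (S k) (fun t => -1 * (t ^ k * (rho t ^ k - 1 ^ k)))).
  { intros t. rewrite Rpow_mult_distr, pow1. ring. }
  apply bigO_scal. rewrite <- Nat.add_1_r. apply bigO_pow_mult.
  apply bigO_sub_pow; auto using bigO_const, bigO_smooth.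
  apply (bigO_eq D 1 (fun t => t ^ 1 * hq rho t)).
  - intros t; rewrite (hq_spec rho t sr), r0; ring.
  - now apply bigO_pow_smooth, smooth_R_hq.
Qed.

(** * Sufficiency: jets that determine a cusp *)

(** The curve [f] is known only on [D], possibly on one side, whereas [X] and [Y] will be smooth on
    the line. *)
Definition coords (D : R -> Prop) (f : R -> R * R) (a1 a2 b1 b2 : R) (X Y : R -> R) : Prop :=
  within D (locally 0) (fun h => a1 * fst (f h) + a2 * snd (f h) = X h /\
                                 b1 * fst (f h) + b2 * snd (f h) = Y h).

(** Only the odd part in the parameter [s] counts: the even part, including the contribution of
    [kappa * X ^ 2], is a smooth function of [s ^ 2] and goes into [g0]. The hypothesis on [Y] says
    that the odd part starts with [delta * s ^ S (2 * m)]. *)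
Lemma cusp_2_normal_form D f a1 a2 b1 b2 X Y alpha kappa delta m :
  coords D f a1 a2 b1 b2 X Y -> a1 * b2 - a2 * b1 <> 0 ->
  smooth_R X -> smooth_R Y -> alpha <> 0 -> delta <> 0 -> (0 < m)%nat ->
  bigO full 3 (fun t => X t - alpha * t ^ 2) ->
  bigO full (S (S (2 * m))) (fun t => Y t - kappa * X t ^ 2 - delta * t ^ S (2 * m)) ->
  cuspidal D f (S (2 * m)) 2.
Proof.
  intros hco hdet sX sY ha hd hm hX hY.
  destruct (root_param X alpha 1 sX ha hX) as [rho [sr [r0 hr]]].
  destruct (reparametrize rho Y sr r0 sY) as [g [sg [hg hg']]].
  assert (hgj : bigO full (S (S (2 * m))) (fun s => g s - (kappa * (alpha * s ^ 2) ^ 2 + delta * s ^ S (2 * m)))).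
  { apply (hg' _ (fun s => kappa * (alpha * s ^ 2) ^ 2 + delta * s ^ S (2 * m))).
    apply (bigO_of_locally full _ (fun t => (Y t - kappa * X t ^ 2 - delta * t ^ S (2 * m))
      + delta * (t ^ S (2 * m) - (t * rho t) ^ S (2 * m)))).
    - revert hr; apply filter_imp. intros t e. rewrite e at 1. cbn [pow]; ring.
    - apply bigO_plus; auto. apply bigO_scal, param_pow_bigO; auto. }
  destruct (divide_square g sg) as [g0 [g1 [sg0 [sg1 eg]]]].
  assert (h1 : bigO full (S m) (fun u => g1 u - delta * u ^ m)).
  { apply (bigO_of_comp_pow _ 2); [lia| |].
    - solve_smooth.
    - apply (bigO_pow_cancel full 1). 
      set (E := fun s => g s - (kappa * (alpha * s ^ 2) ^ 2 + delta * s ^ S (2 * m))) in *.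
      (* Antisymmetrizing the remainder isolates [s * (g1 (s ^ 2) - delta * s ^ (2 * m))]. *)
      assert (hE : bigO full (S (S (2 * m))) (fun s => E (-1 * s))).
      { destruct hgj as [C [del hdel]]. exists C, del. intros t ht [_ t0].
        replace (Rabs t) with (Rabs (-1 * t)) by (rewrite Rabs_mult, Rabs_left; lra).
        apply hdel.
        - change (Rabs (t - 0) < del) in ht. change (Rabs (-1 * t - 0) < del).
          replace (-1 * t - 0) with (- (t - 0)) by ring. now rewrite Rabs_Ropp.
        - split; [exact Logic.I|lra]. }
      apply (bigO_eq full _ (fun s => / 2 * (E s - E (-1 * s)))).
      + intros s. unfold E. rewrite (eg s), (eg (-1 * s)).
        replace ((-1 * s) ^ 2) with (s ^ 2) by ring.
        change ((-1 * s) ^ S (2 * m)) with ((-1 * s) * (-1 * s) ^ (2 * m)).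
        change (s ^ S (2 * m)) with (s * s ^ (2 * m)).
        rewrite (pow_mult (-1 * s)), (pow_mult s).
        replace ((-1 * s) ^ 2) with (s ^ 2) by ring. field.
      + apply bigO_scal. now apply bigO_minus. }
  destruct (bigO_smooth_factor g1 m sg1) as [c [sc ec]].
  { apply (bigO_eq full m (fun u => (g1 u - delta * u ^ m) + delta * u ^ m)); [intros; ring|].
    apply bigO_plus; [now apply (bigO_le full (S m)); [lia|]|apply bigO_scal, bigO_pow]. }
  assert (c0 : c 0 = delta).
  { apply Rminus_diag_uniq. apply (bigO_S_value (fun t => c t - delta) 0).
    - apply smooth_R_minus; auto using smooth_R_const.
    - apply (bigO_pow_cancel full m). rewrite Nat.add_1_r. revert h1; apply bigO_eq.
      intros t; rewrite ec; ring. }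
  assert (g00 : g0 0 = 0).
  { assert (sp : smooth_R (fun s => kappa * (alpha * s ^ 2) ^ 2 + delta * s ^ S (2 * m))).
    { solve_smooth. }
    assert (h := bigO_S_value _ _ (smooth_R_minus _ _ sg sp) hgj). cbv beta in h.
    rewrite eg in h. replace (0 ^ 2) with 0 in h by ring. rewrite pow_ne_zero in h by lia. lra. }
  apply (A_equivalent_of_coordinates (a1 / alpha) (a2 / alpha) b1 b2) with (g := g0) (c := c)
    (e := fun _ => 0) (S := fun t => t * rho t); try lia; auto.
  - replace (a1 / alpha * b2 - a2 / alpha * b1) with ((a1 * b2 - a2 * b1) / alpha) by (field; auto).
    apply Rmult_integral_contrapositive; split; auto. now apply Rinv_neq_0_compat.
  - now apply smooth_R_near.
  - now apply smooth_R_near.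
  - apply smooth_near_const.
  - now rewrite c0.
  - apply diffeo_germ_of_derive; [now apply smooth_R_param|ring|].
    rewrite Derive_param, r0 by auto; lra.
  - unfold coords, within in *.
    generalize (filter_and _ _ (filter_and _ _ hr hg) hco); apply filter_imp.
    intros t [[e1 e2] h] Dt. destruct (h Dt) as [e3 e4]. split.
    + replace (a1 / alpha * fst (f t) + a2 / alpha * snd (f t))
        with ((a1 * fst (f t) + a2 * snd (f t)) / alpha) by (field; auto).
      rewrite e3, e1. field; auto.
    + rewrite e4, e2, eg, ec.
      change ((t * rho t) ^ S (2 * m)) with ((t * rho t) * (t * rho t) ^ (2 * m)).
      rewrite (pow_mult (t * rho t)). ring.
Qed.

Lemma cusp_3_of_quotients D f a1 a2 b1 b2 X Y S G j delta g c q :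
  coords D f a1 a2 b1 b2 X Y -> a1 * b2 - a2 * b1 <> 0 ->
  smooth_R S -> S 0 = 0 -> 0 < Derive S 0 -> delta <> 0 -> (0 < j)%nat ->
  locally 0 (fun t => X t = S t ^ 3) -> locally 0 (fun t => Y t = G (S t)) ->
  smooth_R g -> smooth_R c -> smooth_R q -> g 0 = 0 -> c 0 = delta ->
  (forall s, G s = g (s ^ 3) + s ^ j * c (s ^ 3) + (s ^ j) ^ 2 * q (s ^ 3)) ->
  cuspidal D f j 3.
Proof.
  intros hco hdet sS S0 dS hd hj hX hY sg sc sq g0 c0 eG.
  assert (hcn : c 0 <> 0) by now rewrite c0.
  (* As [c 0 = delta] is nonzero, [c] can be factored out of the last two terms, which leaves
     [e = q / c]. *)
  apply (A_equivalent_of_coordinates a1 a2 b1 b2) with (g := g) (c := c)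
    (e := fun u => q u / c u) (S := S); try lia; auto using smooth_R_near.
  - apply smooth_near_div; auto using smooth_R_near.
  - now apply diffeo_germ_of_derive.
  - assert (hc : locally 0 (fun t => c (S t ^ 3) <> 0)).
    { apply (continuous_neq (fun t => c (S t ^ 3))).
      - rewrite S0. now replace (0 ^ 3) with 0 by ring.
      - apply smooth_R_continuous, (smooth_R_comp (fun t => S t ^ 3)); auto. now apply smooth_R_pow. }
    unfold coords, within in *.
    generalize (filter_and _ _ (filter_and _ _ hX hY) (filter_and _ _ hc hco)).
    apply filter_imp. intros t [[e1 e2] [h0 h]] Dt. destruct (h Dt) as [e3 e4]. split.
    + congruence.
    + rewrite e4, e2, eG. field; auto.
Qed.

(** In the class of 2 modulo 3 the first available power is [(s ^ 4) ^ 2 = s ^ 8], so both [s ^ 2]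
    and [s ^ 5] must be absent; in the class of 1 only [s] precedes [s ^ 4]. *)
Lemma cusp_43_of_cube D f a1 a2 b1 b2 X Y S G delta :
  coords D f a1 a2 b1 b2 X Y -> a1 * b2 - a2 * b1 <> 0 ->
  smooth_R S -> S 0 = 0 -> 0 < Derive S 0 -> delta <> 0 ->
  locally 0 (fun t => X t = S t ^ 3) -> locally 0 (fun t => Y t = G (S t)) ->
  smooth_R G -> bigO full 6 (fun s => G s - delta * s ^ 4) ->
  cuspidal D f 4 3.
Proof.
  intros hco hdet sS S0 dS hd hX hY sG hG.
  destruct (divide_cube G sG) as [g0 [g1 [g2 [s0 [s1 [s2 eG]]]]]].
  assert (e0 := fun u => taylor g0 2 u s0). assert (e1 := fun u => taylor g1 2 u s1).
  assert (e2 := fun u => taylor g2 2 u s2). cbn [psum] in e0, e1, e2.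
  assert (r0 := smooth_R_iter_hq g0 2 s0). assert (r1 := smooth_R_iter_hq g1 2 s1).
  assert (r2 := smooth_R_iter_hq g2 2 s2).
  set (q0 := Nat.iter 2 hq g0) in *. set (q1 := Nat.iter 2 hq g1) in *. set (q2 := Nat.iter 2 hq g2) in *.
  clearbody q0 q1 q2.
  (* Entries follow the powers of [s]: coefficient [k] of the quotient with residue [r] belongs to
     [s ^ (3 * k + r)]. *)
  assert (hl := horner_unique full [tcoef g0 0; tcoef g1 0; tcoef g2 0; tcoef g0 1; tcoef g1 1 - delta; tcoef g2 1] accum_full).
  assert (h : List.Forall (fun a => a = 0) [tcoef g0 0; tcoef g1 0; tcoef g2 0; tcoef g0 1; tcoef g1 1 - delta; tcoef g2 1]).
  { apply hl. cbn [length].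
    apply (bigO_eq full 6 (fun s => (G s - delta * s ^ 4)
      - s ^ 6 * (q0 (s ^ 3) + s * q1 (s ^ 3) + s ^ 2 * q2 (s ^ 3)))).
    - intros s. rewrite (eG s), (e0 (s ^ 3)), (e1 (s ^ 3)), (e2 (s ^ 3)). cbn [horner]. ring.
    - apply bigO_minus; auto. apply bigO_pow_smooth. solve_smooth. }
  inversion_clear h as [|? ? h0 h']. inversion_clear h' as [|? ? h1 h2'].
  inversion_clear h2' as [|? ? h2 h3']. inversion_clear h3' as [|? ? h3 h4'].
  inversion_clear h4' as [|? ? h4 h5']. inversion_clear h5' as [|? ? h5 _].
  apply (cusp_3_of_quotients D f a1 a2 b1 b2 X Y S G 4 delta g0 (fun u => delta + u * q1 u) q2);
    auto; try lia.
  - solve_smooth.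
  - ring.
  - intros s. rewrite (eG s), (e1 (s ^ 3)), (e2 (s ^ 3)), h1, h2, h5.
    replace (tcoef g1 1) with delta by lra. ring.
Qed.

(** In the class of 1 modulo 3 the first available power is [(s ^ 5) ^ 2 = s ^ 10], so [s], [s ^ 4]
    and [s ^ 7] must be absent. The coefficient [beta] of [s ^ 6] is free, being part of a smooth
    function of [s ^ 3]. *)
Lemma cusp_53_of_cube D f a1 a2 b1 b2 X Y S G beta delta :
  coords D f a1 a2 b1 b2 X Y -> a1 * b2 - a2 * b1 <> 0 ->
  smooth_R S -> S 0 = 0 -> 0 < Derive S 0 -> delta <> 0 ->
  locally 0 (fun t => X t = S t ^ 3) -> locally 0 (fun t => Y t = G (S t)) ->
  smooth_R G -> bigO full 8 (fun s => G s - (delta * s ^ 5 + beta * s ^ 6)) ->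
  cuspidal D f 5 3.
Proof.
  intros hco hdet sS S0 dS hd hX hY sG hG.
  destruct (divide_cube G sG) as [g0 [g1 [g2 [s0 [s1 [s2 eG]]]]]].
  assert (e0 := fun u => taylor g0 3 u s0). assert (e1 := fun u => taylor g1 3 u s1).
  assert (e2 := fun u => taylor g2 2 u s2). cbn [psum] in e0, e1, e2.
  assert (r0 := smooth_R_iter_hq g0 3 s0). assert (r1 := smooth_R_iter_hq g1 3 s1).
  assert (r2 := smooth_R_iter_hq g2 2 s2).
  set (q0 := Nat.iter 3 hq g0) in *. set (q1 := Nat.iter 3 hq g1) in *. set (q2 := Nat.iter 2 hq g2) in *.
  clearbody q0 q1 q2.
  set (l := [tcoef g0 0; tcoef g1 0; tcoef g2 0; tcoef g0 1; tcoef g1 1; tcoef g2 1 - delta;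
    tcoef g0 2 - beta; tcoef g1 2]).
  assert (h : List.Forall (fun a => a = 0) l).
  { apply (horner_unique full l accum_full). cbn [length l].
    apply (bigO_eq full 8 (fun s => (G s - (delta * s ^ 5 + beta * s ^ 6))
      - s ^ 8 * (s * q0 (s ^ 3) + s ^ 2 * q1 (s ^ 3) + q2 (s ^ 3)))).
    - intros s. rewrite (eG s), (e0 (s ^ 3)), (e1 (s ^ 3)), (e2 (s ^ 3)). unfold l; cbn [horner]. ring.
    - apply bigO_minus; auto. apply bigO_pow_smooth. solve_smooth. }
  inversion_clear h as [|? ? h0 h']. inversion_clear h' as [|? ? h1 h2'].
  inversion_clear h2' as [|? ? h2 h3']. inversion_clear h3' as [|? ? h3 h4'].
  inversion_clear h4' as [|? ? h4 h5']. inversion_clear h5' as [|? ? h5 h6'].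
  inversion_clear h6' as [|? ? h6 h7']. inversion_clear h7' as [|? ? h7 _].
  apply (cusp_3_of_quotients D f a1 a2 b1 b2 X Y S G 5 delta g0 (fun u => delta + u * q2 u) q1);
    auto; try lia.
  - solve_smooth.
  - ring.
  - intros s. rewrite (eG s), (e1 (s ^ 3)), (e2 (s ^ 3)), h1, h2, h4, h7.
    replace (tcoef g2 1) with delta by lra. ring.
Qed.

(* In a parameter with [X = s ^ 3], adding [a * Y] to [X] and reparametrizing so that
   the sum is a cube again shifts the coefficient of [Y] that has to vanish by a
   nonzero multiple of [a]. *)
Lemma cusp_3_adjust D f a1 a2 b1 b2 X Y alpha (a : R) rho g tau G :
  coords D f a1 a2 b1 b2 X Y -> a1 * b2 - a2 * b1 <> 0 -> alpha <> 0 ->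
  smooth_R rho -> rho 0 = 1 -> locally 0 (fun t => X t = alpha * (t * rho t) ^ 3) ->
  locally 0 (fun t => Y t = g (t * rho t)) ->
  smooth_R tau -> tau 0 = 1 -> locally 0 (fun s => s ^ 3 + a * g s = (s * tau s) ^ 3) ->
  locally 0 (fun s => g s = G (s * tau s)) ->
  exists a1' a2' X' S,
    coords D f a1' a2' b1 b2 X' Y /\ a1' * b2 - a2' * b1 <> 0 /\
    smooth_R S /\ S 0 = 0 /\ 0 < Derive S 0 /\
    locally 0 (fun t => X' t = S t ^ 3) /\ locally 0 (fun t => Y t = G (S t)).
Proof.
  intros hco hdet ha srho rho0 hX hY stau tau0 htau hG.
  set (s1 := fun t => t * rho t). set (s2 := fun t => t * tau t).
  assert (ss1 : smooth_R s1) by now apply smooth_R_param.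
  assert (ss2 : smooth_R s2) by now apply smooth_R_param.
  assert (s10 : s1 0 = 0) by (unfold s1; ring).
  assert (hpull : forall P : R -> Prop, locally 0 P -> locally 0 (fun t => P (s1 t))).
  { intros P hP. assert (hc := smooth_R_continuous s1 0 ss1). apply (hc P). now rewrite s10. }
  exists (a1 / alpha + a * b1), (a2 / alpha + a * b2), (fun t => X t / alpha + a * Y t), (fun t => s2 (s1 t)).
  split; [|split; [|split; [|split; [|split; [|split]]]]].
  - unfold coords, within in *. revert hco; apply filter_imp. intros t h Dt.
    destruct (h Dt) as [e1 e2]; split; auto. rewrite <- e1, <- e2. field; auto.
  - replace ((a1 / alpha + a * b1) * b2 - (a2 / alpha + a * b2) * b1)
      with ((a1 * b2 - a2 * b1) / alpha) by (field; auto).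
    apply Rmult_integral_contrapositive; split; auto. now apply Rinv_neq_0_compat.
  - now apply (smooth_R_comp s1 s2).
  - rewrite s10; unfold s2; ring.
  - replace (Derive (fun t => s2 (s1 t)) 0) with (Derive s1 0 * Derive s2 0).
    + unfold s1, s2; rewrite !Derive_param, rho0, tau0 by auto; lra.
    + symmetry. apply is_derive_unique. rewrite <- s10 at 3.
      apply (is_derive_comp s2 s1); now apply smooth_R_is_derive.
  - generalize (filter_and _ _ (filter_and _ _ hX hY) (hpull _ htau)); apply filter_imp.
    intros t [[e1 e2] e3]. change (t * rho t) with (s1 t) in *. unfold s2. rewrite <- e3, e1, e2. field; auto.
  - generalize (filter_and _ _ hY (hpull _ hG)); apply filter_imp.
    intros t [e2 e3]. change (t * rho t) with (s1 t) in *. unfold s2. now rewrite e2, e3.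
Qed.

Lemma reparametrized_order rho Y g delta j : smooth_R rho -> rho 0 = 1 ->
  (forall n P, bigO full n (fun t => Y t - P (t * rho t)) -> bigO full n (fun s => g s - P s)) ->
  bigO full (S j) (fun t => Y t - delta * t ^ j) -> bigO full (S j) (fun s => g s - delta * s ^ j).
Proof.
  intros sr r0 hg hY. apply (hg (S j) (fun s => delta * s ^ j)).
  apply (bigO_eq full _ (fun t => (Y t - delta * t ^ j) + delta * (t ^ j - (t * rho t) ^ j))); [intros; ring|].
  apply bigO_plus; auto. now apply bigO_scal, param_pow_bigO.
Qed.

Lemma cusp_43_normal_form D f a1 a2 b1 b2 X Y alpha delta :
  coords D f a1 a2 b1 b2 X Y -> a1 * b2 - a2 * b1 <> 0 ->
  smooth_R X -> smooth_R Y -> alpha <> 0 -> delta <> 0 ->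
  bigO full 4 (fun t => X t - alpha * t ^ 3) -> bigO full 5 (fun t => Y t - delta * t ^ 4) ->
  cuspidal D f 4 3.
Proof.
  intros hco hdet sX sY ha hd hX hY.
  destruct (root_param X alpha 2 sX ha hX) as [rho [sr [r0 hr]]].
  destruct (reparametrize rho Y sr r0 sY) as [g [sg [hg hg']]].
  assert (hg5 := reparametrized_order rho Y g delta 4 sr r0 hg' hY).
  destruct (bigO_smooth_factor (fun s => g s - delta * s ^ 4) 5) as [r [srr er]]; auto.
  { solve_smooth. }
  (* With [tau = 1 + m * s + ...], comparing [s ^ 4] in [s ^ 3 + a * g s = (s * tau s) ^ 3] gives
     [3 * m = a * delta]. The new leading term [delta * (s * tau s) ^ 4] contributes [4 * delta * m]
     to [s ^ 5], and equating this with [d] determines [a]. *)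
  set (d := r 0). set (a := 3 * d / (4 * delta ^ 2)).
  assert (eg : forall s, g s = delta * s ^ 4 + d * s ^ 5 + s ^ 6 * hq r s).
  { intros s. specialize (er s). rewrite (hq_spec r s srr) in er. fold d in er. 
    replace (g s) with (delta * s ^ 4 + s ^ 5 * (d + s * hq r s)) by lra. ring. }
  assert (sq := smooth_R_hq r srr). set (q := hq r) in *. clearbody q d.
  destruct (root_param (fun s => s ^ 3 + a * g s) 1 2) as [tau [st [t0 ht]]]; try lra.
  { solve_smooth. }
  { apply (bigO_eq full 4 (fun s => s ^ 4 * (a * (delta + d * s + s ^ 2 * q s)))).
    - intros s; rewrite eg; ring.
    - apply bigO_pow_smooth. solve_smooth. }
  assert (ht' : locally 0 (fun s => s ^ 3 + a * g s = (s * tau s) ^ 3)).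
  { revert ht; apply filter_imp; intros s e; rewrite e; ring. }
  set (m := tcoef tau 1).
  assert (h2 : forall k, bigO full 2 (fun s => tau s ^ k - (1 + m * s) ^ k)).
  { intros k. assert (hm : smooth_R (fun s => 1 + m * s)).
    { solve_smooth. }
    apply bigO_sub_pow; auto using bigO_smooth.
    apply (bigO_eq full 2 (fun s => tau s - psum (tcoef tau) 2 s)); [|now apply taylor_bigO].
    intros s. simpl. unfold m. change (tcoef tau 0) with (tau 0). rewrite t0. ring. }
  assert (hm : 3 * m = a * delta).
  { apply Rminus_diag_uniq.
    assert (h : List.Forall (fun x => x = 0) [0; 3 * m - a * delta]).
    { apply (horner_unique full _ accum_full). cbn [length].
      apply (bigO_pow_cancel full 3).
      apply (bigO_of_locally full _ (fun s => s ^ 3 * (-1 * (tau s ^ 3 - (1 + m * s) ^ 3))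
         + (s ^ 5 * (-3 * m ^ 2 - m ^ 3 * s + a * (d + s * q s))))).
      - revert ht'; apply filter_imp. intros s e. rewrite eg in e. cbn [horner].
        rewrite Rpow_mult_distr in e. nra.
      - apply bigO_plus; [apply bigO_pow_mult, bigO_scal, h2|].
        apply bigO_pow_smooth. solve_smooth. }
    inversion_clear h as [|? ? _ h']. now inversion_clear h'. }
  destruct (reparametrize tau g st t0 sg) as [G [sG [hG hG']]].
  destruct (cusp_3_adjust D f a1 a2 b1 b2 X Y alpha a rho g tau G)
    as [a1' [a2' [X' [S [h3 [h4 [h5 [h6 [h7 [h8 h9]]]]]]]]]]; auto.
  apply (cusp_43_of_cube D f a1' a2' b1 b2 X' Y S G delta); auto.
  apply (hG' 6%nat (fun s => delta * s ^ 4)).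
  assert (hd4 : d = 4 * delta * m).
  { replace m with (a * delta / 3) by lra. unfold a. field; auto. }
  apply (bigO_eq full 6 (fun s => s ^ 4 * (- delta * (tau s ^ 4 - (1 + m * s) ^ 4))
     + s ^ 6 * (q s - delta * (6 * m ^ 2 + 4 * m ^ 3 * s + m ^ 4 * s ^ 2)))).
  - intros s. rewrite eg, Rpow_mult_distr, hd4. ring.
  - apply bigO_plus; [apply (bigO_pow_mult full 4 2), bigO_scal, h2|].
    apply bigO_pow_smooth. solve_smooth.
Qed.

Lemma cusp_53_normal_form D f a1 a2 b1 b2 X Y alpha delta :
  coords D f a1 a2 b1 b2 X Y -> a1 * b2 - a2 * b1 <> 0 ->
  smooth_R X -> smooth_R Y -> alpha <> 0 -> delta <> 0 ->
  bigO full 4 (fun t => X t - alpha * t ^ 3) -> bigO full 6 (fun t => Y t - delta * t ^ 5) ->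
  cuspidal D f 5 3.
Proof.
  intros hco hdet sX sY ha hd hX hY.
  destruct (root_param X alpha 2 sX ha hX) as [rho [sr [r0 hr]]].
  destruct (reparametrize rho Y sr r0 sY) as [g [sg [hg hg']]].
  assert (hg5 := reparametrized_order rho Y g delta 5 sr r0 hg' hY).
  destruct (bigO_smooth_factor (fun s => g s - delta * s ^ 5) 6) as [r [srr er]]; auto.
  { solve_smooth. }
  (* Here [g] starts at [s ^ 5], so [tau = 1 + n * s ^ 2 + ...] with [3 * n = a * delta]. The term
     [delta * (s * tau s) ^ 5] contributes [5 * delta * n] to [s ^ 7], and equating this with [d]
     determines [a]; the term in [b] changes only from [s ^ 8] on. *)
  set (b := tcoef r 0). set (d := tcoef r 1). set (a := 3 * d / (5 * delta ^ 2)).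
  assert (sq := smooth_R_iter_hq r 2 srr).
  assert (eg : forall s, g s = delta * s ^ 5 + b * s ^ 6 + d * s ^ 7 + s ^ 8 * Nat.iter 2 hq r s).
  { intros s. specialize (er s). rewrite (taylor r 2 s srr) in er. cbn [psum] in er. fold d b in er.
    replace (g s) with (delta * s ^ 5 + s ^ 6 * (0 + b * s ^ 0 + d * s ^ 1 + s ^ 2 * Nat.iter 2 hq r s)) by lra.
    ring. }
  set (q := Nat.iter 2 hq r) in *. clearbody q b d.
  destruct (root_param (fun s => s ^ 3 + a * g s) 1 2) as [tau [st [t0 ht]]]; try lra.
  { solve_smooth. }
  { apply (bigO_eq full 4 (fun s => s ^ 4 * (a * (delta * s + b * s ^ 2 + d * s ^ 3 + s ^ 4 * q s)))).
    - intros s; rewrite eg; ring.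
    - apply bigO_pow_smooth. solve_smooth. }
  assert (ht' : locally 0 (fun s => s ^ 3 + a * g s = (s * tau s) ^ 3)).
  { revert ht; apply filter_imp; intros s e; rewrite e; ring. }
  set (m := tcoef tau 1). set (n := tcoef tau 2).
  assert (h3 : forall k, bigO full 3 (fun s => tau s ^ k - (1 + m * s + n * s ^ 2) ^ k)).
  { intros k. assert (hm : smooth_R (fun s => 1 + m * s + n * s ^ 2)).
    { solve_smooth. }
    apply bigO_sub_pow; auto using bigO_smooth.
    apply (bigO_eq full 3 (fun s => tau s - psum (tcoef tau) 3 s)); [|now apply taylor_bigO].
    intros s. simpl. unfold m, n. change (tcoef tau 0) with (tau 0). rewrite t0. ring. }
  assert (hmn : m = 0 /\ 3 * n = a * delta).
  { assert (h : List.Forall (fun x => x = 0) [0; 3 * m; 3 * n + 3 * m ^ 2 - a * delta]).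
    { apply (horner_unique full _ accum_full). cbn [length].
      apply (bigO_pow_cancel full 3).
      apply (bigO_of_locally full _ (fun s => s ^ 3 * (-1 * (tau s ^ 3 - (1 + m * s + n * s ^ 2) ^ 3))
         + (s ^ 6 * (- m ^ 3 - 6 * m * n - 3 * n ^ 2 * s - 3 * m ^ 2 * n * s - 3 * m * n ^ 2 * s ^ 2
             - n ^ 3 * s ^ 3 + a * (b + d * s + s ^ 2 * q s))))).
      - revert ht'; apply filter_imp. intros s e. rewrite eg in e. cbn [horner].
        rewrite Rpow_mult_distr in e.
        replace (s ^ 3 * (-1 * (tau s ^ 3 - (1 + m * s + n * s ^ 2) ^ 3)))
          with (s ^ 3 * (1 + m * s + n * s ^ 2) ^ 3 - s ^ 3 * tau s ^ 3) by ring.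
        rewrite <- e. ring.
      - apply bigO_plus; [apply bigO_pow_mult, bigO_scal, h3|].
        apply bigO_pow_smooth. solve_smooth. }
    inversion_clear h as [|? ? _ h']. inversion_clear h' as [|? ? h1 h'']. inversion_clear h'' as [|? ? h2 _].
    assert (m = 0) by lra. subst. split; auto. rewrite H in h2. lra. }
  destruct hmn as [hm0 hn].
  assert (h3' : forall k, bigO full 3 (fun s => tau s ^ k - (1 + n * s ^ 2) ^ k)).
  { intros k. generalize (h3 k). apply bigO_eq. intros s. rewrite hm0. f_equal. f_equal. f_equal. ring. }
  destruct (reparametrize tau g st t0 sg) as [G [sG [hG hG']]].
  destruct (cusp_3_adjust D f a1 a2 b1 b2 X Y alpha a rho g tau G)
    as [a1' [a2' [X' [S [k3 [k4 [k5 [k6 [k7 [k8 k9]]]]]]]]]]; auto.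
  apply (cusp_53_of_cube D f a1' a2' b1 b2 X' Y S G b delta); auto.
  apply (hG' 8%nat (fun s => delta * s ^ 5 + b * s ^ 6)).
  assert (hd4 : d = 5 * delta * n).
  { replace n with (a * delta / 3) by lra. unfold a. field; auto. }
  apply (bigO_eq full 8 (fun s => s ^ 5 * (- delta * (tau s ^ 5 - (1 + n * s ^ 2) ^ 5))
     + (s ^ 6 * (- b * s ^ 0 * (tau s ^ 6 - (1 + n * s ^ 2) ^ 6))
     + s ^ 8 * (q s - delta * (10 * n ^ 2 * s + 10 * n ^ 3 * s ^ 3 + 5 * n ^ 4 * s ^ 5 + n ^ 5 * s ^ 7)
         - b * (6 * n + 15 * n ^ 2 * s ^ 2 + 20 * n ^ 3 * s ^ 4 + 15 * n ^ 4 * s ^ 6 + 6 * n ^ 5 * s ^ 8 + n ^ 6 * s ^ 10))))).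
  - intros s. rewrite eg, !Rpow_mult_distr, hd4. ring.
  - apply bigO_plus; [apply (bigO_pow_mult full 5 3), bigO_scal, h3'|]. apply bigO_plus.
    + apply (bigO_le full 9); [lia|]. apply (bigO_pow_mult full 6 3).
      apply (bigO_eq full 3 (fun s => - b * (tau s ^ 6 - (1 + n * s ^ 2) ^ 6))); [intros; simpl; ring|].
      apply bigO_scal, h3'.
    + apply bigO_pow_smooth. solve_smooth.
Qed.

(** * Second-order expansion of a diffeomorphism of the plane *)

Lemma Ck_precomp_linear {V1 V2 W : NormedModule R_AbsRing} k (U : V2 -> Prop) (f : V2 -> W) (L : V1 -> V2) :
  is_linear L -> Ck k U f -> Ck k (fun x => U (L x)) (fun x => f (L x)).
Proof.
  intros hL; revert f; induction k as [|k IH]; intros f.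
  - intros hf x hx. apply (continuous_comp L f); [now apply linear_cont|now apply hf].
  - intros [df [h1 h2]]. exists (fun x v => df (L x) (L v)); split.
    + intros x hx. apply (filterdiff_comp' L f); [now apply filterdiff_linear|now apply h1].
    + intros v. apply (IH (fun x => df x (L v))), h2.
Qed.

Lemma smooth_near_precomp_linear {V1 V2 W : NormedModule R_AbsRing} (f : V2 -> W) (L : V1 -> V2) p :
  is_linear L -> smooth_near f (L p) -> smooth_near (fun x => f (L x)) p.
Proof.
  intros hL [U [oU [Up hU]]]. exists (fun x => U (L x)). split; [|split; auto].
  - intros x hx. apply (linear_cont L x hL). now apply oU.
  - intros k. now apply Ck_precomp_linear.
Qed.

Lemma filterdiff_lipschitz {V W : NormedModule R_AbsRing} (f : V -> W) x l :
  filterdiff f (locally x) l ->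
  exists C, 0 < C /\ locally x (fun y => norm (minus (f y) (f x)) <= C * norm (minus y x)).
Proof.
  intros [hl hf]. destruct (linear_norm l hl) as [M [hM hM']].
  exists (M + 1); split; [lra|].
  assert (hx : is_filter_lim (locally x) x) by (intros P hP; exact hP).
  generalize (hf x hx (mkposreal _ Rlt_0_1)); apply filter_imp. simpl.
  intros y hy. 
  replace (minus (f y) (f x)) with (plus (minus (minus (f y) (f x)) (l (minus y x))) (l (minus y x))).
  - eapply Rle_trans; [apply norm_triangle|]. specialize (hM' (minus y x)). lra.
  - set (a := minus (f y) (f x)). set (b := l (minus y x)). unfold minus.
    now rewrite <- plus_assoc, plus_opp_l, plus_zero_r.
Qed.

Lemma norm_RR_le (v : RR) : norm v <= Rabs (fst v) + Rabs (snd v).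
Proof.
  change (sqrt (Rabs (fst v) ^ 2 + Rabs (snd v) ^ 2) <= Rabs (fst v) + Rabs (snd v)).
  assert (h1 := Rabs_pos (fst v)). assert (h2 := Rabs_pos (snd v)).
  rewrite <- (sqrt_pow2 (Rabs (fst v) + Rabs (snd v))) by lra.
  apply sqrt_le_1_alt. nra.
Qed.

Lemma norm_RR_fst (v : RR) : Rabs (fst v) <= norm v.
Proof. apply (norm_le_prod_norm_1 (U := R_NormedModule) (V := R_NormedModule) v). Qed.

Lemma norm_RR_snd (v : RR) : Rabs (snd v) <= norm v.
Proof.
  change (Rabs (snd v) <= sqrt (Rabs (fst v) ^ 2 + Rabs (snd v) ^ 2)).
  assert (h2 := Rabs_pos (snd v)).
  rewrite <- (sqrt_pow2 (Rabs (snd v))) at 1 by auto.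
  apply sqrt_le_1_alt. generalize (pow2_ge_0 (Rabs (fst v))); lra.
Qed.

(** Quadratic terms containing [Y] stay in the error: at [(s ^ i, s ^ j)] with [i < j] they have
    order at least [i + j], while [X ^ 2] has order [2 * i] and must be recorded. *)
Definition order_2_bound (P : RR -> R) (a b v C del : R) : Prop :=
  forall X Y, Rabs X < del -> Rabs Y < del ->
    Rabs (P (X, Y) - (a * X + b * Y + v * X ^ 2)) <= C * (Rabs X ^ 3 + Rabs Y * (Rabs X + Rabs Y)).

(** On the axis [Y = 0] this is the Taylor formula in one variable. The increment in [Y] is treated
    by the mean value theorem, the partial derivative [r] being Lipschitz at the origin. *)
Lemma second_order_taylor (P : RR -> R) :
  smooth_near (V := RR) (W := R_NormedModule) P (0, 0) -> P (0, 0) = 0 ->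
  exists a b v C del, 0 <= C /\ 0 < del /\ order_2_bound P a b v C del.
Proof.
  intros sP P0.
  assert (sQ : smooth_near (fun X : R => P (X, 0)) 0).
  { apply (@smooth_near_precomp_linear R_NormedModule RR R_NormedModule P (fun X => (X, 0))); auto.
    apply (@is_linear_prod R_AbsRing R_NormedModule R_NormedModule R_NormedModule (fun X => X) (fun _ => zero));
      [apply is_linear_id|apply is_linear_zero]. }
  destruct (smooth_R_extension _ sQ) as [Q [ssQ hQ]].
  destruct sP as [U [oU [U0 hU]]].
  destruct (hU 2%nat) as [dP [hP hdP]]. destruct (hdP (0, 1)) as [dR [hR _]].
  set (r := fun x : RR => dP x (0, 1)).
  destruct (filterdiff_lipschitz r (0, 0) _ (hR (0, 0) U0)) as [C1 [hC1 hl1]].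
  destruct (bigO_nonneg _ _ _ (taylor_bigO full Q 3 ssQ)) as [C2 [hC2 hl2]].
  unfold within in hl2.
  destruct (filter_and _ _ hl1 (oU _ U0)) as [d1 hd1].
  destruct (filter_and _ _ hQ hl2) as [d2 hd2].
  assert (hd1' : forall X Y : R, Rabs X < d1 -> Rabs Y < d1 ->
    norm (minus (r (X, Y)) (r (0, 0))) <= C1 * norm (minus ((X, Y) : RR) (0, 0)) /\ U (X, Y)).
  { intros X Y hX hY. apply hd1. split.
    - change (Rabs (X - 0) < d1). now rewrite Rminus_0_r.
    - change (Rabs (Y - 0) < d1). now rewrite Rminus_0_r. }
  clear hd1.
  exists (tcoef Q 1), (r (0, 0)), (tcoef Q 2), (C1 + C2), (Rmin d1 d2).
  split; [lra|]. split; [apply Rmin_pos; apply cond_pos|].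
  intros X Y hX hY.
  assert (hX1 := Rlt_le_trans _ _ _ hX (Rmin_l _ _)). assert (hX2 := Rlt_le_trans _ _ _ hX (Rmin_r _ _)).
  assert (hY1 := Rlt_le_trans _ _ _ hY (Rmin_l _ _)).
  assert (hder : forall y, Rabs y < d1 -> is_derive (fun y => P (X, y)) y (r (X, y))).
  { intros y hy. destruct (hd1' X y hX1 hy) as [_ hUy].
    assert (h := hP (X, y) hUy). unfold is_derive.
    apply filterdiff_ext_lin with (fun z : R => dP (X, y) (zero, z)).
    - apply (@filterdiff_comp' R_AbsRing R_NormedModule RR R_NormedModule (fun y => (X, y)) P y (fun z => (zero, z))); auto.
      apply (@filterdiff_pair R_NormedModule R_NormedModule R_NormedModule (locally y) _ (fun _ => X) (fun _ => zero) (fun y => y) (fun y => y)).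
      + apply filterdiff_const; typeclasses eauto.
      + apply filterdiff_id.
    - intros z. unfold r.
      rewrite <- (linear_scal (dP (X, y)) (proj1 h) z (0, 1)). f_equal.
      change ((0, z) = (z * 0, z * 1)). now rewrite Rmult_0_r, Rmult_1_r. }
  assert (hb : Rabs (P (X, Y) - P (X, 0) - r (0, 0) * Y) <= C1 * (Rabs Y * (Rabs X + Rabs Y))).
  { destruct (MVT_gen (fun y => P (X, y)) 0 Y (fun y => r (X, y))) as [c [hc e]].
    - intros y hy. apply hder. revert hy. unfold Rmin, Rmax. destruct (Rle_dec 0 Y); intros;
        apply Rabs_def1; apply Rabs_def2 in hY1; lra.
    - intros y hy. apply continuity_pt_filterlim. apply (ex_derive_continuous (fun y => P (X, y))).
      eexists; apply hder. revert hy. unfold Rmin, Rmax. destruct (Rle_dec 0 Y); intros;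
        apply Rabs_def1; apply Rabs_def2 in hY1; lra.
    - cbv beta in e. rewrite e.
      assert (hcY : Rabs c <= Rabs Y).
      { revert hc. unfold Rmin, Rmax. destruct (Rle_dec 0 Y); intros hc.
        - rewrite !Rabs_right; lra.
        - rewrite !Rabs_left1; lra. }
      destruct (hd1' X c hX1 ltac:(lra)) as [hn _].
      change (Rabs (r (X, c) - r (0, 0)) <= C1 * norm (minus ((X, c) : RR) (0, 0))) in hn.
      assert (hn2 := norm_RR_le (minus ((X, c) : RR) (0, 0))).
      change (norm (minus ((X, c) : RR) (0, 0)) <= Rabs (X - 0) + Rabs (c - 0)) in hn2.
      rewrite !Rminus_0_r in hn2.
      replace (r (X, c) * (Y - 0) - r (0, 0) * Y) with (Y * (r (X, c) - r (0, 0))) by ring.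
      rewrite Rabs_mult.
      replace (C1 * (Rabs Y * (Rabs X + Rabs Y))) with (Rabs Y * (C1 * (Rabs X + Rabs Y))) by ring.
      apply Rmult_le_compat_l; [apply Rabs_pos|]. apply Rle_trans with (1 := hn).
      apply Rmult_le_compat_l; lra. }
  assert (hq : Rabs (P (X, 0) - (tcoef Q 1 * X + tcoef Q 2 * X ^ 2)) <= C2 * Rabs X ^ 3).
  { destruct (hd2 X) as [e h].
    { change (Rabs (X - 0) < d2). now rewrite Rminus_0_r. }
    destruct (Req_dec X 0) as [->|hX0].
    - rewrite P0. replace (0 - (tcoef Q 1 * 0 + tcoef Q 2 * 0 ^ 2)) with 0 by ring.
      rewrite Rabs_R0. simpl. lra.
    - specialize (h (conj Logic.I hX0)).
      replace (P (X, 0) - (tcoef Q 1 * X + tcoef Q 2 * X ^ 2)) with (Q X - psum (tcoef Q) 3 X); auto.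
      rewrite e. simpl. replace (tcoef Q 0) with 0; [ring|].
      unfold tcoef; simpl. now rewrite (locally_singleton _ _ hQ), P0. }
  replace (P (X, Y) - (tcoef Q 1 * X + r (0, 0) * Y + tcoef Q 2 * X ^ 2))
    with ((P (X, Y) - P (X, 0) - r (0, 0) * Y) + (P (X, 0) - (tcoef Q 1 * X + tcoef Q 2 * X ^ 2))) by ring.
  eapply Rle_trans; [apply Rabs_triang|].
  assert (0 <= Rabs X ^ 3) by (apply pow_le, Rabs_pos).
  assert (0 <= Rabs Y * (Rabs X + Rabs Y)).
  { apply Rmult_le_pos; [apply Rabs_pos|]. generalize (Rabs_pos X) (Rabs_pos Y); lra. }
  nra.
Qed.

Lemma nonzero_kernel a1 b1 a2 b2 : a1 * b2 - a2 * b1 = 0 ->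
  exists x y, (x <> 0 \/ y <> 0) /\ a1 * x + b1 * y = 0 /\ a2 * x + b2 * y = 0.
Proof.
  intros h. destruct (Req_dec a1 0) as [h1|h1]; [destruct (Req_dec b1 0) as [h2|h2]|].
  - destruct (Req_dec a2 0) as [h3|h3]; [exists 1, 0|exists b2, (- a2)].
    + split; [lra|]. rewrite h1, h2, h3. split; ring.
    + split; [lra|]. rewrite h1, h2. split; ring.
  - exists b1, (- a1). split; [lra|]. split; [ring|lra].
  - exists b1, (- a1). split; [lra|]. split; [ring|lra].
Qed.

(** It is the inverse that has to be expanded: the identity [f2 (S t) = T (f1 t)] gives the curve as
    [T' (s ^ i, s ^ j)]. *)
Lemma diffeo_germ_jets (T : RR -> RR) : diffeo_germ T ->
  exists T' a1 b1 v1 a2 b2 v2 C del,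
    locally (zero : RR) (fun x => T' (T x) = x) /\ a1 * b2 - a2 * b1 <> 0 /\ 0 <= C /\ 0 < del /\
    order_2_bound (fun v => fst (T' v)) a1 b1 v1 C del /\
    order_2_bound (fun v => snd (T' v)) a2 b2 v2 C del.
Proof.
  intros [T0 [sT [T' [T'0 [sT' [h1 h2]]]]]].
  destruct (second_order_taylor (fun v => fst (T' v))) as [a1 [b1 [v1 [C1 [d1 [hC1 [hd1 hb1]]]]]]].
  { apply (smooth_near_linear_comp (W1 := RR) T' (fun v : RR => fst v)); auto. apply is_linear_fst. }
  { change (fst (T' zero) = 0). now rewrite T'0. }
  destruct (second_order_taylor (fun v => snd (T' v))) as [a2 [b2 [v2 [C2 [d2 [hC2 [hd2 hb2]]]]]]].
  { apply (smooth_near_linear_comp (W1 := RR) T' (fun v : RR => snd v)); auto. apply is_linear_snd. }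
  { change (snd (T' zero) = 0). now rewrite T'0. }
  assert (hbound : forall X Y, 0 <= Rabs X ^ 3 + Rabs Y * (Rabs X + Rabs Y)).
  { intros X Y. assert (0 <= Rabs X ^ 3) by (apply pow_le, Rabs_pos).
    assert (0 <= Rabs Y * (Rabs X + Rabs Y)).
    { apply Rmult_le_pos; [apply Rabs_pos|]. generalize (Rabs_pos X) (Rabs_pos Y); lra. }
    lra. }
  exists T', a1, b1, v1, a2, b2, v2, (C1 + C2), (Rmin d1 d2).
  split; [auto|]. split; [|split; [lra|split; [now apply Rmin_pos|split]]].
  2: { intros X Y hX hY. eapply Rle_trans; [apply hb1|].
       - eapply Rlt_le_trans; [apply hX|apply Rmin_l].
       - eapply Rlt_le_trans; [apply hY|apply Rmin_l].
       - apply Rmult_le_compat_r; auto; lra. }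
  2: { intros X Y hX hY. eapply Rle_trans; [apply hb2|].
       - eapply Rlt_le_trans; [apply hX|apply Rmin_r].
       - eapply Rlt_le_trans; [apply hY|apply Rmin_r].
       - apply Rmult_le_compat_r; auto; lra. }
  intros hdet. destruct (nonzero_kernel a1 b1 a2 b2 hdet) as [x [y [hxy [k1 k2]]]].
  assert (hdT : exists l, filterdiff T (locally (zero : RR)) l).
  { destruct sT as [U [oU [U0 hU]]]. destruct (hU 1%nat) as [dT [hT _]].
    exists (dT zero). now apply hT. }
  destruct hdT as [l hl]. destruct (filterdiff_lipschitz T (zero : RR) l hl) as [K [hK hl1]].
  assert (hcT' : continuous T' (zero : RR)) by now apply (@smooth_near_continuous RR RR).
  assert (hl2 : locally (zero : RR) (fun w => norm (minus (T (T' w)) (T zero)) <= K * norm (minus (T' w) zero))).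
  { unfold continuous in hcT'. rewrite T'0 in hcT'. apply (hcT' _ hl1). }
  destruct (filter_and (F := locally (zero : RR)) _ _ h2 hl2) as [d3 hd3]. clear hl1 hl2.
  assert (hd3' : forall X Y, Rabs X < d3 -> Rabs Y < d3 ->
    norm ((X, Y) : RR) <= K * (Rabs (fst (T' (X, Y))) + Rabs (snd (T' (X, Y))))).
  { intros X Y hX hY. destruct (hd3 (X, Y)) as [e h].
    { split; [change (Rabs (X - 0) < d3)|change (Rabs (Y - 0) < d3)]; now rewrite Rminus_0_r. }
    rewrite e, T0, (minus_zero_r (T' (X, Y))) in h.
    apply Rle_trans with (norm (minus ((X, Y) : RR) zero)).
    { right; f_equal; symmetry; apply (minus_zero_r ((X, Y) : RR)). }
    apply Rle_trans with (1 := h). apply Rmult_le_compat_l; [lra|]. apply norm_RR_le. }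
  clear hd3.
  (* [T'] is of second order along its kernel direction, although it has the
     Lipschitz left inverse [T]. *)
  assert (hscal : forall (u : R) (d : posreal), locally 0 (fun e => Rabs (e * u) < d)).
  { intros u d. assert (sm : smooth_R (fun e => e * u)) by solve_smooth.
    assert (h := proj1 (filterlim_locally (fun e => e * u) (0 * u)) (smooth_R_continuous _ 0 sm) d).
    revert h. apply filter_imp. intros e h. change (Rabs (e * u - 0 * u) < d) in h.
    now rewrite Rmult_0_l, Rminus_0_r in h. }
  assert (hsmall : forall P a b v C D, order_2_bound P a b v C D -> 0 < D -> 0 <= C -> a * x + b * y = 0 ->
     bigO full 2 (fun e => P (e * x, e * y))).
  { intros P a b v C D hP hD hC hk.
    apply (bigO_eq full 2 (fun e => (P (e * x, e * y) - v * x ^ 2 * e ^ 2) + v * x ^ 2 * e ^ 2)); [intros; ring|].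
    apply bigO_plus; [|apply bigO_scal, bigO_pow].
    exists (C * (Rabs x ^ 3 + Rabs y * (Rabs x + Rabs y))). unfold within.
    generalize (filter_and _ _ (hscal 1 (mkposreal _ Rlt_0_1))
      (filter_and _ _ (hscal x (mkposreal _ hD)) (hscal y (mkposreal _ hD)))); apply filter_imp.
    intros e [h0 [h3 h4]] _. simpl in h0, h3, h4. rewrite Rmult_1_r in h0.
    assert (h := hP _ _ h3 h4).
    replace (a * (e * x) + b * (e * y) + v * (e * x) ^ 2) with (v * x ^ 2 * e ^ 2) in h
      by (replace (a * (e * x) + b * (e * y)) with (e * (a * x + b * y)) by ring; rewrite hk; ring).
    apply Rle_trans with (1 := h). rewrite Rmult_assoc. apply Rmult_le_compat_l; auto.
    rewrite !Rabs_mult.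
    assert (h5 : 0 <= Rabs x ^ 3) by (apply pow_le, Rabs_pos).
    assert (h6 : Rabs e * Rabs x ^ 3 <= Rabs x ^ 3) by nra.
    assert (h7 : 0 <= Rabs e ^ 2) by apply pow2_ge_0. nra. }
  assert (q1 := hsmall _ _ _ _ _ _ hb1 hd1 hC1 k1). assert (q2 := hsmall _ _ _ _ _ _ hb2 hd2 hC2 k2).
  assert (hz : forall u, (forall e, Rabs (e * u) <= norm ((e * x, e * y) : RR)) -> u = 0).
  { intros u hu. apply (bigO_constant_term full u (fun _ => 0)); auto using accum_full, bigO_const.
    apply (bigO_pow_cancel full 1).
    apply (bigO_dominated full 2 K _ (fun e => Rabs (fst (T' (e * x, e * y))) + Rabs (snd (T' (e * x, e * y))))).
    - apply bigO_plus; [apply (bigO_dominated full 2 1 _ _ q1)|apply (bigO_dominated full 2 1 _ _ q2)];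
        apply filter_forall; intros e; rewrite Rabs_Rabsolu; lra.
    - unfold within. generalize (filter_and _ _ (hscal x d3) (hscal y d3)); apply filter_imp.
      intros e [h3 h4] _. replace (e ^ 1 * (u + e * 0)) with (e * u) by ring.
      apply Rle_trans with (1 := hu e). rewrite (Rabs_right (Rabs _ + Rabs _)).
      + now apply hd3'.
      + apply Rle_ge, Rplus_le_le_0_compat; apply Rabs_pos. }
  destruct hxy as [h|h]; apply h, hz; intros e;
    [exact (norm_RR_fst (e * x, e * y))|exact (norm_RR_snd (e * x, e * y))].
Qed.

(** * Necessity: expansions of cuspidal germs *)

Definition cusp_expansion (D : R -> Prop) (i j : nat) (rho X : R -> R) (a b v : R) (N : nat) : Prop :=
  bigO D N (fun t => X t - (a * (t * rho t) ^ i + b * (t * rho t) ^ j + v * (t * rho t) ^ (2 * i))).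

Lemma bigO_param_pow D rho k : smooth_R rho -> bigO D k (fun t => (t * rho t) ^ k).
Proof.
  intros sr. apply (bigO_eq D k (fun t => t ^ k * rho t ^ k)).
  - intros t; now rewrite Rpow_mult_distr.
  - now apply bigO_pow_smooth, smooth_R_pow.
Qed.

(** The bounds on [N] are the orders of the error terms [X ^ 3] and [X * Y] of [order_2_bound]. The
    determinant is the product of those of the coordinates and of the linear part of [T']. *)
Lemma A_equivalent_expansion D f p1 p2 q1 q2 X Y i j :
  coords D f p1 p2 q1 q2 X Y -> p1 * q2 - p2 * q1 <> 0 ->
  smooth_R X -> smooth_R Y -> X 0 = 0 -> Y 0 = 0 -> (0 < i < j)%nat ->
  cuspidal D f j i ->
  exists rho a b v a' b' v', smooth_R rho /\ rho 0 <> 0 /\ a * b' - a' * b <> 0 /\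
    forall N, (N <= 3 * i)%nat -> (N <= i + j)%nat ->
      cusp_expansion D i j rho X a b v N /\ cusp_expansion D i j rho Y a' b' v' N.
Proof.
  intros hco hdet sX sY X0 Y0 hij [S [T [hS [hT heq]]]].
  destruct (diffeo_germ_jets T hT) as [T' [a1 [b1 [v1 [a2 [b2 [v2 [C [del [hT' [hab [hC [hdel [hb1 hb2]]]]]]]]]]]]]].
  destruct (diffeo_germ_inverse_smooth S hS) as [sg [ssg [sg0 [hinv _]]]].
  destruct hS as [S0 [sS _]]. change (S 0 = 0) in S0.
  destruct (smooth_R_extension S sS) as [s [ss hs]].
  assert (s0 : s 0 = 0) by now rewrite (locally_singleton _ _ hs).
  set (rho := hq s).
  assert (hrho : forall t, s t = t * rho t).
  { intros t. rewrite (hq_spec s t ss), s0. unfold rho; ring. }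
  assert (srho : smooth_R rho) by now apply smooth_R_hq.
  assert (hrho0 : rho 0 <> 0).
  { unfold rho. rewrite hq_0 by auto. intros h.
    assert (hd : is_derive (fun t => sg (s t)) 0 (Derive s 0 * Derive sg (s 0))).
    { apply (is_derive_comp sg s); now apply smooth_R_is_derive. }
    rewrite h, Rmult_0_l in hd.
    assert (hd1 : is_derive (fun t : R => t) 0 0).
    { revert hd. apply is_derive_ext_loc. generalize (filter_and _ _ hs hinv); apply filter_imp.
      now intros t [-> e]. }
    apply is_derive_unique in hd1. rewrite Derive_id in hd1. lra. }
  (* [T'] inverts [T] only near the origin, so [f] has to tend to zero along [D]. This is derived
     from [X] and [Y] by inverting the coordinate matrix. *)
  assert (hf0 : forall P : RR -> Prop, locally (zero : RR) P -> within D (locally 0) (fun h => P (f h))).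
  { intros P [e he].
    set (dd := p1 * q2 - p2 * q1) in *.
    assert (c1 : locally 0 (fun h => Rabs ((q2 * X h - p2 * Y h) / dd) < e)).
    { assert (sm : smooth_R (fun h => (q2 * X h - p2 * Y h) * / dd)) by solve_smooth.
      apply (smooth_R_continuous _ 0 sm (fun y => Rabs y < e)). rewrite X0, Y0.
      exists e. intros y hy. replace ((q2 * 0 - p2 * 0) * / dd) with 0 in hy by ring.
      change (Rabs (y - 0) < e) in hy. now rewrite Rminus_0_r in hy. }
    assert (c2 : locally 0 (fun h => Rabs ((p1 * Y h - q1 * X h) / dd) < e)).
    { assert (sm : smooth_R (fun h => (p1 * Y h - q1 * X h) * / dd)) by solve_smooth.
      apply (smooth_R_continuous _ 0 sm (fun y => Rabs y < e)). rewrite X0, Y0.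
      exists e. intros y hy. replace ((p1 * 0 - q1 * 0) * / dd) with 0 in hy by ring.
      change (Rabs (y - 0) < e) in hy. now rewrite Rminus_0_r in hy. }
    unfold coords, within in *. generalize (filter_and _ _ (filter_and _ _ c1 c2) hco); apply filter_imp.
    intros h [[h1 h2] h3] Dh. destruct (h3 Dh) as [e1 e2]. apply he.
    rewrite <- e1, <- e2 in h1, h2.
    replace ((q2 * (p1 * fst (f h) + p2 * snd (f h)) - p2 * (q1 * fst (f h) + q2 * snd (f h))) / dd)
      with (fst (f h)) in h1 by (unfold dd; field; auto).
    replace ((p1 * (q1 * fst (f h) + q2 * snd (f h)) - q1 * (p1 * fst (f h) + p2 * snd (f h))) / dd)
      with (snd (f h)) in h2 by (unfold dd; field; auto).
    split; [change (Rabs (fst (f h) - 0) < e)|change (Rabs (snd (f h) - 0) < e)]; now rewrite Rminus_0_r. }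
  assert (hsd : forall k, (0 < k)%nat -> locally 0 (fun t => Rabs (s t ^ k) < del)).
  { intros k hk. assert (sm : smooth_R (fun t => s t ^ k)) by solve_smooth.
    apply (smooth_R_continuous _ 0 sm (fun y => Rabs y < del)). rewrite s0, pow_ne_zero by lia.
    exists (mkposreal _ hdel). intros y hy. change (Rabs (y - 0) < del) in hy. now rewrite Rminus_0_r in hy. }
  assert (hcomp : within D (locally 0) (fun h => f h = T' (s h ^ i, s h ^ j) /\
    Rabs (s h ^ i) < del /\ Rabs (s h ^ j) < del)).
  { assert (h1 := hf0 _ hT'). unfold within in *.
    assert (h2 := hsd i ltac:(lia)). assert (h3 := hsd j ltac:(lia)).
    generalize (filter_and _ _ (filter_and _ _ h1 heq) (filter_and _ _ hs (filter_and _ _ h2 h3))); apply filter_imp.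
    intros h [[k1 k2] [k3 k4]] Dh. split; auto. rewrite k3, (k2 Dh). symmetry; auto. }
  assert (hexp : forall N, (N <= 3 * i)%nat -> (N <= i + j)%nat ->
    bigO D N (fun t => fst (f t) - (a1 * s t ^ i + b1 * s t ^ j + v1 * s t ^ (2 * i))) /\
    bigO D N (fun t => snd (f t) - (a2 * s t ^ i + b2 * s t ^ j + v2 * s t ^ (2 * i)))).
  { intros N h1 h2.
    assert (hO : bigO D N (fun t => Rabs (s t ^ (3 * i)) + Rabs (s t ^ (j + i)) + Rabs (s t ^ (j + j)))).
    { assert (h : forall k, (N <= k)%nat -> bigO D N (fun t => Rabs (s t ^ k))).
      { intros k hk. apply (bigO_dominated D N 1 _ (fun t => (t * rho t) ^ k)).
        - apply (bigO_le D k); auto. now apply bigO_param_pow.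
        - apply filter_forall. intros t. rewrite hrho, Rabs_Rabsolu. lra. }
      apply bigO_plus; [apply bigO_plus|]; apply h; lia. }
    assert (hdom : forall t, Rabs (s t ^ i) ^ 3 + Rabs (s t ^ j) * (Rabs (s t ^ i) + Rabs (s t ^ j))
      = Rabs (Rabs (s t ^ (3 * i)) + Rabs (s t ^ (j + i)) + Rabs (s t ^ (j + j)))).
    { intros t. rewrite (Rabs_right (Rabs _ + _ + _)).
      - rewrite !pow_add, !Rabs_mult, (Nat.mul_comm 3), pow_mult, <- !RPow_abs. ring.
      - generalize (Rabs_pos (s t ^ (3 * i))) (Rabs_pos (s t ^ (j + i))) (Rabs_pos (s t ^ (j + j))); lra. }
    split; refine (bigO_dominated D N C _ _ hO _); unfold within in *; revert hcomp; apply filter_imp;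
      intros t h Dt; destruct (h Dt) as [e [k1 k2]]; rewrite <- hdom, e.
    - rewrite (Nat.mul_comm 2), pow_mult. exact (hb1 _ _ k1 k2).
    - rewrite (Nat.mul_comm 2), pow_mult. exact (hb2 _ _ k1 k2). }
  exists rho, (p1 * a1 + p2 * a2), (p1 * b1 + p2 * b2), (p1 * v1 + p2 * v2),
    (q1 * a1 + q2 * a2), (q1 * b1 + q2 * b2), (q1 * v1 + q2 * v2).
  split; auto. split; auto. split.
  - replace ((p1 * a1 + p2 * a2) * (q1 * b1 + q2 * b2) - (q1 * a1 + q2 * a2) * (p1 * b1 + p2 * b2))
      with ((p1 * q2 - p2 * q1) * (a1 * b2 - a2 * b1)) by ring.
    apply Rmult_integral_contrapositive; auto.
  - intros N h1 h2. destruct (hexp N h1 h2) as [h3 h4]. split.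
    + apply (bigO_ext D N (fun t => p1 * (fst (f t) - (a1 * s t ^ i + b1 * s t ^ j + v1 * s t ^ (2 * i)))
        + p2 * (snd (f t) - (a2 * s t ^ i + b2 * s t ^ j + v2 * s t ^ (2 * i))))).
      * unfold coords, within in *. revert hco; apply filter_imp. intros t h [Dt _].
        destruct (h Dt) as [<- _]. rewrite hrho. ring.
      * apply bigO_plus; now apply bigO_scal.
    + apply (bigO_ext D N (fun t => q1 * (fst (f t) - (a1 * s t ^ i + b1 * s t ^ j + v1 * s t ^ (2 * i)))
        + q2 * (snd (f t) - (a2 * s t ^ i + b2 * s t ^ j + v2 * s t ^ (2 * i))))).
      * unfold coords, within in *. revert hco; apply filter_imp. intros t h [Dt _].
        destruct (h Dt) as [_ <-]. rewrite hrho. ring.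
      * apply bigO_plus; now apply bigO_scal.
Qed.

Lemma leading_coefficient D rho c d k : accum D -> smooth_R rho ->
  bigO D (S k) (fun t => c * (t * rho t) ^ k - d * t ^ k) -> c * rho 0 ^ k = d.
Proof.
  intros hD sr h. apply Rminus_diag_uniq.
  assert (sm : smooth_R (fun t => c * rho t ^ k - d)) by solve_smooth.
  apply (bigO_constant_term D _ (hq (fun t => c * rho t ^ k - d)) hD).
  - now apply bigO_smooth, smooth_R_hq.
  - apply (bigO_pow_cancel D k). rewrite Nat.add_1_r. revert h; apply bigO_eq.
    intros t. rewrite <- (hq_spec _ t sm), Rpow_mult_distr. ring.
Qed.

Section Leading.
Context (D : R -> Prop) (hD : accum D) (i j : nat) (rho X : R -> R) (sr : smooth_R rho) (r0 : rho 0 <> 0).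

Let O_pow k m c : (m <= k)%nat -> bigO D m (fun t => c * (t * rho t) ^ k).
Proof. intros h. apply bigO_scal. apply (bigO_le D k); auto. now apply bigO_param_pow. Qed.

Lemma cusp_expansion_lead_i a b v l : (i < j)%nat -> (0 < i)%nat ->
  cusp_expansion D i j rho X a b v (S i) -> bigO D (S i) (fun t => X t - l * t ^ i) -> a * rho 0 ^ i = l.
Proof.
  intros hij hi h hl. apply (leading_coefficient D); auto.
  apply (bigO_eq D (S i) (fun t => (X t - l * t ^ i)
    - (X t - (a * (t * rho t) ^ i + b * (t * rho t) ^ j + v * (t * rho t) ^ (2 * i)))
    - (b * (t * rho t) ^ j + v * (t * rho t) ^ (2 * i)))); [intros; ring|].
  apply bigO_minus; [now apply bigO_minus|]. apply bigO_plus; apply O_pow; lia.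
Qed.

Lemma cusp_expansion_lead_j b v l : (j < 2 * i)%nat ->
  cusp_expansion D i j rho X 0 b v (S j) -> bigO D (S j) (fun t => X t - l * t ^ j) -> b * rho 0 ^ j = l.
Proof.
  intros hij h hl. apply (leading_coefficient D); auto.
  apply (bigO_eq D (S j) (fun t => (X t - l * t ^ j)
    - (X t - (0 * (t * rho t) ^ i + b * (t * rho t) ^ j + v * (t * rho t) ^ (2 * i)))
    - (v * (t * rho t) ^ (2 * i)))); [intros; ring|].
  apply bigO_minus; [now apply bigO_minus|]. apply O_pow; lia.
Qed.

End Leading.

Lemma bigO_weaken_lead D n X l : bigO D (S n) (fun t => X t - l * t ^ n) -> bigO D n X.
Proof.
  intros h. apply (bigO_eq D n (fun t => (X t - l * t ^ n) + l * t ^ n)); [intros; ring|].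
  apply bigO_plus; [now apply (bigO_le D (S n)); [lia|]|apply bigO_scal, bigO_pow].
Qed.

Lemma pow_neq_0_zero a r k : r <> 0 -> a * r ^ k = 0 -> a = 0.
Proof.
  intros hr h. apply Rmult_integral in h. destruct h as [h|h]; auto.
  now apply (pow_nonzero r k) in hr.
Qed.

Section OnlyIf.
Context (D : R -> Prop) (f : R -> R * R) (p1 p2 q1 q2 : R) (X Y : R -> R).
Context (hco : coords D f p1 p2 q1 q2 X Y) (hdet : p1 * q2 - p2 * q1 <> 0) (hD : accum D).
Context (sX : smooth_R X) (sY : smooth_R Y).

(** As [Y] has no term of order [i], its coefficient [a'] vanishes; independence then forces [a] and
    [b'] to be nonzero, and [l] is [a] times a power of [rho 0]. *)
Lemma cuspidal_leading i j l : (0 < i < j)%nat ->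
  bigO full (S i) (fun t => X t - l * t ^ i) -> bigO full (S i) Y -> cuspidal D f j i ->
  l <> 0 /\ exists rho a b v b' v', smooth_R rho /\ rho 0 <> 0 /\ b' <> 0 /\
    forall N, (N <= 3 * i)%nat -> (N <= i + j)%nat ->
      cusp_expansion D i j rho X a b v N /\ cusp_expansion D i j rho Y 0 b' v' N.
Proof.
  intros hij hX hY hA.
  assert (X0 : X 0 = 0).
  { apply (bigO_S_value X 0); auto. apply (bigO_le full i); [lia|]. now apply (bigO_weaken_lead full i X l). }
  assert (Y0 : Y 0 = 0) by now apply (bigO_S_value Y i).
  destruct (A_equivalent_expansion D f p1 p2 q1 q2 X Y i j hco hdet sX sY X0 Y0 hij hA)
    as [rho [a [b [v [a' [b' [v' [sr [r0 [hab hN]]]]]]]]]].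
  destruct (hN (S i)) as [h1 h2]; try lia.
  assert (ea := cusp_expansion_lead_i D hD i j rho X sr a b v l ltac:(lia) ltac:(lia) h1 (bigO_full D _ _ hX)).
  assert (ea' : a' * rho 0 ^ i = 0).
  { apply (cusp_expansion_lead_i D hD i j rho Y sr a' b' v' 0); auto; try lia.
    generalize (bigO_full D _ _ hY). apply bigO_eq; intros; ring. }
  apply pow_neq_0_zero in ea'; auto. subst a'.
  split; [|exists rho, a, b, v, b', v'; repeat split; auto; try apply hN; auto].
  - intros h; subst; apply hab. apply pow_neq_0_zero in h; auto. subst; ring.
  - intros h; subst; apply hab; ring.
Qed.

(** The image of [(s ^ i, s ^ j)] under a diffeomorphism fixing the origin has order at least [i] in
    every coordinate. *)
Lemma cuspidal_order i j N l : (0 < i < j)%nat -> (N < i)%nat -> X 0 = 0 -> Y 0 = 0 ->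
  bigO full (S N) (fun t => X t - l * t ^ N) -> cuspidal D f j i -> l = 0.
Proof.
  intros hij hN X0 Y0 hX hA.
  destruct (A_equivalent_expansion D f p1 p2 q1 q2 X Y i j hco hdet sX sY X0 Y0 hij hA)
    as [rho [a [b [v [a' [b' [v' [sr [r0 [hab hE]]]]]]]]]].
  destruct (hE i) as [h1 _]; try lia.
  (* [leading_coefficient] with constant parameter factor 1 and coefficient 0 compares [l * t ^ N]
     with zero. *)
  symmetry. rewrite <- (Rmult_0_l (1 ^ N)).
  apply (leading_coefficient D (fun _ => 1) 0 l N); auto using smooth_R_const.
  apply (bigO_eq D (S N) (fun t => (X t - l * t ^ N)
    - (X t - (a * (t * rho t) ^ i + b * (t * rho t) ^ j + v * (t * rho t) ^ (2 * i)))
    - (a * (t * rho t) ^ i + b * (t * rho t) ^ j + v * (t * rho t) ^ (2 * i)))); [intros; ring|].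
  assert (hs : forall k c, (i <= k)%nat -> bigO D (S N) (fun t => c * (t * rho t) ^ k)).
  { intros k c hk. apply bigO_scal. apply (bigO_le D k); [lia|]. now apply bigO_param_pow. }
  apply bigO_minus; [apply bigO_minus; [now apply bigO_full|now apply (bigO_le D i); [lia|]]|].
  apply bigO_plus; [apply bigO_plus|]; apply hs; lia.
Qed.

Lemma cuspidal_necessary i j l m : (0 < i < j)%nat -> (j < 2 * i)%nat ->
  bigO full (S i) (fun t => X t - l * t ^ i) -> bigO full (S j) (fun t => Y t - m * t ^ j) ->
  cuspidal D f j i -> l <> 0 /\ m <> 0.
Proof.
  intros hij hji hX hY hA.
  destruct (cuspidal_leading i j l hij hX) as [hl [rho [a [b [v [b' [v' [sr [r0 [hb hN]]]]]]]]]]; auto.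
  { apply (bigO_le full j); [lia|]. now apply (bigO_weaken_lead full j Y m). }
  split; auto. destruct (hN (S j)) as [_ h]; try lia.
  assert (e := cusp_expansion_lead_j D hD i j rho Y sr b' v' m hji h (bigO_full D _ _ hY)).
  intros h0; subst. now apply pow_neq_0_zero in h0.
Qed.

(** Once [a' = 0], the expansion of [Y] starts at order [j] or [2 * i], so nothing can appear at an
    order [N] below both. *)
Lemma cuspidal_gap i j N l m : (0 < i < N)%nat -> (N < j)%nat -> (N < 2 * i)%nat ->
  bigO full (S i) (fun t => X t - l * t ^ i) -> bigO full (S N) (fun t => Y t - m * t ^ N) ->
  cuspidal D f j i -> m = 0.
Proof.
  intros hiN hNj hNi hX hY hA.
  destruct (cuspidal_leading i j l ltac:(lia) hX) as [hl [rho [a [b [v [b' [v' [sr [r0 [hb hN]]]]]]]]]]; auto.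
  { apply (bigO_le full N); [lia|]. now apply (bigO_weaken_lead full N Y m). }
  destruct (hN (S N)) as [_ h]; try lia.
  symmetry. rewrite <- (Rmult_0_l (1 ^ N)).
  apply (leading_coefficient D (fun _ => 1) 0 m N); auto using smooth_R_const.
  apply (bigO_eq D (S N) (fun t => (Y t - m * t ^ N)
    - (Y t - (0 * (t * rho t) ^ i + b' * (t * rho t) ^ j + v' * (t * rho t) ^ (2 * i)))
    - (b' * (t * rho t) ^ j + v' * (t * rho t) ^ (2 * i)))); [intros; ring|].
  assert (hs : forall k c, (N < k)%nat -> bigO D (S N) (fun t => c * (t * rho t) ^ k)).
  { intros k c hk. apply bigO_scal. apply (bigO_le D k); [lia|]. now apply bigO_param_pow. }
  apply bigO_minus; [apply bigO_minus; auto; now apply bigO_full|].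
  apply bigO_plus; apply hs; lia.
Qed.

(** The square of the first coordinate contributes [v' * s ^ 4], ahead of [s ^ 5]. Since
    [Y - kappa * X ^ 2] has no term of order 4, necessarily [v' = kappa * a ^ 2], and [b' * s ^ 5]
    is then the leading term. *)
Lemma cusp_52_necessary l kappa delta :
  bigO full 3 (fun t => X t - l * t ^ 2) -> bigO full 3 Y -> cuspidal D f 5 2 ->
  bigO full 6 (fun t => Y t - kappa * X t ^ 2 - delta * t ^ 5) -> delta <> 0.
Proof.
  intros hX hY hA hd.
  destruct (cuspidal_leading 2 5 l ltac:(lia) hX hY hA) as [hl [rho [a [b [v [b' [v' [sr [r0 [hb hN]]]]]]]]]].
  destruct (hN 4%nat) as [h4 _]; try lia. destruct (hN 6%nat) as [_ h6]; try lia.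
  unfold cusp_expansion in h4, h6. change (2 * 2)%nat with 4%nat in h4, h6.
  assert (hs : forall k n c, (n <= k)%nat -> bigO D n (fun t => c * (t * rho t) ^ k)).
  { intros k n c hk. apply bigO_scal. apply (bigO_le D k); auto. now apply bigO_param_pow. }
  assert (hZ : bigO D 6 (fun t => (v' - kappa * a ^ 2) * (t * rho t) ^ 4 + b' * (t * rho t) ^ 5 - delta * t ^ 5)).
  { apply (bigO_eq D 6 (fun t => (Y t - kappa * X t ^ 2 - delta * t ^ 5)
      - (Y t - (0 * (t * rho t) ^ 2 + b' * (t * rho t) ^ 5 + v' * (t * rho t) ^ 4))
      + kappa * ((X t - a * (t * rho t) ^ 2) * (X t + a * (t * rho t) ^ 2)))); [intros; ring|].
    apply bigO_plus; [apply bigO_minus; auto; now apply bigO_full|].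
    (* [X - a * s ^ 2] has no term before [s ^ 4], so replacing [X ^ 2] by [a ^ 2 * s ^ 4] costs
       only order 6. *)
    apply bigO_scal. apply (bigO_mult D 4 2).
    - apply (bigO_eq D 4 (fun t => (X t - (a * (t * rho t) ^ 2 + b * (t * rho t) ^ 5 + v * (t * rho t) ^ 4))
        + (b * (t * rho t) ^ 5 + v * (t * rho t) ^ 4))); [intros; ring|].
      apply bigO_plus; auto. apply bigO_plus; apply hs; lia.
    - apply bigO_plus; [|apply hs; lia]. apply bigO_full. now apply (bigO_weaken_lead full 2 X l). }
  (* This coefficient has to be zero before order 5 can be compared, because [(t * rho t) ^ 4] also
     contributes to [t ^ 5]. *)
  assert (h0 : (v' - kappa * a ^ 2) * rho 0 ^ 4 = 0).
  { apply (leading_coefficient D); auto.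
    apply (bigO_eq D 5 (fun t => ((v' - kappa * a ^ 2) * (t * rho t) ^ 4 + b' * (t * rho t) ^ 5 - delta * t ^ 5)
      - (b' * (t * rho t) ^ 5 - delta * t ^ 5))); [intros; ring|].
    apply bigO_minus; [apply (bigO_le D 6); auto; lia|].
    apply bigO_minus; [apply hs; lia|apply bigO_scal, bigO_pow]. }
  apply pow_neq_0_zero in h0; auto.
  assert (h7 : b' * rho 0 ^ 5 = delta).
  { apply (leading_coefficient D); auto. revert hZ; apply bigO_eq. intros t; rewrite h0; ring. }
  intros h; subst. now apply pow_neq_0_zero in h.
Qed.

End OnlyIf.

(** * Jets of the curve *)

(** Integration of an estimate by the mean value theorem; the jets below follow from the
    differential equations in this way. *)
Lemma bigO_primitive n f P f' P' : smooth_R f -> smooth_R P -> f 0 = P 0 ->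
  locally 0 (fun t => is_derive f t (f' t)) -> (forall t, is_derive P t (P' t)) ->
  bigO full n (fun t => f' t - P' t) -> bigO full (S n) (fun t => f t - P t).
Proof.
  intros sf sP e0 hf hP hO.
  set (g := fun t => f t - P t). assert (sg : smooth_R g) by now apply smooth_R_minus.
  assert (hg : bigO full n (Derive g)).
  { revert hO. apply bigO_of_locally. revert hf; apply filter_imp. intros t ht.
    symmetry. apply is_derive_unique. now apply (is_derive_minus f P). }
  destruct (bigO_smooth_factor (Derive g) n (smooth_R_Derive g sg) hg) as [q [sq eq]].
  destruct (bigO_smooth full q sq) as [C hC].
  assert (hq : locally 0 (fun t => Rabs (q t) <= Rabs (q 0) + 1)).
  { assert (h := smooth_R_continuous q 0 sq (fun y => Rabs (y - q 0) < 1)).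
    assert (hl : locally (q 0) (fun y => Rabs (y - q 0) < 1)).
    { exists (mkposreal _ Rlt_0_1). intros y hy; exact hy. }
    specialize (h hl). unfold filtermap in h. revert h; apply filter_imp. intros t ht.
    replace (q t) with (q 0 + (q t - q 0)) by ring.
    eapply Rle_trans; [apply Rabs_triang|]. lra. }
  destruct hq as [del hdel]. exists (Rabs (q 0) + 1). exists del. intros t ht _.
  change (Rabs (t - 0) < del) in ht. rewrite Rminus_0_r in ht. change (Rabs (g t) <= (Rabs (q 0) + 1) * Rabs t ^ S n).
  assert (g0 : g 0 = 0) by (unfold g; rewrite e0; ring).
  destruct (MVT_gen g 0 t (Derive g)) as [c [hc e]].
  - intros y _. now apply smooth_R_is_derive.
  - intros y _. now apply continuity_pt_filterlim, smooth_R_continuous.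
  - assert (hct : Rabs c <= Rabs t).
    { revert hc. unfold Rmin, Rmax. destruct (Rle_dec 0 t); intros hc.
      - rewrite !Rabs_right; lra.
      - rewrite !Rabs_left1; lra. }
    rewrite g0, !Rminus_0_r in e. rewrite e, eq, !Rabs_mult, <- RPow_abs.
    replace ((Rabs (q 0) + 1) * Rabs t ^ S n) with (Rabs t ^ n * (Rabs (q 0) + 1) * Rabs t) by (simpl; ring).
    apply Rmult_le_compat_r; [apply Rabs_pos|]. apply Rmult_le_compat; try apply Rabs_pos.
    + apply pow_le, Rabs_pos.
    + apply pow_incr; split; auto; apply Rabs_pos.
    + apply hdel. change (Rabs (c - 0) < del). rewrite Rminus_0_r. lra.
Qed.

Lemma bigO_value f : smooth_R f -> bigO full 1 (fun t => f t - f 0).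
Proof.
  intros sf. apply (bigO_eq full 1 (fun t => t ^ 1 * hq f t)).
  - intros t. rewrite (hq_spec f t sf). ring.
  - now apply bigO_pow_smooth, smooth_R_hq.
Qed.

Lemma bigO_of_value f : smooth_R f -> f 0 = 0 -> bigO full 1 f.
Proof.
  intros sf f0. generalize (bigO_value f sf). apply bigO_eq. intros t; rewrite f0; ring.
Qed.

(* [c] stands for the value at the origin of [sin psi / y]. It enters the jet of [w],
   but cancels from the determinant [l1 * w3 - l2 * w2] that decides the 5/2-cusp. *)
Section Jets.
Context (L z w om X Y : R -> R) (l1 l2 n1 n2 n3 c : R).
Context (sL : smooth_R L) (sz : smooth_R z) (sw : smooth_R w) (som : smooth_R om)
  (sX : smooth_R X) (sY : smooth_R Y).
Context (hL : bigO full 3 (fun t => L t - (l1 * t + l2 / 2 * t ^ 2))).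
Context (z0 : z 0 = 1) (w0 : w 0 = 0) (X0 : X 0 = 0) (Y0 : Y 0 = 0).
Context (dX : locally 0 (fun t => is_derive X t (L t * z t)))
  (dY : locally 0 (fun t => is_derive Y t (L t * w t))).
Context (dw : locally 0 (fun t => is_derive w t (om t * z t)))
  (dz : locally 0 (fun t => is_derive z t (- om t * w t))).
Context (hom : om 0 = n1).
Context (hom3 : n1 = 0 -> bigO full 3 (fun t => om t - ((n2 - l1 * c) * t + (n3 - l2 * c) / 2 * t ^ 2))).

Lemma bigO_poly n (q : R -> R) (P : R -> R) : smooth_R q -> (forall t, P t = t ^ n * q t) -> bigO full n P.
Proof.
  intros sq e. apply (bigO_eq full n (fun t => t ^ n * q t)); auto. now apply bigO_pow_smooth.
Qed.

Lemma jet_L1 : bigO full 1 L.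
Proof.
  apply (bigO_eq full 1 (fun t => (L t - (l1 * t + l2 / 2 * t ^ 2)) + (l1 * t + l2 / 2 * t ^ 2))); [intros; ring|].
  apply bigO_plus; [apply (bigO_le full 3); auto|].
  apply (bigO_poly 1 (fun t => l1 + l2 / 2 * t)); [solve_smooth|intros; ring].
Qed.

Lemma jet_z : bigO full 2 (fun t => z t - 1).
Proof.
  apply (bigO_primitive 1 z (fun _ => 1) (fun t => - om t * w t) (fun _ => 0)); auto using smooth_R_const.
  - intros; auto_derive; auto.
  - apply (bigO_eq full 1 (fun t => (-1 * om t) * w t)); [intros; ring|].
    apply (bigO_mult full 0 1); [apply bigO_scal, bigO_smooth; auto|now apply bigO_of_value].
Qed.

Lemma jet_w : bigO full 2 (fun t => w t - n1 * t).
Proof.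
  apply (bigO_primitive 1 w (fun t => n1 * t) (fun t => om t * z t) (fun _ => n1)); auto.
  - solve_smooth.
  - rewrite w0; ring.
  - intros; auto_derive; auto; ring.
  - apply (bigO_eq full 1 (fun t => om t * z t - n1 * 1)); [intros; ring|].
    apply bigO_sub_mult; auto using bigO_smooth, bigO_const.
    + rewrite <- hom. now apply bigO_value.
    + apply (bigO_le full 2); auto using jet_z.
Qed.

Lemma jet_X : bigO full 4 (fun t => X t - (l1 / 2 * t ^ 2 + l2 / 6 * t ^ 3)).
Proof.
  apply (bigO_primitive 3 X (fun t => l1 / 2 * t ^ 2 + l2 / 6 * t ^ 3) (fun t => L t * z t)
    (fun t => l1 * t + l2 / 2 * t ^ 2)); auto.
  - solve_smooth.
  - rewrite X0; ring.
  - intros; auto_derive; auto; field.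
  - apply (bigO_eq full 3 (fun t => (L t - (l1 * t + l2 / 2 * t ^ 2)) + L t * (z t - 1))); [intros; ring|].
    apply bigO_plus; auto. apply (bigO_mult full 1 2); auto using jet_L1, jet_z.
Qed.

Lemma jet_Y3 : bigO full 4 (fun t => Y t - l1 * n1 / 3 * t ^ 3).
Proof.
  apply (bigO_primitive 3 Y (fun t => l1 * n1 / 3 * t ^ 3) (fun t => L t * w t) (fun t => l1 * n1 * t ^ 2)); auto.
  - solve_smooth.
  - rewrite Y0; ring.
  - intros; auto_derive; auto; field.
  - apply (bigO_eq full 3 (fun t => L t * (w t - n1 * t) + t ^ 1 * (n1 * (L t - (l1 * t + l2 / 2 * t ^ 2)))
       + t ^ 3 * (n1 * (l2 / 2)))); [intros; field|].
    apply bigO_plus; [apply bigO_plus|].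
    + apply (bigO_mult full 1 2); auto using jet_L1, jet_w.
    + apply (bigO_le full 4); auto. apply (bigO_pow_mult full 1 3). now apply bigO_scal.
    + apply bigO_pow_smooth. solve_smooth.
Qed.

Lemma jet_Y4 : l1 = 0 -> bigO full 5 (fun t => Y t - l2 * n1 / 8 * t ^ 4).
Proof.
  intros h1.
  apply (bigO_primitive 4 Y (fun t => l2 * n1 / 8 * t ^ 4) (fun t => L t * w t) (fun t => l2 * n1 / 2 * t ^ 3)); auto.
  - solve_smooth.
  - rewrite Y0; ring.
  - intros; auto_derive; auto; field.
  - apply (bigO_eq full 4 (fun t => (L t - (l1 * t + l2 / 2 * t ^ 2)) * w t
       + t ^ 2 * (l2 / 2 * (w t - n1 * t)))); [intros; rewrite h1; field|].
    apply bigO_plus.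
    + apply (bigO_mult full 3 1); auto. now apply bigO_of_value.
    + apply (bigO_pow_mult full 2 2). apply bigO_scal, jet_w.
Qed.

Lemma jet_Y5 : n1 = 0 -> bigO full 6 (fun t => Y t - (l1 * (n2 - l1 * c) / 8 * t ^ 4
  + (l1 * (n3 - l2 * c) / 30 + l2 * (n2 - l1 * c) / 20) * t ^ 5)).
Proof.
  (* [w2] and [w3] are the second and third derivatives of [w] at the origin. *)
  intros h. assert (ho := hom3 h). set (w2 := n2 - l1 * c) in *. set (w3 := n3 - l2 * c) in *.
  assert (hw : bigO full 4 (fun t => w t - (w2 / 2 * t ^ 2 + w3 / 6 * t ^ 3))).
  { apply (bigO_primitive 3 w (fun t => w2 / 2 * t ^ 2 + w3 / 6 * t ^ 3) (fun t => om t * z t)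
      (fun t => w2 * t + w3 / 2 * t ^ 2)); auto.
    - solve_smooth.
    - rewrite w0; ring.
    - intros; auto_derive; auto; field.
    - apply (bigO_eq full 3 (fun t => (om t - (w2 * t + w3 / 2 * t ^ 2)) + om t * (z t - 1))); [intros; ring|].
      apply bigO_plus; auto. apply (bigO_mult full 1 2); auto using jet_z.
      apply bigO_of_value; auto. now rewrite hom. }
  apply (bigO_primitive 5 Y (fun t => l1 * w2 / 8 * t ^ 4 + (l1 * w3 / 30 + l2 * w2 / 20) * t ^ 5)
    (fun t => L t * w t) (fun t => l1 * w2 / 2 * t ^ 3 + (l1 * w3 / 6 + l2 * w2 / 4) * t ^ 4)); auto.
  - solve_smooth.
  - rewrite Y0; ring.
  - intros; auto_derive; auto; field.
  - apply (bigO_eq full 5 (fun t => L t * (w t - (w2 / 2 * t ^ 2 + w3 / 6 * t ^ 3))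
       + t ^ 2 * ((w2 / 2 + w3 / 6 * t) * (L t - (l1 * t + l2 / 2 * t ^ 2)))
       + t ^ 5 * (l2 / 2 * (w3 / 6)))); [intros; field|].
    apply bigO_plus; [apply bigO_plus|].
    + apply (bigO_mult full 1 4); auto using jet_L1.
    + apply (bigO_pow_mult full 2 3). apply (bigO_mult full 0 3); auto. apply bigO_smooth. solve_smooth.
    + apply bigO_pow_smooth. solve_smooth.
Qed.

(** With [w2 = n2 - l1 * c] and [w3 = n3 - l2 * c], the factor [w2 / (2 * l1)] matches the terms in
    [t ^ 4]. Its contribution [l2 * w2 / 12] to [t ^ 5] turns [l1 * w3 / 30 + l2 * w2 / 20] into
    [(l1 * w3 - l2 * w2) / 30], where the terms in [c] cancel. *)
Lemma jet_52 : l1 <> 0 -> n1 = 0 ->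
  bigO full 6 (fun t => Y t - (n2 - l1 * c) / (2 * l1) * X t ^ 2 - (l1 * n3 - l2 * n2) / 30 * t ^ 5).
Proof.
  intros h1 h2. set (P := fun t => l1 / 2 * t ^ 2 + l2 / 6 * t ^ 3).
  assert (hP : bigO full 2 P).
  { apply (bigO_poly 2 (fun t => l1 / 2 + l2 / 6 * t)); [solve_smooth|intros; unfold P; ring]. }
  assert (hX2 : bigO full 2 X).
  { apply (bigO_eq full 2 (fun t => (X t - P t) + P t)); [intros; ring|].
    apply bigO_plus; auto. apply (bigO_le full 4); auto using jet_X. }
  apply (bigO_eq full 6 (fun t =>
    (Y t - (l1 * (n2 - l1 * c) / 8 * t ^ 4 + (l1 * (n3 - l2 * c) / 30 + l2 * (n2 - l1 * c) / 20) * t ^ 5))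
    + (- ((n2 - l1 * c) / (2 * l1)) * ((X t - P t) * (X t + P t))
    + t ^ 6 * (- ((n2 - l1 * c) / (2 * l1)) * (l2 / 6) ^ 2)))).
  - intros t. unfold P. field. auto.
  - apply bigO_plus; [now apply jet_Y5|]. apply bigO_plus.
    + apply bigO_scal. apply (bigO_mult full 4 2); [apply jet_X|]. now apply bigO_plus.
    + apply bigO_pow_smooth. apply smooth_R_const.
Qed.

Context (D : R -> Prop) (f : R -> R * R) (p1 p2 q1 q2 : R).
Context (hco : coords D f p1 p2 q1 q2 X Y) (hdet : p1 * q2 - p2 * q1 <> 0) (hD : accum D).

Lemma jet_X2 : bigO full 3 (fun t => X t - l1 / 2 * t ^ 2).
Proof.
  apply (bigO_eq full 3 (fun t => (X t - (l1 / 2 * t ^ 2 + l2 / 6 * t ^ 3)) + l2 / 6 * t ^ 3)); [intros; ring|].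
  apply bigO_plus; [apply (bigO_le full 4); auto using jet_X|apply bigO_scal, bigO_pow].
Qed.

Lemma jet_X3 : l1 = 0 -> bigO full 4 (fun t => X t - l2 / 6 * t ^ 3).
Proof. intros h. generalize jet_X. apply bigO_eq. intros t; rewrite h; field. Qed.

Lemma jet_Y5' : l1 = 0 -> n1 = 0 -> bigO full 6 (fun t => Y t - l2 * n2 / 20 * t ^ 5).
Proof. intros h1 h2. generalize (jet_Y5 h2). apply bigO_eq. intros t; rewrite h1; field. Qed.

Lemma cusp_32_iff : cuspidal D f 3 2 <-> l1 * n1 <> 0.
Proof.
  split; intros h.
  - destruct (cuspidal_necessary D f p1 p2 q1 q2 X Y hco hdet hD sX sY 2 3 _ _
      ltac:(lia) ltac:(lia) jet_X2 jet_Y3 h). lra.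
  - apply (cusp_2_normal_form D f p1 p2 q1 q2 X Y (l1 / 2) 0 (l1 * n1 / 3) 1); auto using jet_X2; try lra.
    + intros e. apply h. replace l1 with (2 * (l1 / 2)) by field. rewrite e. ring.
    + generalize jet_Y3. apply bigO_eq. intros t. simpl. ring.
Qed.

Lemma cusp_52_iff : cuspidal D f 5 2 <-> l1 <> 0 /\ n1 = 0 /\ l2 * n2 - l1 * n3 <> 0.
Proof.
  split.
  - intros h. assert (hY : bigO full 3 Y) by apply (bigO_weaken_lead full 3 Y _ jet_Y3).
    destruct (cuspidal_leading D f p1 p2 q1 q2 X Y hco hdet hD sX sY 2 5 _ ltac:(lia) jet_X2 hY h) as [h1 _].
    assert (h2 := cuspidal_gap D f p1 p2 q1 q2 X Y hco hdet hD sX sY 2 5 3 _ _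
      ltac:(lia) ltac:(lia) ltac:(lia) jet_X2 jet_Y3 h).
    assert (k1 : l1 <> 0) by lra.
    assert (k2 : n1 = 0).
    { assert (e : l1 * n1 = 0) by lra. apply Rmult_integral in e. tauto. }
    assert (k3 := cusp_52_necessary D f p1 p2 q1 q2 X Y hco hdet hD sX sY _ _ _ jet_X2 hY h (jet_52 k1 k2)).
    repeat split; auto. lra.
  - intros [h1 [h2 h3]].
    apply (cusp_2_normal_form D f p1 p2 q1 q2 X Y (l1 / 2) ((n2 - l1 * c) / (2 * l1)) ((l1 * n3 - l2 * n2) / 30) 2);
      auto using jet_X2; try lra.
    now apply jet_52.
Qed.

Lemma cusp_i3_order j : (3 < j)%nat -> cuspidal D f j 3 -> l1 = 0.
Proof.
  intros hj h.
  assert (e := cuspidal_order D f p1 p2 q1 q2 X Y hco hdet hD sX sY 3 j 2 _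
    ltac:(lia) ltac:(lia) X0 Y0 jet_X2 h). lra.
Qed.

Lemma cusp_43_iff : cuspidal D f 4 3 <-> l1 = 0 /\ n1 * l2 <> 0.
Proof.
  split.
  - intros h. assert (e := cusp_i3_order 4 ltac:(lia) h). split; auto.
    destruct (cuspidal_necessary D f p1 p2 q1 q2 X Y hco hdet hD sX sY 3 4 _ _
      ltac:(lia) ltac:(lia) (jet_X3 e) (jet_Y4 e) h). lra.
  - intros [h1 h2].
    apply (cusp_43_normal_form D f p1 p2 q1 q2 X Y (l2 / 6) (l2 * n1 / 8)); auto using jet_X3, jet_Y4; try lra.
    intros e. apply h2. replace l2 with (6 * (l2 / 6)) by field. rewrite e; ring.
Qed.

Lemma cusp_53_iff : cuspidal D f 5 3 <-> l1 = 0 /\ n1 = 0 /\ n2 * l2 <> 0.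
Proof.
  split.
  - intros h. assert (e := cusp_i3_order 5 ltac:(lia) h). split; auto.
    assert (h4 := cuspidal_gap D f p1 p2 q1 q2 X Y hco hdet hD sX sY 3 5 4 _ _
      ltac:(lia) ltac:(lia) ltac:(lia) (jet_X3 e) (jet_Y4 e) h).
    assert (hY : bigO full 4 Y) by apply (bigO_weaken_lead full 4 Y _ (jet_Y4 e)).
    destruct (cuspidal_leading D f p1 p2 q1 q2 X Y hco hdet hD sX sY 3 5 _ ltac:(lia) (jet_X3 e) hY h) as [h1 _].
    assert (k : n1 = 0).
    { assert (e' : l2 * n1 = 0) by lra. apply Rmult_integral in e'. destruct e' as [e'|e']; auto.
      exfalso; apply h1; rewrite e'; field. }
    split; auto.
    destruct (cuspidal_necessary D f p1 p2 q1 q2 X Y hco hdet hD sX sY 3 5 _ _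
      ltac:(lia) ltac:(lia) (jet_X3 e) (jet_Y5' e k) h). lra.
  - intros [h1 [h2 h3]].
    apply (cusp_53_normal_form D f p1 p2 q1 q2 X Y (l2 / 6) (l2 * n2 / 20)); auto using jet_X3, jet_Y5'; try lra.
    intros e. apply h3. replace l2 with (6 * (l2 / 6)) by field. rewrite e; ring.
Qed.

End Jets.

(** * The moving frame of the curve *)

Lemma Ck_sin_cos k : Ck k (fun _ : R => True) sin /\ Ck k (fun _ : R => True) cos.
Proof.
  induction k as [|k [IHs IHc]].
  - split; intros x _; [apply continuous_sin|apply continuous_cos].
  - split.
    + apply (Ck_of_derive k _ sin cos); auto. intros x _. apply is_derive_Reals, derivable_pt_lim_sin.
    + apply (Ck_of_derive k _ cos (fun x => -1 * sin x)).
      * intros x _. replace (-1 * sin x) with (- sin x) by ring.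
        apply is_derive_Reals, derivable_pt_lim_cos.
      * apply Ck_mult; auto using Ck_const.
Qed.

Lemma smooth_R_sin : smooth_R sin.
Proof. intros k; apply Ck_sin_cos. Qed.

Lemma smooth_R_cos : smooth_R cos.
Proof. intros k; apply Ck_sin_cos. Qed.

Section Germ.
Context (L N E A B xs : R -> R) (l1 l2 n1 n2 n3 : R).
Context (sL : smooth_R L) (sN : smooth_R N) (sE : smooth_R E) (sA : smooth_R A) (sB : smooth_R B)
  (sxs : smooth_R xs).
Context (dE : locally 0 (fun t => is_derive E t (N t)))
  (dA : locally 0 (fun t => is_derive A t (L t * sin (E t))))
  (dB : locally 0 (fun t => is_derive B t (L t * cos (E t)))).
Context (hpos : 0 < A 0 ^ 2 + B 0 ^ 2) (xs0 : xs 0 = 0).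
Context (dxs : locally 0 (fun t => is_derive xs t
  (L t * ((B t * sin (E t) - A t * cos (E t)) / sqrt (A t ^ 2 + B t ^ 2))))).
Context (hL : bigO full 3 (fun t => L t - (l1 * t + l2 / 2 * t ^ 2)))
  (hN : bigO full 3 (fun t => N t - (n1 + n2 * t + n3 / 2 * t ^ 2))).
Context (D : R -> Prop) (f : R -> R * R) (hD : accum D).
Context (hf : within D (locally 0) (fun h => fst (f h) = xs h /\
  snd (f h) = sqrt (A h ^ 2 + B h ^ 2) - sqrt (A 0 ^ 2 + B 0 ^ 2))).

(* With [U = sin psi] and [V = cos psi], the curve has velocity [L * (U, V)] and
   [psi] has derivative [om = N - L * U * K], where [K] extends [1 / y]. *)
Lemma germ_cusps :
  (cuspidal D f 3 2 <-> l1 * n1 <> 0) /\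
  (cuspidal D f 5 2 <->
     l1 <> 0 /\ n1 = 0 /\ l2 * n2 - l1 * n3 <> 0) /\
  (cuspidal D f 4 3 <-> l1 = 0 /\ n1 * l2 <> 0) /\
  (cuspidal D f 5 3 <->
     l1 = 0 /\ n1 = 0 /\ n2 * l2 <> 0).
Proof.
  assert (sS := smooth_R_sin). assert (sC := smooth_R_cos).
  set (q := fun t => A t ^ 2 + B t ^ 2).
  assert (sq : smooth_R q) by (unfold q; solve_smooth).
  assert (q0 : 0 < q 0) by exact hpos.
  assert (hq : locally 0 (fun t => 0 < q t)).
  { apply (continuous_pos q); auto. now apply smooth_R_continuous. }
  assert (ssq : smooth_near (fun t : R => sqrt (q t)) 0).
  { apply (smooth_near_comp (V := R_NormedModule) q sqrt); [now apply smooth_R_near|now apply smooth_near_sqrt]. }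
  destruct (smooth_R_extension (fun t => / sqrt (q t))) as [K [sK hK]].
  { apply (smooth_near_comp (V := R_NormedModule) (fun t => sqrt (q t)) Rinv); auto.
    apply smooth_near_inv. apply Rgt_not_eq, sqrt_lt_R0; auto. }
  destruct (smooth_R_extension (fun t => sqrt (q t) - sqrt (q 0))) as [ys [sys hys]].
  { apply (smooth_near_minus (V := R_NormedModule)); auto. apply smooth_near_const. }
  (* [U] and [V] are the cross and dot products of the unit vector [(A, B) / y] with
     [(sin E, cos E)], hence [U ^ 2 + V ^ 2 = 1]. *)
  set (U := fun t => (B t * sin (E t) - A t * cos (E t)) * K t).
  set (V := fun t => (A t * sin (E t) + B t * cos (E t)) * K t).
  assert (sU : smooth_R U) by (unfold U; solve_smooth).
  assert (sV : smooth_R V) by (unfold V; solve_smooth).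
  set (om := fun t => N t - L t * (U t * K t)).
  assert (som : smooth_R om) by (unfold om; solve_smooth).
  assert (hL0 : L 0 = 0).
  { apply (bigO_S_value L 0); auto. apply (bigO_eq full 1 (fun t => (L t - (l1 * t + l2 / 2 * t ^ 2)) + t ^ 1 * (l1 + l2 / 2 * t))); [intros; ring|].
    apply bigO_plus; [apply (bigO_le full 3); auto|]. apply bigO_pow_smooth. solve_smooth. }
  assert (hK2 : locally 0 (fun t => K t ^ 2 * q t = 1 /\ K t * sqrt (q t) = 1)).
  { generalize (filter_and _ _ hK hq); apply filter_imp. intros t [e h].
    assert (hs := sqrt_lt_R0 _ h). assert (hs2 := pow2_sqrt (q t) (Rlt_le _ _ h)).
    rewrite e. split; [|field; lra]. rewrite <- hs2 at 2. field; lra. }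
  assert (hUV : locally 0 (fun t => U t ^ 2 + V t ^ 2 = 1)).
  { revert hK2; apply filter_imp. intros t [e _]. rewrite <- e. unfold U, V, q.
    assert (h := sin2_cos2 (E t)). unfold Rsqr in h.
    transitivity (K t ^ 2 * ((A t ^ 2 + B t ^ 2) * (sin (E t) * sin (E t) + cos (E t) * cos (E t)))).
    - ring.
    - rewrite h. ring. }
  assert (dq : locally 0 (fun t => is_derive (fun t => sqrt (q t)) t (L t * V t))).
  { generalize (filter_and _ _ (filter_and _ _ hK2 hq) (filter_and _ _ dA dB)); apply filter_imp.
    intros t [[[e1 e2] h] [h1 h2]]. unfold q in *.
    assert (hs := sqrt_lt_R0 _ h). set (s := sqrt (A t ^ 2 + B t ^ 2)) in *.
    replace (L t * V t) with ((2 * A t * (L t * sin (E t)) + 2 * B t * (L t * cos (E t))) / (2 * s)).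
    - assert (hd : is_derive (fun t => A t ^ 2 + B t ^ 2) t (2 * A t * (L t * sin (E t)) + 2 * B t * (L t * cos (E t)))).
      { auto_derive.
        - split; [eexists; exact h1|split; auto; eexists; exact h2].
        - replace (Derive (fun x => A x) t) with (L t * sin (E t)) by (symmetry; now apply is_derive_unique).
          replace (Derive (fun x => B x) t) with (L t * cos (E t)) by (symmetry; now apply is_derive_unique).
          ring. }
      apply (is_derive_sqrt _ t _ hd h).
    - unfold V. replace (K t) with (/ s); [field; lra|].
      apply (Rmult_eq_reg_r s); [|lra]. rewrite e2. field; lra. }
  assert (dK : locally 0 (fun t => is_derive K t (- (K t ^ 2 * (L t * V t))))).
  { generalize (filter_and _ _ (filter_and _ _ (locally_locally _ _ hK) hq) (filter_and _ _ dq hK2)); apply filter_imp.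
    intros t [[e h] [h1 [_ h3]]]. assert (hs := sqrt_lt_R0 _ h).
    apply (is_derive_ext_loc (fun t => / sqrt (q t))).
    - revert e; apply filter_imp; auto.
    - replace (- (K t ^ 2 * (L t * V t))) with (- (L t * V t) / sqrt (q t) ^ 2).
      + apply (is_derive_inv (fun t => sqrt (q t))); auto. lra.
      + replace (K t) with (/ sqrt (q t)); [field; lra|].
        apply (Rmult_eq_reg_r (sqrt (q t))); [|lra]. rewrite h3. field; lra. }
  assert (dUV : locally 0 (fun t => is_derive U t (om t * V t) /\ is_derive V t (- om t * U t))).
  { generalize (filter_and _ _ (filter_and _ _ (filter_and _ _ dA dB) (filter_and _ _ dE dK)) hUV); apply filter_imp.
    intros t [[[h1 h2] [h3 h4]] h5].
    assert (exA : ex_derive A t) by (eexists; exact h1). assert (exB : ex_derive B t) by (eexists; exact h2).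
    assert (exE : ex_derive E t) by (eexists; exact h3). assert (exK : ex_derive K t) by (eexists; exact h4).
    split.
    - unfold U at 1. auto_derive; [tauto|].
      change (Derive (fun x => A x) t) with (Derive A t). change (Derive (fun x => B x) t) with (Derive B t).
      change (Derive (fun x => E x) t) with (Derive E t). change (Derive (fun x => K x) t) with (Derive K t).
      rewrite (is_derive_unique _ _ _ h1), (is_derive_unique _ _ _ h2), (is_derive_unique _ _ _ h3),
        (is_derive_unique _ _ _ h4).
      unfold om, U, V. ring.
    - unfold V at 1. auto_derive; [tauto|].
      change (Derive (fun x => A x) t) with (Derive A t). change (Derive (fun x => B x) t) with (Derive B t).
      change (Derive (fun x => E x) t) with (Derive E t). change (Derive (fun x => K x) t) with (Derive K t).
      rewrite (is_derive_unique _ _ _ h1), (is_derive_unique _ _ _ h2), (is_derive_unique _ _ _ h3),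
        (is_derive_unique _ _ _ h4).
      unfold om. assert (hsc := sin2_cos2 (E t)). unfold Rsqr in hsc.
      (* Differentiating [V] leaves [L * K * (1 - V ^ 2)], which is [L * K * U ^ 2] by the unit
         length; this is the correction term of [om]. *)
      transitivity (- (N t * U t) + L t * K t * (sin (E t) * sin (E t) + cos (E t) * cos (E t) - V t ^ 2)).
      + unfold U, V; ring.
      + rewrite hsc. replace (1 - V t ^ 2) with (U t ^ 2) by lra. ring. }
  set (U0 := U 0). set (V0 := V 0).
  assert (hUV0 : U0 ^ 2 + V0 ^ 2 = 1) by (apply (locally_singleton _ _ hUV)).
  assert (dys : locally 0 (fun t => is_derive ys t (L t * V t))).
  { generalize (filter_and _ _ (locally_locally _ _ hys) dq); apply filter_imp.
    intros t [e h]. apply (is_derive_ext_loc (fun t => sqrt (q t) - sqrt (q 0))).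
    - revert e; apply filter_imp; auto.
    - replace (L t * V t) with (L t * V t - 0) by ring.
      apply (is_derive_minus (fun t => sqrt (q t)) (fun _ => sqrt (q 0))); auto.
      apply (@is_derive_const R_AbsRing R_NormedModule). }
  assert (dxs' : locally 0 (fun t => is_derive xs t (L t * U t))).
  { generalize (filter_and _ _ dxs hK); apply filter_imp. intros t [h e].
    unfold U. rewrite e. exact h. }
  assert (dlin : forall (g1 g2 : R -> R) d1 d2 a b t, is_derive g1 t d1 -> is_derive g2 t d2 ->
    is_derive (fun t => a * g1 t + b * g2 t) t (a * d1 + b * d2)).
  { intros g1 g2 d1 d2 a b t h1 h2.
    apply (is_derive_plus (fun t => a * g1 t) (fun t => b * g2 t)); now apply is_derive_scal. }
  (* These are the cosine and the sine of [psi - psi p]. The frame is the reflection with rows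
     [(U0, V0)] and [(V0, - U0)], oriented so that [w' = om * z]. *)
  set (z := fun t => U0 * U t + V0 * V t). set (w := fun t => V0 * U t + - U0 * V t).
  set (X := fun t => U0 * xs t + V0 * ys t). set (Y := fun t => V0 * xs t + - U0 * ys t).
  assert (sz : smooth_R z) by (unfold z; solve_smooth). assert (sw : smooth_R w) by (unfold w; solve_smooth).
  assert (sX : smooth_R X) by (unfold X; solve_smooth). assert (sY : smooth_R Y) by (unfold Y; solve_smooth).
  assert (ys0 : ys 0 = 0).
  { rewrite (locally_singleton _ _ hys). ring. }
  assert (z0 : z 0 = 1) by (unfold z; fold U0 V0; rewrite <- hUV0; ring).
  assert (w0 : w 0 = 0) by (unfold w; fold U0 V0; ring).
  assert (X0 : X 0 = 0) by (unfold X; rewrite xs0, ys0; ring).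
  assert (Y0 : Y 0 = 0) by (unfold Y; rewrite xs0, ys0; ring).
  assert (dX : locally 0 (fun t => is_derive X t (L t * z t))).
  { generalize (filter_and _ _ dxs' dys); apply filter_imp. intros t [h1 h2].
    unfold z. replace (L t * (U0 * U t + V0 * V t)) with (U0 * (L t * U t) + V0 * (L t * V t)) by ring.
    now apply dlin. }
  assert (dY : locally 0 (fun t => is_derive Y t (L t * w t))).
  { generalize (filter_and _ _ dxs' dys); apply filter_imp. intros t [h1 h2].
    unfold w. replace (L t * (V0 * U t + - U0 * V t)) with (V0 * (L t * U t) + - U0 * (L t * V t)) by ring.
    now apply dlin. }
  assert (dw : locally 0 (fun t => is_derive w t (om t * z t))).
  { revert dUV; apply filter_imp. intros t [h1 h2].
    unfold z. replace (om t * (U0 * U t + V0 * V t)) with (V0 * (om t * V t) + - U0 * (- om t * U t)) by ring.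
    now apply dlin. }
  assert (dz : locally 0 (fun t => is_derive z t (- om t * w t))).
  { revert dUV; apply filter_imp. intros t [h1 h2].
    unfold w. replace (- om t * (V0 * U t + - U0 * V t)) with (U0 * (om t * V t) + V0 * (- om t * U t)) by ring.
    now apply dlin. }
  assert (hN0 : N 0 = n1).
  { apply Rminus_diag_uniq. apply (bigO_S_value (fun t => N t - n1) 0); [solve_smooth|].
    apply (bigO_eq full 1 (fun t => (N t - (n1 + n2 * t + n3 / 2 * t ^ 2)) + t ^ 1 * (n2 + n3 / 2 * t))); [intros; ring|].
    apply bigO_plus; [apply (bigO_le full 3); auto|]. apply bigO_pow_smooth. solve_smooth. }
  assert (hom : om 0 = n1) by (unfold om; rewrite hL0, hN0; ring).
  set (c := U0 * K 0).
  assert (hL1 : bigO full 1 L) by now apply bigO_of_value.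
  assert (hom3 : n1 = 0 -> bigO full 3 (fun t => om t - ((n2 - l1 * c) * t + (n3 - l2 * c) / 2 * t ^ 2))).
  { intros h.
    (* When [n1 = 0], both [U] and [K] have zero derivative at the origin, so [L * U * K] may be
       replaced by [c * L] up to order 3. *)
    assert (hU2 : bigO full 2 (fun t => U t - U0)).
    { apply (bigO_primitive 1 U (fun _ => U0) (fun t => om t * V t) (fun _ => 0)); auto using smooth_R_const.
      - revert dUV; apply filter_imp; tauto.
      - intros; auto_derive; auto.
      - apply (bigO_eq full 1 (fun t => om t * V t)); [intros; ring|].
        apply (bigO_mult full 1 0); [apply bigO_of_value; auto; now rewrite hom|now apply bigO_smooth]. }
    assert (hKK : bigO full 2 (fun t => K t - K 0)).
    { apply (bigO_primitive 1 K (fun _ => K 0) (fun t => - (K t ^ 2 * (L t * V t))) (fun _ => 0)); auto using smooth_R_const.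
      - intros; auto_derive; auto.
      - apply (bigO_eq full 1 (fun t => L t * (-1 * K t ^ 2 * V t))); [intros; ring|].
        apply (bigO_mult full 1 0); auto. apply bigO_smooth. solve_smooth. }
    apply (bigO_eq full 3 (fun t => (N t - (n1 + n2 * t + n3 / 2 * t ^ 2))
      - L t * (U t * K t - U0 * K 0) - c * (L t - (l1 * t + l2 / 2 * t ^ 2)))).
    - intros t. unfold om, c. rewrite h. field.
    - apply bigO_minus; [apply bigO_minus; auto|now apply bigO_scal].
      apply (bigO_mult full 1 2); auto.
      apply bigO_sub_mult; auto using bigO_smooth, bigO_const. }
  assert (hco : coords D f U0 V0 V0 (- U0) X Y).
  { unfold coords, within in *. generalize (filter_and _ _ hf hys); apply filter_imp.
    intros t [h e] Dt. destruct (h Dt) as [e1 e2]. fold (q t) in e2. fold (q 0) in e2.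
    rewrite <- e in e2. unfold X, Y. rewrite e1, e2. split; ring. }
  assert (hdet : U0 * - U0 - V0 * V0 <> 0).
  { replace (U0 * - U0 - V0 * V0) with (- (U0 ^ 2 + V0 ^ 2)) by ring. rewrite hUV0. lra. }
  split; [|split; [|split]].
  - now apply (cusp_32_iff L z w om X Y l1 l2 n1) with (p1 := U0) (p2 := V0) (q1 := V0) (q2 := - U0).
  - now apply (cusp_52_iff L z w om X Y l1 l2 n1 n2 n3 c) with (p1 := U0) (p2 := V0) (q1 := V0) (q2 := - U0).
  - now apply (cusp_43_iff L z w om X Y l1 l2 n1) with (p1 := U0) (p2 := V0) (q1 := V0) (q2 := - U0).
  - now apply (cusp_53_iff L z w om X Y l1 l2 n1 n2 n3 c) with (p1 := U0) (p2 := V0) (q1 := V0) (q2 := - U0).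
Qed.

End Germ.

(** * Germs along an interval *)

(** Recentred at [p] and smooth on both sides of the origin, so that one-sided derivatives and
    integrals of [f] become ordinary ones of [G]. *)
Definition germ_on (I : R -> Prop) (p : R) (f G : R -> R) : Prop :=
  smooth_R G /\ within (fun h => I (p + h)) (locally 0) (fun h => f (p + h) = G h).

Lemma smooth_on_germ I f p : smooth_on I f -> I p -> exists G, germ_on I p f G.
Proof.
  intros hf hp. destruct (hf p hp) as [g [sg hg]].
  destruct (smooth_R_extension (fun h => g (p + h))) as [G [sG hG]].
  { apply (smooth_near_comp (V := R_NormedModule) (fun h => p + h) g).
    - apply (smooth_near_plus (V := R_NormedModule)); [apply smooth_near_const|].
      apply (smooth_near_linear (V := R_NormedModule)), is_linear_id.
    - now rewrite Rplus_0_r. }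
  exists G; split; auto. unfold within in *.
  destruct hg as [d1 h1]. destruct hG as [d2 h2].
  assert (hm : 0 < Rmin d1 d2) by (apply Rmin_pos; apply cond_pos).
  exists (mkposreal _ hm). intros h hh Ih. change (Rabs (h - 0) < Rmin d1 d2) in hh.
  assert (k1 := Rlt_le_trans _ _ _ hh (Rmin_l _ _)). assert (k2 := Rlt_le_trans _ _ _ hh (Rmin_r _ _)).
  rewrite (h2 h k2). apply h1; auto. change (Rabs (p + h - p) < d1).
  replace (p + h - p) with (h - 0) by ring. exact k1.
Qed.

Lemma germ_on_value I p f G : I p -> germ_on I p f G -> f p = G 0.
Proof.
  intros hp [_ h]. unfold within in h. apply locally_singleton in h.
  rewrite Rplus_0_r in h. auto.
Qed.

Lemma germ_on_delta I p f G : germ_on I p f G ->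
  exists d : posreal, forall h, Rabs h < d -> I (p + h) -> f (p + h) = G h.
Proof.
  intros [_ [d hd]]. exists d. intros h hh. apply hd. change (Rabs (h - 0) < d). now rewrite Rminus_0_r.
Qed.

Section Interval.
Context (I : R -> Prop) (hI : is_interval I).

Lemma interval_mem a b t : I a -> I b -> Rmin a b <= t <= Rmax a b -> I t.
Proof.
  intros ha hb ht. destruct hI as [h _]. revert ht. unfold Rmin, Rmax.
  destruct (Rle_dec a b); intros ht; [apply (h a b)|apply (h b a)]; auto; lra.
Qed.

Lemma accum_interval p : I p -> accum (fun h => I (p + h)).
Proof.
  intros hp eps. destruct hI as [h [a [b [ha [hb hab]]]]].
  assert (he := cond_pos eps).
  destruct (Rlt_le_dec p b) as [h1|h1].
  - set (m := Rmin (eps / 2) (b - p)).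
    assert (hm : 0 < m) by (apply Rmin_pos; lra).
    assert (m1 : m <= eps / 2) by apply Rmin_l. assert (m2 : m <= b - p) by apply Rmin_r.
    exists m. split; [apply (h p b); auto; lra|]. split; [lra|]. rewrite Rabs_right; lra.
  - set (m := Rmin (eps / 2) (p - a)).
    assert (hm : 0 < m) by (apply Rmin_pos; lra).
    assert (m1 : m <= eps / 2) by apply Rmin_l. assert (m2 : m <= p - a) by apply Rmin_r.
    exists (- m). split; [apply (h a p); auto; lra|]. split; [lra|]. rewrite Rabs_left; lra.
Qed.

Lemma within_proper t : I t -> ProperFilter (within I (locally t)).
Proof.
  intros ht. split.
  - intros P hP. exists t. unfold within in hP. apply locally_singleton in hP. auto.
  - typeclasses eauto.
Qed.

Lemma within_filter_lim t : is_filter_lim (within I (locally t)) t.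
Proof. intros P hP. unfold within. revert hP; apply filter_imp; auto. Qed.

Lemma is_derive_in_ext {W : NormedModule R_AbsRing} (f g : R -> W) t d : I t ->
  within I (locally t) (fun y => g y = f y) -> is_derive g t d -> is_derive_in I f t d.
Proof.
  intros ht he hg. assert (hp := within_proper t ht).
  unfold is_derive_in. apply (@filterdiff_ext_loc _ _ _ (within I (locally t)) _ g f); auto.
  - intros y hy.
    assert (e : y = t).
    { apply eq_close. apply (is_filter_lim_close y t hy), within_filter_lim. }
    subst y. unfold within in he. apply locally_singleton in he. auto.
  - apply (filterdiff_locally g t); auto. apply within_filter_lim.
Qed.

Lemma is_derive_in_bound (f : R -> R) t d : is_derive_in I f t d -> forall eps : posreal,
  exists del : posreal, forall y, I y -> Rabs (y - t) < del ->
    Rabs (f y - f t - (y - t) * d) <= eps * Rabs (y - t).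
Proof.
  intros [_ h] eps. destruct (h t (within_filter_lim t) eps) as [del hdel].
  exists del. intros y Iy hy. exact (hdel y hy Iy).
Qed.

Lemma is_derive_in_unique (f : R -> R) t d1 d2 : I t ->
  is_derive_in I f t d1 -> is_derive_in I f t d2 -> d1 = d2.
Proof.
  intros ht h1 h2. apply Rminus_diag_uniq. apply Rabs_eq_0.
  destruct (Rle_lt_or_eq_dec 0 (Rabs (d1 - d2)) (Rabs_pos _)) as [hlt|]; auto. exfalso.
  assert (he : 0 < Rabs (d1 - d2) / 4) by lra.
  destruct (is_derive_in_bound f t d1 h1 (mkposreal _ he)) as [e1 k1].
  destruct (is_derive_in_bound f t d2 h2 (mkposreal _ he)) as [e2 k2].
  assert (hm : 0 < Rmin e1 e2) by (apply Rmin_pos; apply cond_pos).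
  destruct (accum_interval t ht (mkposreal _ hm)) as [h [Ih [h0 hh]]]. simpl in hh, k1, k2.
  specialize (k1 (t + h) Ih). specialize (k2 (t + h) Ih).
  replace (t + h - t) with h in k1, k2 by ring.
  specialize (k1 (Rlt_le_trans _ _ _ hh (Rmin_l _ _))). specialize (k2 (Rlt_le_trans _ _ _ hh (Rmin_r _ _))).
  assert (hp : 0 < Rabs h) by now apply Rabs_pos_lt.
  assert (k3 : Rabs (h * (d1 - d2)) <= Rabs (d1 - d2) / 2 * Rabs h).
  { replace (h * (d1 - d2)) with ((f (t + h) - f t - h * d2) - (f (t + h) - f t - h * d1)) by ring.
    eapply Rle_trans; [apply Rabs_triang|]. rewrite Rabs_Ropp. lra. }
  rewrite Rabs_mult in k3. nra.
Qed.

(** [Derive_in] is a definite description, hence its value rests on uniqueness of the derivative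
    along [I], that is, on points of [I] accumulating at [t]. *)
Lemma Derive_in_eq (f : R -> R) t d : I t -> is_derive_in I f t d -> Derive_in I f t = d.
Proof.
  intros ht h. apply (iota_unique (V := R_CompleteNormedModule)); auto.
  intros y hy. now apply (is_derive_in_unique f t).
Qed.

(** Stated at all nearby points of [I], because the next derivative needs the whole function
    [Derive_in I f] and not only its value at [p]. *)
Lemma germ_is_derive_in p f G : germ_on I p f G ->
  within (fun h => I (p + h)) (locally 0) (fun h => is_derive_in I f (p + h) (Derive G h)).
Proof.
  intros hG. destruct (germ_on_delta I p f G hG) as [d hd]. destruct hG as [sG _].
  exists d.
  refine (_ : forall h : R, Rabs (h - 0) < d -> I (p + h) -> is_derive_in I f (p + h) (Derive G h)).
  intros h hh Ih. rewrite Rminus_0_r in hh.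
  apply (is_derive_in_ext f (fun y => G (y - p))); auto.
  - assert (he : 0 < d - Rabs h) by lra. exists (mkposreal _ he).
    refine (_ : forall y : R, Rabs (y - (p + h)) < d - Rabs h -> I y -> G (y - p) = f y).
    intros y hy Iy. replace (f y) with (f (p + (y - p))) by (f_equal; ring). symmetry. apply hd.
    + replace (y - p) with ((y - (p + h)) + h) by ring.
      eapply Rle_lt_trans; [apply Rabs_triang|]. lra.
    + now replace (p + (y - p)) with y by ring.
  - replace (Derive G h) with (1 * Derive G (p + h - p)) by (replace (p + h - p) with h by ring; ring).
    apply (is_derive_comp G (fun y => y - p)); [now apply smooth_R_is_derive|].
    auto_derive; auto; ring.
Qed.

Lemma germ_Derive_n_in p f G n : germ_on I p f G -> germ_on I p (Derive_n_in I f n) (Derive_n G n).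
Proof.
  intros hG. induction n as [|n IH]; auto. split.
  - apply (smooth_R_Derive_n G (S n)), hG.
  - generalize (germ_is_derive_in p _ _ IH). unfold within. apply filter_imp.
    intros h hd Ih. simpl. now apply Derive_in_eq; [|apply hd].
Qed.

Definition has_germs (f : R -> R) : Prop := forall p, I p -> exists G, germ_on I p f G.

(** Retraction onto the segment between [a] and [b]. Composition with it makes a function that is
    continuous along [I] continuous on the line, as integration and the mean value theorem
    require. *)
Definition clamp (a b t : R) : R := Rmax (Rmin a b) (Rmin t (Rmax a b)).

Lemma clamp_bounds a b t : Rmin a b <= clamp a b t <= Rmax a b.
Proof.
  assert (h : Rmin a b <= Rmax a b) by (eapply Rle_trans; [apply Rmin_l|apply Rmax_l]).
  unfold clamp. split; [apply Rmax_l|]. apply Rmax_lub; auto. apply Rmin_r.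
Qed.

Lemma clamp_id a b t : Rmin a b <= t <= Rmax a b -> clamp a b t = t.
Proof. intros [h1 h2]. unfold clamp. rewrite (Rmin_left t) by auto. now rewrite Rmax_right. Qed.

Lemma clamp_lipschitz a b t u : Rabs (clamp a b t - clamp a b u) <= Rabs (t - u).
Proof.
  unfold clamp. generalize (Rmin a b) (Rmax a b). intros m M.
  assert (h : t <= u \/ u <= t) by lra.
  unfold Rmax, Rmin. destruct (Rle_dec t M), (Rle_dec u M);
    repeat (match goal with |- context [Rle_dec ?x ?y] => destruct (Rle_dec x y) end);
    destruct h; apply Rabs_le; unfold Rabs; destruct (Rcase_abs (t - u)); lra.
Qed.

Lemma continuous_clamp (f : R -> R) a b : I a -> I b ->
  (forall t, I t -> forall eps : posreal, exists del : posreal,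
     forall y, I y -> Rabs (y - t) < del -> Rabs (f y - f t) < eps) ->
  forall t, continuous (fun s => f (clamp a b s)) t.
Proof.
  intros ha hb hf t.
  assert (hIc : forall s, I (clamp a b s)) by (intros; apply (interval_mem a b); auto using clamp_bounds).
  apply (filterlim_locally (fun s => f (clamp a b s))).
  intros eps. destruct (hf _ (hIc t) eps) as [del hdel]. exists del. intros y hy.
  change (Rabs (y - t) < del) in hy. apply hdel; auto.
  eapply Rle_lt_trans; [apply clamp_lipschitz|auto].
Qed.

Lemma germ_continuous_in f : has_germs f -> forall t, I t -> forall eps : posreal, exists del : posreal,
  forall y, I y -> Rabs (y - t) < del -> Rabs (f y - f t) < eps.
Proof.
  intros hf t ht eps. destruct (hf t ht) as [G hG].
  assert (e0 := germ_on_value I t f G ht hG).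
  destruct (germ_on_delta I t f G hG) as [d hd]. destruct hG as [sG _].
  assert (hc : continuous G 0) by now apply smooth_R_continuous.
  destruct (proj1 (filterlim_locally G (G 0)) hc eps) as [d' hd'].
  assert (hm : 0 < Rmin d d') by (apply Rmin_pos; apply cond_pos).
  exists (mkposreal _ hm). intros y Iy hy. simpl in hy.
  assert (k1 := Rlt_le_trans _ _ _ hy (Rmin_l _ _)). assert (k2 := Rlt_le_trans _ _ _ hy (Rmin_r _ _)).
  assert (e : f y = G (y - t)).
  { replace y with (t + (y - t)) at 1 by ring. apply hd; auto. now replace (t + (y - t)) with y by ring. }
  rewrite e, e0. apply (hd' (y - t)). change (Rabs (y - t - 0) < d'). now rewrite Rminus_0_r.
Qed.

Lemma germ_ex_RInt f a b : has_germs f -> I a -> I b -> ex_RInt f a b.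
Proof.
  intros hf ha hb. apply (ex_RInt_ext (fun t => f (clamp a b t))).
  - intros t ht. rewrite clamp_id; auto; lra.
  - apply (@ex_RInt_continuous R_CompleteNormedModule). intros t _.
    apply continuous_clamp; auto. now apply germ_continuous_in.
Qed.

Lemma smooth_R_RInt G c : smooth_R G -> smooth_R (fun h => c + RInt G 0 h).
Proof.
  intros sG. apply smooth_R_plus; [apply smooth_R_const|].
  apply (smooth_R_of_derive _ G); auto. intros h.
  apply (is_derive_RInt G (fun h => RInt G 0 h) 0 h); [|now apply smooth_R_continuous].
  apply filter_forall; intros u. apply (@RInt_correct R_CompleteNormedModule).
  apply (@ex_RInt_continuous R_CompleteNormedModule). intros; now apply smooth_R_continuous.
Qed.

Lemma is_derive_RInt_smooth G c h : smooth_R G -> is_derive (fun h => c + RInt G 0 h) h (G h).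
Proof.
  intros sG. replace (G h) with (0 + G h) by ring.
  apply (is_derive_plus (fun _ => c) (fun h => RInt G 0 h)).
  - apply (@is_derive_const R_AbsRing R_NormedModule).
  - apply (is_derive_RInt G (fun h => RInt G 0 h) 0 h); [|now apply smooth_R_continuous].
    apply filter_forall; intros u. apply (@RInt_correct R_CompleteNormedModule).
    apply (@ex_RInt_continuous R_CompleteNormedModule). intros; now apply smooth_R_continuous.
Qed.

Lemma germ_RInt f p G : I 0 -> I p -> has_germs f -> germ_on I p f G ->
  germ_on I p (fun u => RInt f 0 u) (fun h => RInt f 0 p + RInt G 0 h).
Proof.
  intros h0 hp hf hG. destruct (germ_on_delta I p f G hG) as [d hd]. destruct hG as [sG _].
  split; [now apply smooth_R_RInt|].
  exists d.
  refine (_ : forall h : R, Rabs (h - 0) < d -> I (p + h) ->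
    RInt f 0 (p + h) = RInt f 0 p + RInt G 0 h).
  intros h hh Ih. rewrite Rminus_0_r in hh.
  assert (x1 := germ_ex_RInt f 0 p hf h0 hp). assert (x2 := germ_ex_RInt f p (p + h) hf hp Ih).
  rewrite <- (RInt_Chasles f 0 p (p + h)) by auto.
  change (RInt f 0 p + RInt f p (p + h) = RInt f 0 p + RInt G 0 h). f_equal.
  assert (e := RInt_comp_lin f 1 p 0 h).
  replace (1 * 0 + p) with p in e by ring. replace (1 * h + p) with (p + h) in e by ring.
  rewrite <- e by auto. apply RInt_ext. intros t ht.
  assert (ht' : Rabs t < d).
  { revert ht hh. unfold Rmin, Rmax. destruct (Rle_dec 0 h); unfold Rabs;
      destruct (Rcase_abs t), (Rcase_abs h); lra. }
  assert (It : I (p + t)).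
  { apply (interval_mem p (p + h)); auto. revert ht. unfold Rmin, Rmax.
    destruct (Rle_dec 0 h), (Rle_dec p (p + h)); lra. }
  replace (1 * t + p) with (p + t) by ring. rewrite hd by auto.
  unfold scal; simpl; unfold mult; simpl. ring.
Qed.

Lemma has_germs_RInt f : I 0 -> has_germs f -> has_germs (fun u => RInt f 0 u).
Proof.
  intros h0 hf p hp. destruct (hf p hp) as [G hG]. eexists. now apply germ_RInt; eauto.
Qed.

(** At [a] and [b] the derivative may be one-sided; there the mean value theorem asks only for
    continuity, which the clamped function has. *)
Lemma constant_of_derive_in_0 f a b : I a -> I b ->
  (forall t, Rmin a b <= t <= Rmax a b -> is_derive_in I f t 0) -> f a = f b.
Proof.
  intros ha hb hd. set (g := fun s => f (clamp a b s)).
  assert (hc : forall t, Rmin a b <= t <= Rmax a b -> forall eps : posreal, exists del : posreal,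
     forall y, I y -> Rabs (y - t) < del -> Rabs (f y - f t) < eps).
  { intros t ht eps. destruct (is_derive_in_bound f t 0 (hd t ht) (mkposreal _ Rlt_0_1)) as [del h].
    assert (hm : 0 < Rmin del eps) by (apply Rmin_pos; apply cond_pos).
    exists (mkposreal _ hm). intros y Iy hy. simpl in hy, h.
    specialize (h y Iy (Rlt_le_trans _ _ _ hy (Rmin_l _ _))).
    rewrite Rmult_0_r, Rminus_0_r in h. generalize (Rlt_le_trans _ _ _ hy (Rmin_r _ _)); lra. }
  assert (hg : forall t, continuity_pt g t).
  { intros t. apply continuity_pt_filterlim. apply (filterlim_locally g).
    intros eps. destruct (hc _ (clamp_bounds a b t) eps) as [del hdel]. exists del. intros y hy.
    change (Rabs (y - t) < del) in hy. apply hdel.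
    - apply (interval_mem a b); auto using clamp_bounds.
    - eapply Rle_lt_trans; [apply clamp_lipschitz|auto]. }
  assert (hmm : Rmin a b <= Rmax a b) by (eapply Rle_trans; [apply Rmin_l|apply Rmax_l]).
  destruct (MVT_gen g a b (fun _ => 0)) as [c [_ e]].
  - intros t ht. apply is_derive_Reals. intros eps heps.
    assert (he : 0 < eps / 2) by lra.
    destruct (is_derive_in_bound f t 0 (hd t ltac:(lra)) (mkposreal _ he)) as [del h].
    assert (hm : 0 < Rmin del (Rmin (t - Rmin a b) (Rmax a b - t))).
    { repeat apply Rmin_pos; try lra. apply cond_pos. }
    exists (mkposreal _ hm). intros k k0 hk. simpl in hk, h.
    assert (hk1 := Rlt_le_trans _ _ _ hk (Rmin_l _ _)). assert (hk2 := Rlt_le_trans _ _ _ hk (Rmin_r _ _)).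
    assert (hk3 := Rlt_le_trans _ _ _ hk2 (Rmin_l _ _)). assert (hk4 := Rlt_le_trans _ _ _ hk2 (Rmin_r _ _)).
    apply Rabs_def2 in hk3, hk4.
    unfold g. rewrite !clamp_id by lra.
    assert (Itk : I (t + k)) by (apply (interval_mem a b); auto; lra).
    specialize (h (t + k) Itk). replace (t + k - t) with k in h by ring. specialize (h hk1).
    rewrite Rmult_0_r, Rminus_0_r in h. rewrite Rminus_0_r.
    unfold Rdiv. rewrite Rabs_mult, Rabs_inv.
    assert (hp : 0 < Rabs k) by now apply Rabs_pos_lt.
    apply (Rmult_lt_reg_r (Rabs k)); auto. rewrite Rmult_assoc, Rinv_l, Rmult_1_r by lra. nra.
  - intros t _; apply hg.
  - unfold g in e. rewrite !clamp_id in e; [lra| |]; split; auto using Rmin_l, Rmin_r, Rmax_l, Rmax_r.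
Qed.

End Interval.

(** * Taylor coefficients and the germ of the curve at [p] *)

Lemma smooth_taylor_3 f : smooth_R f ->
  bigO full 3 (fun t => f t - (f 0 + Derive f 0 * t + Derive_n f 2 0 / 2 * t ^ 2)).
Proof.
  intros sf.
  assert (s1 := smooth_R_Derive_n f 1 sf). assert (s2 := smooth_R_Derive_n f 2 sf).
  apply (bigO_primitive 2 f (fun t => f 0 + Derive f 0 * t + Derive_n f 2 0 / 2 * t ^ 2) (Derive f)
    (fun t => Derive f 0 + Derive_n f 2 0 * t)); auto.
  - solve_smooth.
  - ring.
  - apply filter_forall; intros; now apply smooth_R_is_derive.
  - intros t. auto_derive; auto. simpl; field.
  - apply (bigO_primitive 1 (Derive f) (fun t => Derive f 0 + Derive_n f 2 0 * t) (Derive_n f 2)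
      (fun t => Derive_n f 2 0)); auto.
    + solve_smooth.
    + ring.
    + apply filter_forall; intros. apply (smooth_R_is_derive (Derive f)); auto.
    + intros t. auto_derive; auto. simpl; ring.
    + now apply bigO_value.
Qed.

Lemma germ_on_mult I p f g F G : germ_on I p f F -> germ_on I p g G ->
  germ_on I p (fun t => f t * g t) (fun h => F h * G h).
Proof.
  intros [sF hF] [sG hG]. split; [now apply smooth_R_mult|].
  unfold within in *. generalize (filter_and _ _ hF hG); apply filter_imp.
  intros h [e1 e2] Ih. now rewrite e1, e2.
Qed.

Lemma germ_on_comp I p f g F : smooth_R g -> germ_on I p f F -> germ_on I p (fun t => g (f t)) (fun h => g (F h)).
Proof.
  intros sg [sF hF]. split; [now apply smooth_R_comp|].
  unfold within in *. revert hF; apply filter_imp. intros h e Ih. now rewrite e.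
Qed.

Lemma germ_on_const I p c : germ_on I p (fun _ => c) (fun _ => c).
Proof. split; [apply smooth_R_const|]. apply filter_forall; auto. Qed.

Theorem proposition2p3
  (I : R -> Prop) (hI : is_interval I) (hI0 : I 0)
  (l : R -> R) (hl : smooth_on I l)
  (hP : is_discrete (fun t => I t /\ l t = 0))
  (H : R -> R) (hH : smooth_on (fun t => I t /\ l t <> 0) H)
  (lH : R -> R) (hlH : smooth_on I lH)
  (hlH_ext : forall t, I t -> l t <> 0 -> lH t = l t * H t)
  (c1 c2 : R)
  (hc : forall t, I t -> (Fint l lH t - c1) ^ 2 + (Gint l lH t - c2) ^ 2 > 0)
  (x y : R -> R)
  (hy : forall t, I t ->
    y t = sqrt ((Fint l lH t - c1) ^ 2 + (Gint l lH t - c2) ^ 2))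
  (hx : forall t, I t -> is_derive_in I x t
    ((Derive_in I (Fint l lH) t * (Gint l lH t - c2)
      - Derive_in I (Gint l lH) t * (Fint l lH t - c1)) / y t))
  (p : R) (hp : I p) (hlp : l p = 0) :
  let gamma := fun t => (x t, y t) in
  let l' := Derive_n_in I l 1 p in
  let l'' := Derive_n_in I l 2 p in
  let eta' := Derive_n_in I (eta lH) 1 p in
  let eta'' := Derive_n_in I (eta lH) 2 p in
  let eta''' := Derive_n_in I (eta lH) 3 p in
  (is_cusp 3 2 I gamma p <-> l' * eta' <> 0) /\
  (is_cusp 5 2 I gamma p <->
     l' <> 0 /\ eta' = 0 /\ l'' * eta'' - l' * eta''' <> 0) /\
  (is_cusp 4 3 I gamma p <-> l' = 0 /\ eta' * l'' <> 0) /\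
  (is_cusp 5 3 I gamma p <-> l' = 0 /\ eta' = 0 /\ eta'' * l'' <> 0).
Proof.
  intros gamma l' l'' eta' eta'' eta'''.
  set (gE := eta lH). set (gF := Fint l lH). set (gG := Gint l lH).
  assert (germs_l : has_germs I l) by (intros q hq; now apply smooth_on_germ).
  assert (germs_2lH : has_germs I (fun v => 2 * lH v)).
  { intros q hq. destruct (smooth_on_germ I lH q hlH hq) as [G hG].
    eexists. apply germ_on_mult; [apply germ_on_const|exact hG]. }
  assert (germs_E : has_germs I gE) by now apply has_germs_RInt.
  assert (germs_F' : has_germs I (fun u => l u * sin (gE u))).
  { intros q hq. destruct (germs_l q hq) as [G1 h1]. destruct (germs_E q hq) as [G2 h2].
    eexists. apply germ_on_mult; [exact h1|]. apply (germ_on_comp I q gE sin); eauto using smooth_R_sin. }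
  assert (germs_G' : has_germs I (fun u => l u * cos (gE u))).
  { intros q hq. destruct (germs_l q hq) as [G1 h1]. destruct (germs_E q hq) as [G2 h2].
    eexists. apply germ_on_mult; [exact h1|]. apply (germ_on_comp I q gE cos); eauto using smooth_R_cos. }
  destruct (germs_l p hp) as [L hL]. destruct (germs_2lH p hp) as [N hN].
  set (E := fun h => gE p + RInt N 0 h).
  assert (hE : germ_on I p gE E) by now apply germ_RInt.
  assert (hF' : germ_on I p (fun u => l u * sin (gE u)) (fun h => L h * sin (E h))).
  { apply germ_on_mult; auto. apply (germ_on_comp I p gE sin); auto using smooth_R_sin. }
  assert (hG' : germ_on I p (fun u => l u * cos (gE u)) (fun h => L h * cos (E h))).
  { apply germ_on_mult; auto. apply (germ_on_comp I p gE cos); auto using smooth_R_cos. }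
  assert (hF : germ_on I p gF (fun h => gF p + RInt (fun h => L h * sin (E h)) 0 h)).
  { apply (germ_RInt I hI (fun u => l u * sin (gE u))); auto. }
  assert (hG : germ_on I p gG (fun h => gG p + RInt (fun h => L h * cos (E h)) 0 h)).
  { apply (germ_RInt I hI (fun u => l u * cos (gE u))); auto. }
  (* [A] and [B] are the recentred germs of [F - c1] and [G - c2], the constants being carried into
     the primitives. *)
  set (A := fun h => gF p - c1 + RInt (fun h => L h * sin (E h)) 0 h).
  set (B := fun h => gG p - c2 + RInt (fun h => L h * cos (E h)) 0 h).
  assert (sL : smooth_R L) by apply hL. assert (sN : smooth_R N) by apply hN.
  assert (sE : smooth_R E) by apply hE.
  assert (sLs : smooth_R (fun h => L h * sin (E h))) by apply hF'.
  assert (sLc : smooth_R (fun h => L h * cos (E h))) by apply hG'.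
  assert (sA : smooth_R A) by now apply smooth_R_RInt.
  assert (sB : smooth_R B) by now apply smooth_R_RInt.
  assert (dE : forall h, is_derive E h (N h)) by (intros; now apply is_derive_RInt_smooth).
  assert (dA : forall h, is_derive A h (L h * sin (E h))).
  { intros h. apply (is_derive_RInt_smooth (fun h => L h * sin (E h))); auto. }
  assert (dB : forall h, is_derive B h (L h * cos (E h))).
  { intros h. apply (is_derive_RInt_smooth (fun h => L h * cos (E h))); auto. }
  assert (dF : forall h, Derive (fun h => gF p + RInt (fun h => L h * sin (E h)) 0 h) h = L h * sin (E h)).
  { intros h. apply is_derive_unique. apply (is_derive_RInt_smooth (fun h => L h * sin (E h))); auto. }
  assert (dG : forall h, Derive (fun h => gG p + RInt (fun h => L h * cos (E h)) 0 h) h = L h * cos (E h)).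
  { intros h. apply is_derive_unique. apply (is_derive_RInt_smooth (fun h => L h * cos (E h))); auto. }
  assert (A0 : A 0 = gF p - c1) by (unfold A; rewrite RInt_point; apply Rplus_0_r).
  assert (B0 : B 0 = gG p - c2) by (unfold B; rewrite RInt_point; apply Rplus_0_r).
  assert (hpos : 0 < A 0 ^ 2 + B 0 ^ 2) by (rewrite A0, B0; apply (hc p hp)).
  assert (L0 : L 0 = 0) by (rewrite <- (germ_on_value I p l L hp hL); auto).
  assert (hAB : within (fun h => I (p + h)) (locally 0) (fun h => gF (p + h) - c1 = A h /\ gG (p + h) - c2 = B h)).
  { destruct hF as [_ hF]. destruct hG as [_ hG]. unfold within in *.
    generalize (filter_and _ _ hF hG); apply filter_imp. intros h [e1 e2] Ih.
    rewrite e1, e2 by auto. unfold A, B. split; ring. }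
  assert (sq : smooth_R (fun h => A h ^ 2 + B h ^ 2)) by solve_smooth.
  (* The prescribed [x'] with [F' = l * sin eta] and [G' = l * cos eta] inserted. It is known to be
     smooth only near the origin, where the radicand is positive, so it is extended before being
     integrated. *)
  set (vx := fun h => L h * ((B h * sin (E h) - A h * cos (E h)) / sqrt (A h ^ 2 + B h ^ 2))).
  destruct (smooth_R_extension vx) as [W [sW hW]].
  { assert (ss := smooth_R_sin). assert (sc := smooth_R_cos).
    apply (smooth_near_mult (V := R_NormedModule)); [now apply smooth_R_near|].
    apply (smooth_near_div (V := R_NormedModule)).
    - apply Rgt_not_eq, sqrt_lt_R0; auto.
    - apply smooth_R_near. solve_smooth.
    - apply (smooth_near_comp (V := R_NormedModule) (fun h => A h ^ 2 + B h ^ 2) sqrt); [now apply smooth_R_near|].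
      now apply smooth_near_sqrt. }
  set (xs := fun h => 0 + RInt W 0 h).
  assert (sxs : smooth_R xs) by now apply smooth_R_RInt.
  assert (dxs : forall h, is_derive xs h (W h)) by (intros; now apply is_derive_RInt_smooth).
  assert (xs0 : xs 0 = 0) by (unfold xs; rewrite RInt_point; apply Rplus_0_r).
  assert (hder : within (fun h => I (p + h)) (locally 0) (fun h => is_derive_in I x (p + h) (W h))).
  { assert (kF := germ_is_derive_in I p gF _ hF). assert (kG := germ_is_derive_in I p gG _ hG).
    unfold within in *.
    generalize (filter_and _ _ (filter_and _ _ kF kG) (filter_and _ _ hAB hW)); apply filter_imp.
    intros h [[k1 k2] [k3 k4]] Ih. specialize (k1 Ih). specialize (k2 Ih). destruct (k3 Ih) as [e1 e2].
    rewrite dF in k1. rewrite dG in k2.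
    assert (k := hx (p + h) Ih). fold gF gG in k.
    rewrite (Derive_in_eq I hI gF _ _ Ih k1), (Derive_in_eq I hI gG _ _ Ih k2), (hy _ Ih) in k.
    fold gF gG in k. rewrite e1, e2 in k. rewrite k4. unfold vx.
    replace (L h * ((B h * sin (E h) - A h * cos (E h)) / sqrt (A h ^ 2 + B h ^ 2)))
      with ((L h * sin (E h) * B h - L h * cos (E h) * A h) / sqrt (A h ^ 2 + B h ^ 2)); auto.
    unfold Rdiv. ring. }
  (* [x] is given through its derivative along [I]; its difference with the primitive [xs] has
     derivative zero there, endpoints included, hence is constant. *)
  assert (hxs : within (fun h => I (p + h)) (locally 0) (fun h => x (p + h) - x p = xs h)).
  { destruct hder as [d hd]. exists d.
    refine (_ : forall h : R, Rabs (h - 0) < d -> I (p + h) -> x (p + h) - x p = xs h).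
    intros h hh Ih. rewrite Rminus_0_r in hh.
    assert (e : x p - xs (p - p) = x (p + h) - xs (p + h - p)).
    { apply (constant_of_derive_in_0 I hI (fun t => x t - xs (t - p))); auto.
      intros t ht.
      assert (It : I t) by (apply (interval_mem I hI p (p + h)); auto).
      assert (k1 : is_derive_in I x t (W (t - p))).
      { replace t with (p + (t - p)) at 1 by ring. apply hd.
        - change (Rabs (t - p - 0) < d). revert ht hh. unfold Rmin, Rmax.
          destruct (Rle_dec p (p + h)); unfold Rabs;
            destruct (Rcase_abs (t - p - 0)), (Rcase_abs h); lra.
        - now replace (p + (t - p)) with t by ring. }
      assert (k2 : is_derive_in I (fun t => xs (t - p)) t (W (t - p))).
      { apply (is_derive_in_ext I (fun t => xs (t - p)) (fun t => xs (t - p))); auto.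
        - apply filter_forall; auto.
        - replace (W (t - p)) with (1 * W (t - p)) by ring.
          apply (is_derive_comp xs (fun t => t - p)); auto. auto_derive; auto; ring. }
      unfold is_derive_in in *.
      apply filterdiff_ext_lin with (fun h : R => minus (scal h (W (t - p))) (scal h (W (t - p)))).
      - apply (filterdiff_minus_fct x (fun t => xs (t - p)) (fun h : R => scal h (W (t - p)))
          (fun h : R => scal h (W (t - p)))); auto.
      - intros s. unfold minus, plus, opp, scal; simpl; unfold mult; simpl. ring. }
    replace (p - p) with 0 in e by ring. replace (p + h - p) with h in e by ring. lra. }
  assert (hy' : within (fun h => I (p + h)) (locally 0)
    (fun h => y (p + h) = sqrt (A h ^ 2 + B h ^ 2))).
  { unfold within in *. revert hAB; apply filter_imp. intros h e Ih. destruct (e Ih) as [e1 e2].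
    rewrite (hy _ Ih). fold gF gG. now rewrite e1, e2. }
  assert (hyp : y p = sqrt (A 0 ^ 2 + B 0 ^ 2)) by (rewrite (hy p hp), A0, B0; reflexivity).
  (* Both components of the velocity contain the factor [l], which vanishes at [p]. The singularity
     clause of [is_cusp] therefore holds in all four cases, and only the equivalence of germs is
     left. *)
  assert (singular : is_derive_in I gamma p zero).
  { assert (k1 : is_derive_in I x p 0).
    { unfold within in hder. apply locally_singleton in hder. rewrite Rplus_0_r in hder.
      specialize (hder hp). rewrite (locally_singleton _ _ hW) in hder. unfold vx in hder.
      now rewrite L0, Rmult_0_l in hder. }
    assert (k2 : is_derive_in I y p 0).
    { apply (is_derive_in_ext I y (fun t => sqrt (A (t - p) ^ 2 + B (t - p) ^ 2))); auto.
      - destruct hy' as [d hd]. exists d.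
        refine (_ : forall t : R, Rabs (t - p) < d -> I t -> sqrt (A (t - p) ^ 2 + B (t - p) ^ 2) = y t).
        intros t ht It. replace (y t) with (y (p + (t - p))) by (f_equal; ring). symmetry. apply hd.
        + change (Rabs (t - p - 0) < d). now rewrite Rminus_0_r.
        + now replace (p + (t - p)) with t by ring.
      - assert (hq : is_derive (fun h => A h ^ 2 + B h ^ 2) 0 0).
        { assert (exA : ex_derive A 0) by (eexists; apply dA). assert (exB : ex_derive B 0) by (eexists; apply dB).
          auto_derive; [tauto|].
          change (Derive (fun x => A x) 0) with (Derive A 0). change (Derive (fun x => B x) 0) with (Derive B 0).
          rewrite (is_derive_unique _ _ _ (dA 0)), (is_derive_unique _ _ _ (dB 0)), L0. ring. }
        assert (k2 : is_derive (fun t => sqrt (A (t - p) ^ 2 + B (t - p) ^ 2)) p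
          (1 * (0 / (2 * sqrt (A 0 ^ 2 + B 0 ^ 2))))).
        { apply (is_derive_comp (fun h => sqrt (A h ^ 2 + B h ^ 2)) (fun t => t - p)).
          - replace (p - p) with 0 by ring. now apply (is_derive_sqrt (fun h => A h ^ 2 + B h ^ 2)).
          - auto_derive; auto; ring. }
        now replace (1 * (0 / (2 * sqrt (A 0 ^ 2 + B 0 ^ 2)))) with 0 in k2 by (unfold Rdiv; ring). }
    unfold is_derive_in in *.
    apply filterdiff_ext_lin with (fun h : R => (scal h 0, scal h 0)).
    - apply (@filterdiff_pair R_NormedModule R_NormedModule R_NormedModule); auto. typeclasses eauto.
    - reflexivity. }
  assert (cusp_iff : forall j i, is_cusp j i I gamma p <-> A_equivalent (V := R_NormedModule) (fun h : R => I (p + h))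
    (fun h : R => minus (gamma (p + h)) (gamma p)) (fun t : R => (t ^ i, t ^ j))).
  { intros j i. unfold is_cusp. tauto. }
  assert (el' : l' = Derive L 0).
  { apply (germ_on_value I p (Derive_n_in I l 1) (Derive_n L 1) hp). now apply germ_Derive_n_in. }
  assert (el'' : l'' = Derive_n L 2 0).
  { apply (germ_on_value I p (Derive_n_in I l 2) (Derive_n L 2) hp). now apply germ_Derive_n_in. }
  assert (eE : forall h, Derive E h = N h) by (intros; now apply is_derive_unique).
  assert (ee' : eta' = N 0).
  { rewrite <- eE. apply (germ_on_value I p (Derive_n_in I gE 1) (Derive_n E 1) hp). now apply germ_Derive_n_in. }
  assert (ee'' : eta'' = Derive N 0).
  { rewrite <- (Derive_ext _ _ _ eE). apply (germ_on_value I p (Derive_n_in I gE 2) (Derive_n E 2) hp). now apply germ_Derive_n_in. }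
  assert (ee''' : eta''' = Derive_n N 2 0).
  { transitivity (Derive_n E 3 0).
    - apply (germ_on_value I p (Derive_n_in I gE 3) (Derive_n E 3) hp). now apply germ_Derive_n_in.
    - simpl. apply Derive_ext. intros h. apply Derive_ext. apply eE. }
  destruct (germ_cusps L N E A B xs l' l'' eta' eta'' eta''' sL sN sE sA sB sxs)
    with (D := fun h => I (p + h)) (f := fun h : R => minus (gamma (p + h)) (gamma p))
    as [k1 [k2 [k3 k4]]].
  - apply filter_forall; auto.
  - apply filter_forall; auto.
  - apply filter_forall; auto.
  - exact hpos.
  - exact xs0.
  - revert hW; apply filter_imp. intros h e. change (is_derive xs h (vx h)). rewrite <- e. apply dxs.
  - generalize (smooth_taylor_3 L sL). apply bigO_eq. intros t. rewrite el', el'', L0. ring.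
  - generalize (smooth_taylor_3 N sN). apply bigO_eq. intros t. rewrite ee', ee'', ee'''. ring.
  - now apply accum_interval.
  - unfold within in *. generalize (filter_and _ _ hxs hy'); apply filter_imp. intros h [e1 e2] Ih.
    split; [exact (e1 Ih)|]. change (y (p + h) - y p = sqrt (A h ^ 2 + B h ^ 2) - sqrt (A 0 ^ 2 + B 0 ^ 2)).
    now rewrite (e2 Ih), hyp.
  - rewrite !cusp_iff. auto.
Qed.
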